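(* Fix $T$ with $1<T<\tfrac43$. Consider the PD process on the infinite square grid $\mathbb{Z}^2$ with initial configuration $C_0$ in which the set of cooperators is a connected set of exactly $4$ vertices and all other vertices are defectors. Then the expected number of cooperators in the stable configuration reached is bounded above by $$\sum_{j>0}\left(\tfrac78\right)^j\tfrac18\left((6j+8)^2+(6j+7)^2\right)<8919.$$
   Context: A configuration on a graph $G=(V,E)$ is a map $C:V\to\{0,1\}$; $1$ means cooperator, $0$ means defector. The pay-off $f(a,b)$ to a player with strategy $a$ against strategy $b$ is $f(0,0)=0$, $f(0,1)=T$, $f(1,0)=0$, $f(1,1)=1$. The score of $v$ is $s(v)=\sum_{x\in N(v)} f(C(v),C(x))$. The most successful neighbours of $v$ are the vertices of $N[v]$ of maximum score (defectors taken as most successful in case of a tie between a cooperator and a defector). A vertex is weak if its strategy differs from that of its most successful neighbours; updating a vertex changes its strategy if it is currently weak and does nothing otherwise. PD process: given $C_t$, let $W_t$ be the (here finite) set of weak vertices; if $W_t=\emptyset$ the process stops and $C_t$ is stable. Otherwise a uniformly random ordering of $W_t$ is chosen and the vertices are updated one at a time in that order, each with respect to the current configuration, producing $C_{t+1}$. The grid $\mathbb{Z}^2$ has vertices the integer points, adjacent when at Euclidean distance $1$. *)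

(* Defs.v *)
From HB Require Import structures.
From mathcomp Require Import all_boot all_order all_algebra finmap.
From mathcomp Require Import all_classical all_reals all_analysis.
Set Implicit Arguments.
Unset Strict Implicit.
Unset Printing Implicit Defensive.
Import Order.TTheory GRing.Theory Num.Theory.
Local Open Scope classical_set_scope.
Local Open Scope ring_scope.

Section Graph.
Context (V : choiceType) (adj : rel V).

(* Connectedness of the subgraph induced on A. *)
Definition connected_in (A : {fset V}) : Prop :=
  forall u v, u \in A -> v \in A ->
  exists p : seq V, [/\ path adj u p, {subset p <= A} & last u p = v].

(* [true] is a cooperator, [false] a defector. *)
Definition config := V -> bool.

Definition cooperators (c : config) : set V := [set v | c v].

Context (R : realType) (T : R).

(* Payoff to a player with strategy [a] against strategy [b]. *)
Definition payoff (a b : bool) : R :=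
  match a, b with
  | false, false => 0
  | false, true => T
  | true, false => 0
  | true, true => 1
  end.

Definition nbhood (v : V) : set V := [set x | adj v x].

Definition closed_nbhood (v : V) : set V := v |` nbhood v.

(* A finitely supported sum: the graph has to be locally finite. *)
Definition score (c : config) (v : V) : R :=
  \sum_(x \in nbhood v) payoff (c v) (c x).

Definition top_scorers (c : config) (v : V) : set V :=
  [set w | closed_nbhood v w /\
     forall x, closed_nbhood v x -> score c x <= score c w].

(* If some top scorer is a defector, only the defecting ones are kept. *)
Definition most_successful (c : config) (v : V) : set V :=
  [set w | top_scorers c v w /\
     ((exists2 x, top_scorers c v x & ~~ c x) -> ~~ c w)].

(* All the most successful neighbours of v share one strategy. *)
Definition weak (c : config) (v : V) : Prop :=
  exists2 w, most_successful c v w & c w != c v.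

Definition stable (c : config) : Prop := forall v, ~ weak c v.

Definition update (c : config) (v : V) : config :=
  fun x => if (x == v) && `[< weak c v >] then ~~ c x else c x.

(* s lists every weak vertex of c exactly once. *)
Definition weak_ordering (c : config) (s : seq V) : Prop :=
  uniq s /\ (forall v, v \in s <-> weak c v).

(* The configuration C_t obtained from c0 when C_i is updated in the
   order h i, for i < t. *)
Fixpoint evolve (c0 : config) (h : nat -> seq V) (t : nat) : config :=
  if t is t'.+1 then foldl update (evolve c0 h t') (h t') else c0.

Context (d : measure_display) (Omega : measurableType d)
  (P : probability Omega R).

(* [sigma t] is the random ordering of the weak vertices W_t used at time t.
   Given the orderings used before time t, it is uniform among the |W_t|!
   orderings of W_t, where |W_t| is the size of any of them.  Once W_t is empty,
   [sigma t] is the empty list and the configuration is constant from then on,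
   which encodes that the process has stopped. *)
Record PD_process (c0 : config) (sigma : nat -> Omega -> seq V) : Prop := {
  PD_measurable : forall t s, measurable [set w | sigma t w = s];
  PD_ordering : forall t w,
    weak_ordering (evolve c0 (sigma ^~ w) t) (sigma t w);
  PD_uniform : forall (h : nat -> seq V) t,
    weak_ordering (evolve c0 h t) (h t) ->
    P [set w | forall i, (i <= t)%N -> sigma i w = h i] =
    (P [set w | forall i, (i < t)%N -> sigma i w = h i] *
     (((size (h t))`!)%:R^-1)%:E)%E
}.

Definition stops (c0 : config) (h : nat -> seq V) : Prop :=
  exists t, stable (evolve c0 h t).

(* First time at which there is no weak vertex (0 if the process never stops). *)
Definition stop_time (c0 : config) (h : nat -> seq V) : nat :=
  xget 0%N [set t | stable (evolve c0 h t) /\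
                    forall i, (i < t)%N -> ~ stable (evolve c0 h i)].

Definition final_config (c0 : config) (h : nat -> seq V) : config :=
  evolve c0 h (stop_time c0 h).

End Graph.

(* The points u and v of Z^2 are at Euclidean distance 1. *)
Definition grid : rel (int * int) :=
  fun u v => (u.1 - v.1) ^+ 2 + (u.2 - v.2) ^+ 2 == 1.

(* For c with finitely many cooperators; 0 otherwise. *)
Definition num_cooperators (V : choiceType) (c : config V) : nat :=
  #|` fset_set (cooperators c)|%fset.

(* Main.v *)
Require Import Defs.
From HB Require Import structures.
From Stdlib Require Import ZArith Lia.
From mathcomp Require Import all_boot all_order all_algebra finmap.
From mathcomp Require Import all_classical all_reals all_analysis.
From mathcomp Require Import measurable_realfun ssrZ zify ring lra.
Set Implicit Arguments. Unset Strict Implicit. Unset Printing Implicit Defensive.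
Import Order.TTheory GRing.Theory Num.Theory.
Delimit Scope Z_scope with BZ.

(* For 1 < T < 4/3 only the numbers of cooperating neighbours matter. After at most one round the
   cooperators either form one of a few degenerate shapes or fill a kind of octagon: rows and
   columns are intervals, d k are its extents in the four diagonal directions and h k those in the
   four axis directions. The slack U k = d k + d k.+1 - 2 h k.+1 - 1 is nonnegative, and its sum over
   the four tips, which is 0, 2 or 4, never increases. In one round every diagonal side and every
   tip advances by at most one; whether they advance depends only on which weak cell of each tip
   comes first in the random order, so a tabulated weight V satisfies
   E[V(U') (21/20)^n'] <= V(U) (21/20)^n, with n the sum of the d k. At most n^2 / 4 cells are
   cooperators, and an unstable round adds at least one. Hence V(U) (21/20)^n minus the number of
   cooperators, suitably scaled, dominates this number and has drift at most -1 until the process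
   stops. So it stops almost surely, and Fatou's lemma bounds the expected final number of
   cooperators by 8004, while the series is 8918.875. *)

(** Updates within a round are sequential, so the outcome depends on the order. It stays tractable
    because weak defectors are of two kinds. Those next to a cooperator with three cooperating
    neighbours flip in every order, since convexity keeps every defector at two. The others lie
    above an end of a top row and see one cooperator, of count two; there the first cell updated
    flips and later ones cannot change the extents. Swapping two cells above the same tip preserves
    the uniform law of the order, so the first picks at the four tips are uniform and independent,
    and the drift inequality becomes a finite check over slack vectors. The main obstacle is total
    slack 4: for at most 2 the extents alone keep top rows short enough for convexity to survive a
    round, for 4 they do not. That value occurs only after a start from the 2 x 2 square, whose
    growth is therefore followed in detail: a pinwheel that either completes a turn and starts again
    one level higher or loses slack. The base 21/20 is close enough to 1 for a weight table without
    upward drift, while its powers still exceed n^2 / 1000. *)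

Ltac zar := repeat match goal with
  | H : is_true (~~ _) |- _ => clear H
  | H : is_true (_ ?a _) |- _ => match type of a with Z => clear H end
  | H : forall _, _ |- _ => clear H
  end; lia.

(** * Weakness in terms of neighbour counts, symmetries, and the shape invariants *)

Section Configurations.
Local Open Scope Z_scope.
Implicit Types f c g : Z -> Z -> bool.

Definition coop_nb f x y : Z :=
  Z.b2z (f (x + 1) y) + Z.b2z (f (x + -1) y) +
  Z.b2z (f x (y + 1)) + Z.b2z (f x (y + -1)).

Variant near (x y : Z) : Z -> Z -> Prop :=
| adjE : near x y (x + 1) y
| adjW : near x y (x + -1) y
| adjN : near x y x (y + 1)
| adjS : near x y x (y + -1).

(** The value -1 lies below every neighbour count, so vertices of the other strategy drop out of the
    maximum in [top_rank]. *)
Definition rank_as (a : bool) f x y : Z := if f x y == a then coop_nb f x y else -1.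

Definition top_rank (a : bool) f x y : Z :=
  Z.max (rank_as a f x y) (Z.max (Z.max (rank_as a f (x + 1) y) (rank_as a f (x + -1) y))
    (Z.max (rank_as a f x (y + 1)) (rank_as a f x (y + -1)))).

(* For 1 < T < 4/3 a defector with k cooperating neighbours scores at least as much as a cooperator
   with k of them and, when k < 4, less than a cooperator with k + 1. *)
Definition weakb f x y : bool :=
  f x y (+) (top_rank false f x y <? top_rank true f x y).

Definition flip_weak f (z : Z * Z) : Z -> Z -> bool :=
  fun x y => if ((x =? z.1) && (y =? z.2)) && weakb f z.1 z.2 then ~~ f x y else f x y.

Lemma nb_ge0 f x y : 0 <= coop_nb f x y <= 4.
Proof. rewrite /coop_nb; lia. Qed.

Lemma rk_ge f x y a : -1 <= rank_as a f x y.
Proof. rewrite /rank_as; have := nb_ge0 f x y; case: eqP; lia. Qed.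

Lemma rk_eq f x y a : f x y = a -> rank_as a f x y = coop_nb f x y.
Proof. by rewrite /rank_as => ->; rewrite eqxx. Qed.

Lemma top_ge a f x y u v : near x y u v \/ (u = x /\ v = y) -> rank_as a f u v <= top_rank a f x y.
Proof. rewrite /top_rank => -[[]|[-> ->]]; lia. Qed.

Lemma top_ex a f x y : exists u v, (near x y u v \/ (u = x /\ v = y)) /\
  rank_as a f u v = top_rank a f x y.
Proof.
have [e|[e|[e|[e|e]]]] : top_rank a f x y = rank_as a f x y \/
  top_rank a f x y = rank_as a f (x+1) y \/ top_rank a f x y = rank_as a f (x+ -1) y \/
  top_rank a f x y = rank_as a f x (y+1) \/ top_rank a f x y = rank_as a f x (y+ -1).
  by rewrite /top_rank; lia.
- by exists x, y; split; [right|rewrite -e].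
- by exists (x+1), y; split; [left; constructor|rewrite -e].
- by exists (x+ -1), y; split; [left; constructor|rewrite -e].
- by exists x, (y+1); split; [left; constructor|rewrite -e].
- by exists x, (y+ -1); split; [left; constructor|rewrite -e].
Qed.

Lemma wkDP f x y : ~~ f x y -> weakb f x y <->
  exists u v, [/\ near x y u v, f u v, coop_nb f x y < coop_nb f u v &
    forall u' v', near x y u' v' -> ~~ f u' v' -> coop_nb f u' v' < coop_nb f u v].
Proof.
move=> fF; rewrite /weakb (negbTE fF) addFb; split => [/Z.ltb_spec0 H|].
  have [u [v [nr e]]] := top_ex true f x y.
  have f0 := @top_ge false f x y x y (or_intror (conj erefl erefl)).
  rewrite (rk_eq (negbTE fF)) in f0; have g0 := nb_ge0 f x y.
  have fu : f u v by case: (boolP (f u v)) e => // /negbTE K; rewrite /rank_as K /=; lia.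
  rewrite (rk_eq fu) in e; case: nr => [nr|[eu ev]]; last first.
    by move: fF; rewrite -eu -ev fu.
  exists u, v; split => //; first lia.
  move=> u' v' nr' fu'; have := @top_ge false f x y u' v' (or_introl nr').
  by rewrite (rk_eq (negbTE fu')); lia.
move=> [u [v [nr fu l K]]]; apply/Z.ltb_spec0.
have [u' [v' [nr' <-]]] := top_ex false f x y.
have := @top_ge true f x y u v (or_introl nr); rewrite (rk_eq fu).
have := nb_ge0 f u v; rewrite {1}/rank_as; case: eqP => [e|]; last lia.
case: nr' => [nr'|[-> ->]]; last lia.
by have := K _ _ nr' (negbT e); lia.
Qed.

Lemma wkC f x y : f x y -> weakb f x y ->
  exists u v, [/\ near x y u v, ~~ f u v, coop_nb f x y <= coop_nb f u v &
    forall u' v', near x y u' v' -> f u' v' -> coop_nb f u' v' <= coop_nb f u v].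
Proof.
move=> fT; rewrite /weakb fT /=; case: Z.ltb_spec0 => // H _.
have [u [v [nr e]]] := top_ex false f x y.
have f0 := @top_ge true f x y x y (or_intror (conj erefl erefl)).
rewrite (rk_eq fT) in f0; have g0 := nb_ge0 f x y.
have fu : ~~ f u v by case: (boolP (f u v)) e => // K; rewrite /rank_as K /=; lia.
rewrite (rk_eq (negbTE fu)) in e; case: nr => [nr|[eu ev]]; last first.
  by move: fu; rewrite eu ev fT.
exists u, v; split => //; first lia.
move=> u' v' nr' fu'; have := @top_ge true f x y u' v' (or_introl nr').
by rewrite (rk_eq fu'); lia.
Qed.

(* Reflections about the centre (1/2, 1/2) of the square [0, 1] x [0, 1], which is the start of the regime [spiral]. *)
Definition tr f : Z -> Z -> bool := fun x y => f y x.
Definition fl f : Z -> Z -> bool := fun x y => f (- x + 1) y.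
Definition fv f : Z -> Z -> bool := fun x y => f x (- y + 1).

Lemma zNP x : x + -1 + 1 = x. Proof. lia. Qed.
Lemma zPN x : x + 1 + -1 = x. Proof. lia. Qed.
Lemma zPP x : x + 1 + 1 = x + 2. Proof. lia. Qed.
Lemma zNN x : x + -1 + -1 = x + -2. Proof. lia. Qed.
Definition zE := (zNP, zPN, zPP, zNN).

Lemma fl1K x : - (- x + 1) + 1 = x. Proof. lia. Qed.
Lemma fl1D x k : - (- x + 1 + k) + 1 = x + - k. Proof. lia. Qed.
Lemma fl1S x k : - (x + k) + 1 = - x + 1 + - k. Proof. lia. Qed.

Lemma flK f : fl (fl f) = f.
Proof. by apply/funext => x; apply/funext => y; rewrite /fl fl1K. Qed.
Lemma fl_fv f : fl (fv f) = fv (fl f). Proof. by []. Qed.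

Lemma nb_tr f x y : coop_nb (tr f) x y = coop_nb f y x.
Proof. rewrite /coop_nb /tr; lia. Qed.
Lemma nb_fl f x y : coop_nb (fl f) x y = coop_nb f (- x + 1) y.
Proof. rewrite /coop_nb /fl !fl1S /=; lia. Qed.
Lemma nb_fv f x y : coop_nb (fv f) x y = coop_nb f x (- y + 1).
Proof. rewrite /coop_nb /fv !fl1S /=; lia. Qed.

Lemma rk_tr a f x y : rank_as a (tr f) x y = rank_as a f y x.
Proof. by rewrite /rank_as nb_tr. Qed.
Lemma rk_fl a f x y : rank_as a (fl f) x y = rank_as a f (- x + 1) y.
Proof. by rewrite /rank_as nb_fl. Qed.
Lemma top_tr a f x y : top_rank a (tr f) x y = top_rank a f y x.
Proof.
have H (p q r s t : Z) : Z.max p (Z.max (Z.max q r) (Z.max s t)) =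
   Z.max p (Z.max (Z.max s t) (Z.max q r)) by lia.
rewrite /top_rank !(rk_tr a f); exact: H.
Qed.
Lemma top_fl a f x y : top_rank a (fl f) x y = top_rank a f (- x + 1) y.
Proof.
have H (p q r s t : Z) : Z.max p (Z.max (Z.max q r) (Z.max s t)) =
   Z.max p (Z.max (Z.max r q) (Z.max s t)) by lia.
rewrite /top_rank !(rk_fl a f) !fl1S; exact: H.
Qed.
Lemma wkb_tr f x y : weakb (tr f) x y = weakb f y x.
Proof. by rewrite /weakb !(top_tr _ f). Qed.
Lemma wkb_fl f x y : weakb (fl f) x y = weakb f (- x + 1) y.
Proof. by rewrite /weakb !(top_fl _ f). Qed.
Lemma wkb_fv f x y : weakb (fv f) x y = weakb f x (- y + 1).
Proof. by rewrite -[fv f]/(tr (fl (tr f))) wkb_tr wkb_fl wkb_tr. Qed.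

(** The eight symmetries of the square. With [allfP], an argument written for the top side serves
    all sides and both orientations. *)
Definition all_frames (P : (Z -> Z -> bool) -> Prop) f :=
  [/\ P f, P (fl f), P (fv f) & P (fl (fv f))] /\
  [/\ P (tr f), P (tr (fl f)), P (tr (fv f)) & P (tr (fl (fv f)))].

Lemma allf_id P f : all_frames P f -> P f. Proof. by case=> -[]. Qed.
Lemma allf_tr P f : all_frames P f -> all_frames P (tr f).
Proof. by case=> -[? ? ? ?] [? ? ? ?]; split; split. Qed.
Lemma allf_fl P f : all_frames P f -> all_frames P (fl f).
Proof.
by case=> -[? ? ? ?] [? ? ? ?]; split; split; rewrite -?fl_fv ?flK.
Qed.
Lemma allf_fv P f : all_frames P f -> all_frames P (fv f).
Proof. by move=> H; apply: (@allf_tr _ (fl (tr f))); apply/allf_fl/allf_tr. Qed.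

Lemma allfP P (I : (Z -> Z -> bool) -> Prop) f :
  (forall f, I f -> I (tr f)) -> (forall f, I f -> I (fl f)) ->
  (forall f, I f -> P f) -> I f -> all_frames P f.
Proof.
move=> It If IP H; have Iv h : I h -> I (fv h) by move=> /It/If/It.
by split; split; apply: IP; auto 6.
Qed.

Definition row_itv f := forall x1 x2 x y, f x1 y -> f x2 y -> x1 <= x <= x2 -> f x y.
Definition row_lap f := forall x x' y y', f x y -> f x' y' -> y < y' ->
  exists z, f z y /\ f z (y + 1).
Definition thick f := forall a b y, f a (y + 1) -> f b (y + -1) ->
  exists x, f x y /\ f (x + 1) y.
(** If [(p, h + 1)] is the left end of its row and [(p, h)] is filled, then row [h] reaches at most
    two cells further left. Boundary steps are thus short, which keeps the sides roughly
    diagonal. *)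
Definition no_kink f := forall p h, f p h -> f (p + -1) h -> f (p + -2) h ->
  f (p + -3) h -> f p (h + 1) -> f (p + -1) (h + 1).
(** Prevents two separated cells above the same top row from flipping in one round, which would
    destroy convexity; see [hv_gap]. *)
Definition tip_ok f := forall x h, (forall z, ~~ f z (h + 1)) ->
  f x h -> f (x + 1) h -> f (x + 2) h -> ~~ f (x + 3) h && ~~ weakb f (x + 3) h.
Definition core f := forall x y, f x y -> 3 <= coop_nb f x y \/
  exists u v, [/\ near x y u v, f u v & 3 <= coop_nb f u v].
Definition is_square f := forall x y, f x y = ((0 <=? x) && (x <=? 1)) && ((0 <=? y) && (y <=? 1)).
Definition bounded f := exists B, forall x y, f x y -> (- B <= x <= B) /\ (- B <= y <= B).

Record shape1 f : Prop := Shape1 {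
  sh_itv : row_itv f; sh_lap : row_lap f; sh_thick : thick f; sh_kink : no_kink f }.

Record inv f : Prop := Inv {
  inv_sh : all_frames shape1 f; inv_tips : all_frames tip_ok f; inv_core : core f \/ is_square f;
  inv_fin : bounded f; inv_ne : exists x y, f x y }.

Lemma near_tr x y u v : near x y u v -> near y x v u.
Proof. by case; constructor. Qed.
Lemma near_fl x y u v : near x y u v -> near (- x + 1) y (- u + 1) v.
Proof. by case; rewrite ?fl1S /=; constructor. Qed.

Lemma core_tr f : core f -> core (tr f).
Proof.
move=> H x y /H [h|[u [v [n fu h]]]]; first by left; rewrite (nb_tr f).
by right; exists v, u; rewrite (nb_tr f); split => //; apply: near_tr.
Qed.
Lemma core_fl f : core f -> core (fl f).
Proof.
move=> H x y /H [h|[u [v [n fu h]]]]; first by left; rewrite (nb_fl f).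
right; exists (- u + 1), v; rewrite (nb_fl f) /fl fl1K; split => //.
by have := near_fl n; rewrite fl1K.
Qed.
Lemma sq4_tr f : is_square f -> is_square (tr f).
Proof. by move=> H x y; rewrite /tr H andbC. Qed.
Lemma sq4_fl f : is_square f -> is_square (fl f).
Proof. by move=> H x y; rewrite /fl H; lia. Qed.
Lemma fin_tr f : bounded f -> bounded (tr f).
Proof. by case=> B H; exists B => x y /H; lia. Qed.
Lemma fin_fl f : bounded f -> bounded (fl f).
Proof. by case=> B H; exists (Z.abs B + 1) => x y /H; lia. Qed.

Lemma inv_tr f : inv f -> inv (tr f).
Proof.
case=> s t c n [x [y h]]; split; [exact: allf_tr|exact: allf_tr| |exact: fin_tr|by exists y, x].
by case: c => [/core_tr|/sq4_tr]; [left|right].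
Qed.
Lemma inv_fl f : inv f -> inv (fl f).
Proof.
case=> s t c n [x [y h]]; split; [exact: allf_fl|exact: allf_fl| |exact: fin_fl|].
  by case: c => [/core_fl|/sq4_fl]; [left|right].
by exists (- x + 1), y; rewrite /fl fl1K.
Qed.
Lemma inv_fv f : inv f -> inv (fv f).
Proof. by move=> /inv_tr/inv_fl/inv_tr. Qed.
Lemma inv1 f : inv f -> shape1 f. Proof. by case=> /allf_id. Qed.
Lemma inv_tip f : inv f -> tip_ok f. Proof. by case=> _ /allf_id. Qed.

Definition hv_convex f := row_itv f /\ row_itv (tr f).
Lemma hv_tr f : hv_convex f -> hv_convex (tr f). Proof. by case. Qed.
Lemma hv_fl f : hv_convex f -> hv_convex (fl f).
Proof.
case=> a b; split.
  by move=> x1 x2 x y /= h1 h2 h3; apply: (a _ _ _ _ h2 h1); lia.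
by move=> x1 x2 x y /= h1 h2 h3; apply: (b _ _ _ _ h1 h2); lia.
Qed.
Lemma inv_hv f : inv f -> hv_convex f.
Proof. by move=> If; split; apply: sh_itv; apply: inv1 => //; apply: inv_tr. Qed.

Lemma hv_nbD f x y : hv_convex f -> ~~ f x y -> coop_nb f x y <= 2.
Proof.
move=> [a b] h.
have A : f (x + 1) y && f (x + -1) y = false.
  by apply: contraNF h => /andP[h1 h2]; apply: (a _ _ _ _ h2 h1); lia.
have B : f x (y + 1) && f x (y + -1) = false.
  by apply: contraNF h => /andP[h1 h2]; apply: (b _ _ _ _ h2 h1); lia.
rewrite /coop_nb; lia.
Qed.

(** A defecting cell of this kind stays weak while the configuration grows and remains convex, so it
    flips whatever the order. *)
Definition mover f x y := exists u v, [/\ near x y u v, f u v & 3 <= coop_nb f u v].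

Lemma mover_tr f x y : mover f x y -> mover (tr f) y x.
Proof.
by case=> u [v [n h k]]; exists v, u; rewrite (nb_tr f); split=> //; apply: near_tr.
Qed.
Lemma mover_fl f x y : mover f x y -> mover (fl f) (- x + 1) y.
Proof.
case=> u [v [n h k]]; exists (- u + 1), v; rewrite (nb_fl f) /fl fl1K; split=> //.
exact: near_fl.
Qed.

Lemma mover_wk f x y : hv_convex f -> ~~ f x y -> mover f x y -> weakb f x y.
Proof.
move=> hf h [u [v [n fu k]]]; apply/wkDP => //; exists u, v; split => //.
  by have := hv_nbD hf h; lia.
by move=> u' v' _ h'; have := hv_nbD hf h'; lia.
Qed.

(** If row [y] had a cell to the right, overlapping rows and [no_kink] would place its left end at
    distance two, and the defector in between would have as many cooperating neighbours as the only
    cooperator seen from [(x, y)]. The left side follows by reflection. *)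
Lemma row_empty f x y : all_frames shape1 f -> ~~ f x y -> weakb f x y -> f x (y + -1) ->
  coop_nb f x y = 1 -> forall z, ~~ f z y.
Proof.
move=> If h w b n1.
suff H g x0 : all_frames shape1 g -> ~~ g x0 y -> weakb g x0 y -> g x0 (y + -1) ->
  coop_nb g x0 y = 1 -> forall z, x0 < z -> ~~ g z y.
  move=> z; have [l|[->//|l]] : x < z \/ z = x \/ z < x by zar.
    exact: H If h w b n1 _ l.
  have := H (fl f) (- x + 1) (allf_fl If); rewrite (nb_fl f) (wkb_fl f) /fl fl1K.
  move=> /(_ h w b n1 (- z + 1)); rewrite fl1K; apply; zar.
move=> {If h w b n1} Ig h w b n1 z l; apply/negP => gz.
have [ai al at_ ak] := allf_id Ig.
have [u []] : exists u, g u (y + -1) /\ g u (y + -1 + 1).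
  by apply: al b gz _; zar.
have -> : y + -1 + 1 = y by zar.
move=> gu1 gu.
have nR : ~~ g (x0 + 1) y by apply/negP => k; move: n1; rewrite /coop_nb k b; lia.
have xu : x0 + 1 < u.
  have [//|k] : x0 + 1 < u \/ u <= x0 + 1 by zar.
  have : g (x0 + 1) y by apply: ai gu gz _; zar.
  by rewrite (negbTE nR).
have [p [gp gp' xp]] : exists p, [/\ g p y, ~~ g (p + -1) y & x0 + 1 < p <= u].
  suff [p [? ? ?]] : exists p, [/\ g p y, ~~ g (p + -1) y & x0 + 1 < p <= u].
    by exists p.
  have [n] := ubnP (Z.to_nat (u - x0)).
  elim: n u {gu1} gu xu => // n IH u gu xu un.
  have [gm|gm] := boolP (g (u + -1) y); last by exists u; split => //; zar.
  have [k|k] : u + -1 = x0 + 1 \/ x0 + 1 < u + -1 by zar.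
    by rewrite -k gm in nR.
  have [|p [? ? ?]] := IH _ gm k; first zar.
  by exists p; split => //; zar.
have r k : x0 <= k <= u -> g k (y + -1) by apply: ai b gu1.
have K := ak p (y + -1); move: K.
have -> : y + -1 + 1 = y by zar.
rewrite (negbTE gp') => K.
(* Otherwise [no_kink] at [p] would fill [(p - 1, y)]. Hence [(x0 + 1, y)] has count at least two
   and [(x0, y - 1)] at most two, against weakness. *)
have e : p = x0 + 2 /\ ~~ g (x0 + -1) (y + -1).
  have [k|k] : x0 + 3 <= p \/ p = x0 + 2 by zar.
    by have : false; [apply: K => //; apply: r; zar|].
  split=> //; apply/negP => k'.
  suff : false by []; apply: K => //; try (by apply: r; zar).
  by have -> : p + -3 = x0 + -1 by zar.
case: e => e nW; move: w => /(wkDP h) [c [d [nr gc n2 K']]].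
have [ec ed] : c = x0 /\ d = y + -1.
  move: n1 gc b; case: nr => //; rewrite /coop_nb => n1 gc b; exfalso;
    clear -n1 gc b; lia.
subst c d; have := K' (x0 + 1) y (adjE _ _) nR.
have e1 : g (x0 + 1 + 1) y by have <- : p = x0 + 1 + 1 by zar.
have e2 : g (x0 + 1) (y + -1) by apply: r; zar.
rewrite /coop_nb e1 e2 (negbTE nW) zNP (negbTE h); clear; lia.
Qed.

End Configurations.

(** * Classification of the weak cells, and configurations met during a round *)

Section WeakCells.
Local Open Scope Z_scope.
Implicit Types f c g : Z -> Z -> bool.

(** Convexity limits a defector to two cooperating neighbours, while [core] shows each cooperator a
    count of three in its closed neighbourhood. In the square the cooperators have count two and the
    adjacent defectors count one. *)
Lemma noC f x y : inv f -> f x y -> ~~ weakb f x y.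
Proof.
move=> If fx; apply/negP => /(wkC fx) [u [v [nr fu n1 K]]].
have hu := hv_nbD (inv_hv If) fu.
case: If => _ _ [co|sq] _ _.
  case: (co _ _ fx) => [|[u' [v' [nr' fu' h]]]]; first lia.
  by have := K _ _ nr' fu'; lia.
clear K; move: fx fu n1; rewrite /coop_nb !sq; case: nr; clear; lia.
Qed.

Lemma wk_nbr f x y : ~~ f x y -> weakb f x y -> exists u v, near x y u v /\ f u v.
Proof. by move=> h /(wkDP h)[u [v [n fu _ _]]]; exists u, v. Qed.

Lemma up_empty f a y : row_lap f -> f a (y + -1) -> (forall z, ~~ f z y) ->
  forall z y', y <= y' -> ~~ f z y'.
Proof.
move=> rl fa e z y' l; apply/negP => fz.
have [u []] := rl _ _ _ _ fa fz ltac:(zar); rewrite zNP => _ fu.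
by rewrite (negbTE (e _)) in fu.
Qed.

Lemma tip3 f x x' h : tip_ok f -> row_itv f -> (forall z, ~~ f z (h + 1)) ->
  f x h -> f x' h -> x' <= x + 2.
Proof.
move=> tk ri e h1 h2; have [//|k] : x' <= x + 2 \/ x + 3 <= x' by zar.
have r z : x <= z <= x' -> f z h by apply: ri.
have := tk x h e h1; rewrite !r /=; zar.
Qed.

(** The cell above the right end of a top row. That end has count exactly two, just enough to
    convert [(x, y)]; by [weak_cases] these cells are, up to symmetry, the only weak ones besides
    movers. *)
Definition tip_end f x y := [/\ forall z, ~~ f z y, f x (y + -1), f (x + -1) (y + -1),
  ~~ f (x + 1) (y + -1) & f x (y + -2)].
Definition tipcell f x y := tip_end f x y \/ tip_end (fl f) (- x + 1) y.

(** Without the cell below the middle one, [core] would force cells below both ends, and row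
    convexity would fill the gap between them. *)
Lemma mid3_below f x h : inv f -> (forall z, ~~ f z (h + 1)) ->
  f (x + -1) h -> f x h -> f (x + 1) h ->
  [/\ f x (h + -1), ~~ f (x + 2) h & ~~ f (x + -2) h].
Proof.
move=> If e cL b cR; have [ri _ _ _] := inv1 If; have tk := inv_tip If.
have nR : ~~ f (x + 2) h.
  have := tk (x + -1) _ e cL; rewrite -!Z.add_assoc /= Z.add_0_r => /(_ b cR).
  by case/andP.
have nL : ~~ f (x + -2) h.
  apply/negP => k; have := tip3 tk ri e k cR; zar.
split => //; apply/negPn/negP => b2.
case: If => _ _ [co|sq] _ _; last by clear -b cL cR sq; move: b cL cR; rewrite !sq; lia.
have n2 : coop_nb f x h <= 2 by rewrite /coop_nb (negbTE (e _)) (negbTE b2); clear; lia.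
have bL : f (x + -1) (h + -1).
  case: (co _ _ cL) => [|[u [v [nr fu]]]].
    by rewrite /coop_nb !zE (negbTE nL) (negbTE (e _)); clear; lia.
  by case: nr fu; rewrite ?zE // ?(negbTE nL) ?(negbTE (e _)) //; move: n2; clear; zar.
have bR : f (x + 1) (h + -1).
  case: (co _ _ cR) => [|[u [v [nr fu]]]].
    by rewrite /coop_nb !zE (negbTE nR) (negbTE (e _)); clear; lia.
  by case: nr fu; rewrite ?zE // ?(negbTE nR) ?(negbTE (e _)) //; move: n2; clear; zar.
by move: b2; rewrite (ri _ _ x _ bL bR) //; zar.
Qed.

Lemma cls_S f x y : inv f -> ~~ f x y -> weakb f x y -> f x (y + -1) ->
  coop_nb f x y = 1 -> coop_nb f x (y + -1) = 2 -> tipcell f x y.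
Proof.
move=> If h w b n1 n2; have e := row_empty (inv_sh If) h w b n1.
have e' : forall z, ~~ f z (y + -1 + 1) by rewrite zNP.
have [cL|cL] := boolP (f (x + -1) (y + -1)); have [cR|cR] := boolP (f (x + 1) (y + -1)).
- have [b2 _ _] := mid3_below If e' cL b cR; rewrite zNN in b2.
  by move: n2; rewrite /coop_nb cL cR !zE b2 (negbTE h); clear; lia.
- left; split=> //; move: n2; rewrite /coop_nb cL (negbTE cR) !zE (negbTE h).
  by clear; lia.
- right; split=> //; rewrite /fl ?fl1D ?fl1K //.
  by move: n2; rewrite /coop_nb (negbTE cL) cR !zE (negbTE h); clear; lia.
- exfalso; move: n2; rewrite /coop_nb (negbTE cL) (negbTE cR) !zE (negbTE h).
  by clear; lia.
Qed.

(** The converting cooperator has a count above that of the cell, which is at least one. If it is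
    not three or more, the two counts are 2 and 1, and [row_empty] makes the cell lie beyond a tip
    in one of the four directions. *)
Lemma weak_cases f x y : inv f -> ~~ f x y -> weakb f x y ->
  mover f x y \/ (coop_nb f x y = 1 /\
  ((coop_nb f x (y + -1) = 2 /\ f x (y + -1) /\ tipcell f x y) \/
   (coop_nb f x (y + 1) = 2 /\ f x (y + 1) /\ tipcell (fv f) x (- y + 1)) \/
   (coop_nb f (x + -1) y = 2 /\ f (x + -1) y /\ tipcell (tr f) y x) \/
   (coop_nb f (x + 1) y = 2 /\ f (x + 1) y /\ tipcell (fv (tr f)) y (- x + 1)))).
Proof.
move=> If h w; have [u [v [nr fu n1 _]]] := (wkDP h).1 w.
have [m|m] : 3 <= coop_nb f u v \/ coop_nb f u v <= 2 by zar.
  by left; exists u, v.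
have n0 : coop_nb f x y = 1.
  have : 1 <= coop_nb f x y by case: nr fu n1 m => fu _ _; rewrite /coop_nb fu; clear; lia.
  zar.
have n2 : coop_nb f u v = 2 by zar.
right; split=> //; case: nr fu n2 {n1 m} => fu n2.
- do 3!right; split => //; split => //.
  apply: (cls_S (inv_fv (inv_tr If))); rewrite ?(nb_fv (tr f)) ?(nb_tr f)
    ?(wkb_fv (tr f)) ?(wkb_tr f) /fv /tr ?fl1D ?fl1K //.
- do 2!right; left; split => //; split => //.
  by apply: (cls_S (inv_tr If)); rewrite ?(nb_tr f) ?(wkb_tr f).
- right; left; split => //; split => //.
  by apply: (cls_S (inv_fv If)); rewrite ?(nb_fv f) ?(wkb_fv f) /fv ?fl1D ?fl1K.
- by left; split => //; split => //; apply: cls_S.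
Qed.

(** Otherwise its cooperating neighbours are vertical, only one by column convexity, and [row_empty]
    contradicts the nonempty row. *)
Lemma row_near f x y : inv f -> ~~ f x y -> weakb f x y -> (exists z, f z y) ->
  f (x + 1) y \/ f (x + -1) y.
Proof.
move=> If h w [z fz]; apply: contrapT => /not_orP [/negP k1 /negP k2].
have [_ ci] := inv_hv If.
have nv : ~~ (f x (y + 1) && f x (y + -1)).
  apply/negP => /andP[h1 h2]; move/negP: h; apply.
  by apply: (ci _ _ _ _ h2 h1); zar.
have [u [v [nr fu]]] := wk_nbr h w.
case: nr fu => fu; rewrite ?fu // in k1 k2.
- rewrite fu /= in nv; have := @row_empty (fv f) x (- y + 1) (allf_fv (inv_sh If)).
  rewrite (nb_fv f) (wkb_fv f) /fv ?fl1D ?fl1K => /(_ h w fu) /=.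
  rewrite /coop_nb (negbTE k1) (negbTE k2) (negbTE nv) fu.
  by move=> /(_ erefl z); rewrite ?fl1K fz.
- rewrite fu andbT in nv; have := row_empty (inv_sh If) h w fu.
  rewrite /coop_nb (negbTE k1) (negbTE k2) (negbTE nv) fu.
  by move=> /(_ erefl z); rewrite fz.
Qed.

(* Invariants of a configuration c met in the course of a round that starts from f. *)
Definition mid_round f c := [/\ forall x y, f x y -> c x y,
  forall x y, c x y -> f x y \/ (~~ f x y /\ weakb f x y) & hv_convex c].

Lemma mid_tr f c : mid_round f c -> mid_round (tr f) (tr c).
Proof.
case=> a b h; split; [by move=> x y /a| |exact: hv_tr].
by move=> x y /b; rewrite (wkb_tr f).
Qed.
Lemma mid_fl f c : mid_round f c -> mid_round (fl f) (fl c).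
Proof.
case=> a b h; split; [by move=> x y /a| |exact: hv_fl].
by move=> x y /b; rewrite (wkb_fl f).
Qed.
Lemma mid_fv f c : mid_round f c -> mid_round (fv f) (fv c).
Proof. by move=> /mid_tr/mid_fl/mid_tr. Qed.
Lemma mid_refl f : inv f -> mid_round f f.
Proof. by move=> If; split => //; [left|exact: inv_hv]. Qed.

Lemma nb_mono f c x y : (forall x y, f x y -> c x y) -> coop_nb f x y <= coop_nb c x y.
Proof.
move=> h; have H u v : Z.b2z (f u v) <= Z.b2z (c u v).
  by case: (f u v) (h u v) => [->|] //; case: (c u v).
rewrite /coop_nb; have := H (x+1) y; have := H (x+ -1) y; have := H x (y+1).
by have := H x (y+ -1); clear; lia.
Qed.

Lemma mover_mid f c x y : mid_round f c -> mover f x y -> mover c x y.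
Proof.
case=> fc _ _ [u [v [nr fu n]]]; exists u, v; split; rewrite ?fc //.
by have := @nb_mono f c u v fc; zar.
Qed.

Lemma mid_below f c x y a : inv f -> mid_round f c -> (forall z, ~~ f z y) ->
  f a (y + -1) -> c x y -> f x (y + -1).
Proof.
move=> If [fc cw _] e fa cx.
have [//|[h w]] := cw _ _ cx; first by rewrite (negbTE (e _)).
have [u [v [nr fu]]] := wk_nbr h w; have := up_empty (sh_lap (inv1 If)) fa e.
by case: nr fu => fu K //; rewrite (negbTE (K _ _ _)) // in fu; zar.
Qed.

Lemma mid_up f c x y y' a : inv f -> mid_round f c -> (forall z, ~~ f z y) ->
  f a (y + -1) -> y + 1 <= y' -> ~~ c x y'.
Proof.
move=> If [fc cw _] e fa l; apply/negP => cx.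
have K := up_empty (sh_lap (inv1 If)) fa e.
have [|[h w]] := cw _ _ cx; first by rewrite (negbTE (K _ _ _)) //; zar.
have [u [v [nr fu]]] := wk_nbr h w.
by case: nr fu => fu; rewrite (negbTE (K _ _ _)) // in fu; zar.
Qed.

(** The first weak cell reached in an empty row is certain to flip: either it is a mover, or its
    defecting neighbours still have count at most one while the cooperator beside it keeps count at
    least two. *)
Lemma step_first f c x y : inv f -> mid_round f c -> ~~ f x y -> weakb f x y ->
  (forall a, ~~ f a y) -> (forall a, ~~ c a y) -> weakb c x y.
Proof.
move=> If mc h w e ec.
suff H f' c' y' : inv f' -> mid_round f' c' -> f' x (y' + -1) -> ~~ f' x y' -> weakb f' x y' ->
  (forall a, ~~ f' a y') -> (forall a, ~~ c' a y') -> weakb c' x y'.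
  have [u [v [nr fu]]] := wk_nbr h w; case: nr fu => fu.
  - by rewrite (negbTE (e _)) in fu.
  - by rewrite (negbTE (e _)) in fu.
  - rewrite -[y]fl1K -(wkb_fv c); apply: (H (fv f)); rewrite /fv ?fl1D ?fl1K //.
    + exact: inv_fv.
    + exact: mid_fv.
    + by rewrite (wkb_fv f) fl1K.
  - exact: (H f).
move=> {h w e ec If mc} If mc fu h w e ec; move: (mc) => [fc cw hc].
have cu := fc _ _ fu.
case: (weak_cases If h w) => [m|[n1 K]].
  exact: (mover_wk hc (ec _) (mover_mid mc m)).
have n2 : 2 <= coop_nb c' x (y' + -1).
  apply: (@Z.le_trans _ (coop_nb f' x (y' + -1))); last exact: nb_mono.
  case: K => [[-> //]|[[_ [k _]]|[[_ [k _]]|[_ [k _]]]]].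
  - by move: n1; rewrite /coop_nb fu k; clear; lia.
  - by rewrite (negbTE (e _)) in k.
  - by rewrite (negbTE (e _)) in k.
have ec' a : c' a y' = false by apply/negbTE.
have up a v : y' + 1 <= v -> c' a v = false.
  by move=> l; apply/negbTE; exact: (@mid_up f' c' a y' v x If mc e fu l).
apply/wkDP => //; exists x, (y' + -1); split => //; first by constructor.
  by rewrite {1}/coop_nb !ec' (up _ (y' + 1)) ?cu; clear -n2; simpl; zar.
move=> u v nr du; apply: (@Z.le_lt_trans _ 1); last zar.
case: nr du => du.
- by rewrite /coop_nb !ec' !(up _ (y' + 1)); clear; lia.
- by rewrite /coop_nb !ec' !(up _ (y' + 1)); clear; lia.
- by rewrite /coop_nb !zE !ec' !(up _ (y' + 1)) ?(up _ (y' + 2)); clear; lia.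
- by rewrite cu in du.
Qed.
End WeakCells.

(** * Sequential updates within one round *)

Section MidRound.
Local Open Scope Z_scope.
Implicit Types f c g : Z -> Z -> bool.

(** In a nonempty row new cells touch the old interval. In an empty one the tip below has at most
    three cells, so only the middle can be missing; it has count two, and [tip_ok] leaves the
    cooperator below [(x, y)] with count at most two, so [(x, y)] is no longer weak. *)
Lemma hv_gap f c x y x1 a : inv f -> mid_round f c -> ~~ f x y -> weakb f x y ->
  ~~ c x y -> weakb c x y -> c x1 y -> x1 < a < x -> c a y.
Proof.
move=> If mc h w k kw c1 l.
have [[z fz]|e] := pselect (exists z, f z y).
  have [fc cw _] := mc; apply: fc.
  have ri := sh_itv (inv1 If).
  have q := row_near If h w (ex_intro _ z fz).
  have p : f x1 y \/ f (x1 + 1) y \/ f (x1 + -1) y.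
    have [|[h1 w1]] := cw _ _ c1; [by left|right].
    exact: (row_near If h1 w1 (ex_intro _ z fz)).
  by case: q => q; case: p => [p|[p|p]]; apply: (ri _ _ _ _ p q); zar.
have {}e z : ~~ f z y by apply/negP => fz; apply: e; exists z.
suff H f' c' y' : inv f' -> mid_round f' c' -> f' x (y' + -1) -> (forall z, ~~ f' z y') ->
    weakb f' x y' -> ~~ c' x y' -> weakb c' x y' -> c' x1 y' -> c' a y'.
  have [u [v [nr fu]]] := wk_nbr h w; case: nr fu => fu.
  - by rewrite (negbTE (e _)) in fu.
  - by rewrite (negbTE (e _)) in fu.
  - have := H (fv f) (fv c) (- y + 1) (inv_fv If) (mid_fv mc).
    rewrite (wkb_fv f) (wkb_fv c) /fv ?fl1D ?fl1K /=; exact.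
  - exact: (H f).
move=> {If mc h w k kw c1 e} If mc fu e w k kw c1.
have [fc cw hc] := mc; have [ri rl _ _] := inv1 If; have tk := inv_tip If.
have e' : forall z, ~~ f' z (y' + -1 + 1) by rewrite zNP.
have f1 := mid_below If mc e fu c1.
have lx := tip3 tk ri e' f1 fu.
have [ea ex] : a = x1 + 1 /\ x = x1 + 2 by zar.
subst a x; apply/negPn/negP => na.
have f2 : f' (x1 + 1) (y' + -1) by apply: (ri _ _ _ _ f1 fu); zar.
have /andP[fr fw] := tk x1 _ e' f1 f2 fu.
have cr : ~~ c' (x1 + 3) (y' + -1).
  by apply/negP => /cw []; [rewrite (negbTE fr)|rewrite (negbTE fw); case].
have [u [v [nr cu n1 n2]]] := (wkDP k).1 kw.
have ex : x1 + 2 + -1 = x1 + 1 by zar.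
have {}n2 : 2 < coop_nb c' u v.
  apply: Z.le_lt_trans (n2 (x1 + 1) y' _ na); last by rewrite -ex; constructor.
  by rewrite /coop_nb zPN c1 (fc _ _ f2); clear; lia.
case: nr cu n1 n2 => cu n1 n2.
- have := mid_below If mc e fu cu.
  by rewrite -Z.add_assoc (negbTE fr).
- by rewrite ex (negbTE na) in cu.
- by rewrite (negbTE (@mid_up f' c' _ y' (y' + 1) _ If mc e fu _)) // in cu; zar.
- move: n2; rewrite /coop_nb zNP (negbTE k) (_ : x1 + 2 + 1 = x1 + 3) ?(negbTE cr); last zar.
  by clear; lia.
Qed.

Definition add_cell c x y : Z -> Z -> bool := fun a b => c a b || ((a =? x) && (b =? y)).

Lemma setc_tr c x y : tr (add_cell c x y) = add_cell (tr c) y x.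
Proof. by apply/funext => a; apply/funext => b; rewrite /tr /add_cell andbC. Qed.

Lemma hv_step f c x y : inv f -> mid_round f c -> ~~ f x y -> weakb f x y ->
  ~~ c x y -> weakb c x y -> row_itv (add_cell c x y).
Proof.
move=> If mc h w k kw x1 x2 a b; have [_ _ [ci _]] := mc.
rewrite /add_cell; case: (Z.eqb_spec b y) => [->|_]; last by rewrite !andbF !orbF; exact: ci.
rewrite !andbT => /orP[c1|/Z.eqb_spec e1] /orP[c2|/Z.eqb_spec e2] l; apply/orP.
- by left; apply: ci c1 c2 l.
- case: (Z.eqb_spec a x) => [_|ne]; [by right|left].
  have [->//|ne'] : a = x1 \/ a <> x1 by zar.
  by apply: (hv_gap If mc h w k kw c1); zar.
- case: (Z.eqb_spec a x) => [_|ne]; [by right|left].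
  have [->//|ne'] : a = x2 \/ a <> x2 by zar.
  have := @hv_gap (fl f) (fl c) (- x + 1) y (- x2 + 1) (- a + 1) (inv_fl If) (mid_fl mc).
  rewrite (wkb_fl f) (wkb_fl c) /fl !fl1K; apply => //; zar.
- by right; apply/Z.eqb_spec; zar.
Qed.

Lemma mid_step f c x y : inv f -> mid_round f c -> ~~ f x y -> weakb f x y ->
  ~~ c x y -> weakb c x y -> mid_round f (add_cell c x y).
Proof.
move=> If mc h w k kw; have [fc cw hc] := mc; split.
- by move=> a b /fc; rewrite /add_cell => ->.
- move=> a b; rewrite /add_cell => /orP[/cw //|/andP[/Z.eqb_spec -> /Z.eqb_spec ->]].
  by right.
split; first exact: hv_step If mc h w k kw.
by rewrite setc_tr; apply: (hv_step (inv_tr If) (mid_tr mc)); rewrite ?(wkb_tr f) ?(wkb_tr c).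
Qed.

(** An earlier pick in row [y] lies at [x - 1] or [x - 2]. It gives count two to [(x, y)] itself or
    to its defecting neighbour [(x - 1, y)], while the cooperator below has at most two. So such a
    cell flips only as the first pick of its tip. *)
Lemma ext_row f c x y : inv f -> mid_round f c -> ~~ c x y -> weakb c x y -> tip_end f x y ->
  ~~ c (x + 1) (y + -1) -> forall a, ~~ c a y.
Proof.
move=> If mc k kw [e fu fL fR _] cR a; apply/negP => ca.
have [fc cw hc] := mc; have [ri rl _ _] := inv1 If; have tk := inv_tip If.
have e' : forall z, ~~ f z (y + -1 + 1) by rewrite zNP.
have fa := mid_below If mc e fu ca.
have la : a < x.
  have [//|[e1|l]] : a < x \/ a = x \/ x + 1 <= a by zar.
    by move: k; rewrite -e1 ca.
  by move: fR; rewrite (ri _ _ (x + 1) _ fu fa) //; zar.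
have lx := tip3 tk ri e' fa fu.
have up u : c u (y + 1) = false.
  by apply/negbTE; apply: (@mid_up f c u y (y + 1) x If mc e fu); zar.
have [u [v [nr cu n1 n2]]] := (wkDP k).1 kw.
have n3 : coop_nb c u v <= 2.
  case: nr cu {n1 n2} => cu.
  - by have := mid_below If mc e fu cu; rewrite (negbTE fR).
  - by rewrite /coop_nb zNP (negbTE k) up; clear; lia.
  - by rewrite up in cu.
  - by rewrite /coop_nb zNP (negbTE k) (negbTE cR); clear; lia.
have [cm|cm] := boolP (c (x + -1) y).
  by move: n1; rewrite {1}/coop_nb cm (fc _ _ fu); clear -n3; lia.
have ea : a = x + -2.
  have [//|e1] : a = x + -2 \/ a = x + -1 by zar.
  by rewrite -e1 ca in cm.
have := n2 _ _ (adjW x y) cm; rewrite {1}/coop_nb zNN -ea ca (fc _ _ fL).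
by clear -n3; lia.
Qed.

Lemma ext_step f c x y M : inv f -> mid_round f c -> (forall x y, c x y -> x + y <= M) ->
  ~~ f x y -> weakb f x y -> ~~ c x y -> weakb c x y -> M < x + y ->
  (tip_end f x y /\ forall a, ~~ c a y) \/ (tip_end (tr f) y x /\ forall a, ~~ c x a).
Proof.
move=> If mc cM h w k kw l.
have [fc cw hc] := mc.
have fN u v : M < u + v -> f u v = false.
  by move=> l'; apply/negP => /fc/cM; zar.
have F f' c' x' y' : inv f' -> mid_round f' c' -> (forall x y, c' x y -> x + y <= M) ->
  ~~ c' x' y' -> weakb c' x' y' -> M < x' + y' -> tipcell f' x' y' ->
  tip_end f' x' y' /\ forall a, ~~ c' a y'.
  move=> If' mc' cM' k' kw' l' [dr|[_ _ fr _ _]].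
    split => //; apply: (ext_row If' mc' k' kw' dr).
    by apply/negP => /cM'; zar.
  have [fc' _ _] := mc'.
  by move: fr; rewrite /fl fl1D /= => /fc'/cM'; zar.
case: (weak_cases If h w) => [[u [v [nr fu n]]]|[_ K]].
  have n' : coop_nb f u v <= 2; last by zar.
  case: nr fu {n} => fu; try by rewrite fN in fu; zar.
    by rewrite /coop_nb zNP (negbTE h) (fN _ (y + 1)); [clear; lia|zar].
  by rewrite /coop_nb zNP (negbTE h) (fN (x + 1)); [clear; lia|zar].
case: K => [[_ [_ t]]|[[_ [fu _]]|[[_ [_ t]]|[_ [fu _]]]]].
- left; apply: F => //.
- by rewrite fN in fu; zar.
- right; apply: (F (tr f) (tr c)) => //; [exact: inv_tr|exact: mid_tr| | |].
  + by move=> a b /cM; zar.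
  + by rewrite (wkb_tr c).
  + by zar.
- by rewrite fN in fu; zar.
Qed.

Definition run f (s : seq (Z * Z)) := foldl flip_weak f s.
Definition first_in_row (y : Z) (s : seq (Z * Z)) := ohead [seq z <- s | z.2 =? y].
Definition first_in_col (x : Z) (s : seq (Z * Z)) := ohead [seq z <- s | z.1 =? x].

Lemma upd_set c z : ~~ c z.1 z.2 -> flip_weak c z = if weakb c z.1 z.2 then add_cell c z.1 z.2 else c.
Proof.
move=> k; apply/funext => a; apply/funext => b; rewrite /flip_weak /add_cell.
case: (weakb _ _ _); rewrite ?andbF // andbT.
case: (Z.eqb_spec a z.1) => [->|]; rewrite ?orbF //.
by case: (Z.eqb_spec b z.2) => [->|]; rewrite ?orbF // (negbTE k).
Qed.

Lemma ohead_rcons (T : Type) (s : seq T) z : ohead (rcons s z) =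
  if ohead s is Some z' then Some z' else Some z.
Proof. by case: s. Qed.

(** Stated for a prefix [s] of the order, to allow induction on the last update. By [mr_ext], a
    diagonal extent is exceeded only if the first pick at one of its two adjacent tips already
    exceeds it. *)
Record midrun f (s : seq (Z * Z)) c : Prop := Midrun {
  mr_mid : mid_round f c;
  mr_sub : forall x y, c x y -> f x y \/ (x, y) \in s;
  mr_mov : forall z : Z * Z, z \in s -> mover f z.1 z.2 -> c z.1 z.2;
  mr_fstr : forall y z, (forall a, ~~ f a y) -> first_in_row y s = Some z -> c z.1 z.2;
  mr_fstc : forall x z, (forall a, ~~ f x a) -> first_in_col x s = Some z -> c z.1 z.2;
  mr_core : forall x y, c x y -> ~~ f x y -> mover c x y;
  mr_dbl : forall x y, tip_end f x y -> c x y -> first_in_row y s = Some (x, y) \/ c (x + 1) (y + -1);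
  mr_ext : forall M, (forall x y, f x y -> x + y <= M) -> forall x y, c x y ->
    M < x + y -> exists z, M < z.1 + z.2 /\
     ((first_in_row z.2 s = Some z /\ tip_end f z.1 z.2) \/ (first_in_col z.1 s = Some z /\ tip_end (tr f) z.2 z.1)) }.

Lemma fst_mem y s : first_in_row y s = None -> forall z : Z * Z, z \in s -> z.2 <> y.
Proof.
rewrite /first_in_row; elim: s => //= z s IH; case: Z.eqb_spec => //= ne e u.
by rewrite inE => /orP[/eqP ->|/(IH e)].
Qed.
Lemma fstc_mem y s : first_in_col y s = None -> forall z : Z * Z, z \in s -> z.1 <> y.
Proof.
rewrite /first_in_col; elim: s => //= z s IH; case: Z.eqb_spec => //= ne e u.
by rewrite inE => /orP[/eqP ->|/(IH e)].
Qed.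
Lemma fstr_in y s z : first_in_row y s = Some z -> z \in s /\ z.2 = y.
Proof.
rewrite /first_in_row; elim: s => //= u s IH; case: Z.eqb_spec => //= [e [<-]|_ /IH[h ->]].
  by rewrite inE eqxx.
by rewrite inE h orbT.
Qed.
Lemma fstc_in y s z : first_in_col y s = Some z -> z \in s /\ z.1 = y.
Proof.
rewrite /first_in_col; elim: s => //= u s IH; case: Z.eqb_spec => //= [e [<-]|_ /IH[h ->]].
  by rewrite inE eqxx.
by rewrite inE h orbT.
Qed.

Lemma mover_mono f c x y : (forall x y, f x y -> c x y) -> mover f x y -> mover c x y.
Proof.
move=> fc [u [v [nr fu n]]]; exists u, v; split; rewrite ?fc //.
by have := @nb_mono f c u v fc; zar.
Qed.

Lemma midrunP f s : inv f -> uniq s -> (forall z : Z * Z, z \in s -> ~~ f z.1 z.2 /\ weakb f z.1 z.2) ->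
  midrun f s (run f s).
Proof.
move=> If; elim/last_ind: s => [|s z IH].
  move=> _ _; split => //; first exact: mid_refl.
  - by left.
  - by move=> x y; rewrite /run /= => ->.
  - by move=> x y [e _ _ _ _]; rewrite /run /= (negbTE (e _)).
  - by move=> M fM x y; rewrite /run /= => /fM; zar.
rewrite rcons_uniq => /andP[zs us] ws.
have [|mm sub mov fr fcc co db ex] := IH us.
  by move=> u us'; apply: ws; rewrite mem_rcons inE us' orbT.
have [h w] : ~~ f z.1 z.2 /\ weakb f z.1 z.2 by apply: ws; rewrite mem_rcons inE eqxx.
rewrite /run foldl_rcons -/(run f s); move: (run f s) mm sub mov fr fcc co db ex => c.
move=> mm sub mov fr fcc co db ex {IH ws us}.
have k : ~~ c z.1 z.2.
  apply/negP => /sub []; first by rewrite (negbTE h).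
  by rewrite -surjective_pairing (negbTE zs).
rewrite upd_set //; set g := if _ then _ else _.
have cg x y : c x y -> g x y by rewrite /g /add_cell; case: (weakb c _ _) => // ->.
have [fc cw hc] := mm.
have gz : weakb c z.1 z.2 -> g z.1 z.2.
  by rewrite /g => ->; rewrite /add_cell !Z.eqb_refl orbT.
have gE x y : g x y -> ~~ c x y -> weakb c z.1 z.2 /\ (x, y) = z.
  rewrite /g; case: (weakb c _ _) => [|->] //; rewrite /add_cell => /orP[->//|].
  by move=> /andP[/Z.eqb_spec -> /Z.eqb_spec ->] _; rewrite -surjective_pairing.
have rowc y : first_in_row y s = None -> (forall a, ~~ f a y) -> forall a, ~~ c a y.
  move=> fn e a; apply/negP => /sub[]; first by rewrite (negbTE (e _)).
  by move=> /(fst_mem fn).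
have colc x : first_in_col x s = None -> (forall a, ~~ f x a) -> forall a, ~~ c x a.
  move=> fn e a; apply/negP => /sub[]; first by rewrite (negbTE (e _)).
  by move=> /(fstc_mem fn).
split.
- by rewrite /g; case: ifP => // kw; apply: mid_step.
- move=> x y gx; have [/sub[]|cx] := boolP (c x y); [by left| |].
    by rewrite mem_rcons inE => ->; rewrite orbT; right.
  by have [_ ->] := gE _ _ gx cx; right; rewrite mem_rcons inE eqxx.
- move=> u; rewrite mem_rcons inE => /orP[/eqP -> m|us m]; last by apply/cg/mov.
  by apply/gz/mover_wk => //; apply: mover_mono fc m.
- move=> y u e; rewrite /first_in_row filter_rcons; case: Z.eqb_spec => [ey|_]; last first.
    by move=> /(fr _ _ e)/cg.
  rewrite ohead_rcons -/(first_in_row y s); case E: (first_in_row y s) => [u'|] [<-].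
    exact/cg/(fr _ _ e E).
  by apply/gz/(step_first If mm h w) => [a|]; rewrite ey; [exact: e|exact: rowc].
- move=> y u e; rewrite /first_in_col filter_rcons; case: Z.eqb_spec => [ey|_]; last first.
    by move=> /(fcc _ _ e)/cg.
  rewrite ohead_rcons -/(first_in_col y s); case E: (first_in_col y s) => [u'|] [<-].
    exact/cg/(fcc _ _ e E).
  apply/gz; rewrite -(wkb_tr c).
  apply: (step_first (inv_tr If) (mid_tr mm)); rewrite ?(wkb_tr f) //.
    by move=> a; rewrite /tr ey; exact: e.
  by rewrite /tr ey; exact: colc.
- move=> x y gx fx; have [cx|cx] := boolP (c x y).
    exact: mover_mono cg (co _ _ cx fx).
  have [kw e] := gE _ _ gx cx; subst z; move: (gz kw) => /= gz'.
  have [u [v [nr cu n1 _]]] := (wkDP k).1 kw.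
  exists u, v; split => //; first exact: cg.
  (* The converting cooperator [(u, v)] has a count above that of the cell, so at least two; the
     flip itself raises it to three. *)
  have n0 : 1 <= coop_nb c x y.
    by move: cu; clear -nr; case: nr => cu; rewrite /coop_nb cu; lia.
  suff : coop_nb c u v + 1 <= coop_nb g u v by move: n1 => /= n1; zar.
  have H p q : Z.b2z (c p q) <= Z.b2z (g p q).
    by move: (cg p q); case: (c p q) => [->|_] //; case: (g p q).
  have n2 : Z.b2z (c x y) + 1 <= Z.b2z (g x y) by rewrite gz' (negbTE cx).
  have := H (u + 1) v; have := H (u + -1) v; have := H u (v + 1); have := H u (v + -1).
  by move: n2; rewrite /coop_nb; clear -nr; case: nr; rewrite ?zE;
    repeat match goal with |- context[Z.b2z ?e] => move: (Z.b2z e) => ? end; lia.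
- move=> x y dr gx; have [e fu _ _ _] := dr.
  have [cx|cx] := boolP (c x y).
    case: (db _ _ dr cx) => [K|K]; [left|by right; apply: cg].
    by rewrite /first_in_row filter_rcons; case: ifP => // _; rewrite ohead_rcons -/(first_in_row y s) K.
  have [kw ez] := gE _ _ gx cx; subst z.
  have [cR|cR] := boolP (c (x + 1) (y + -1)); [by right; apply: cg|left].
  have K := ext_row If mm k kw dr cR.
  rewrite /first_in_row filter_rcons /= Z.eqb_refl ohead_rcons -/(first_in_row y s).
  case E: (first_in_row y s) => [u|] //; have [us eu] := fstr_in E.
  by have := fr _ _ e E; have := K u.1; rewrite -eu => /negbTE ->.
- move=> M fM x y gx lx.
  have [[a [b [cab l]]]|nM] := pselect (exists a b, c a b /\ M < a + b).
    have [u [lu K]] := ex M fM _ _ cab l; exists u; split => //.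
    by rewrite /first_in_row /first_in_col !filter_rcons; case: K => -[K D]; [left|right]; split => //;
      case: ifP => // _; rewrite ohead_rcons -/(first_in_row _ _) -/(first_in_col _ _) K.
  have cM a b : c a b -> a + b <= M.
    by move=> cab; apply: Znot_gt_le => l; apply: nM; exists a, b; split => //; zar.
  have cx : ~~ c x y by apply/negP => /cM; zar.
  have [kw e] := gE _ _ gx cx; subst z; move: (gz kw) => /= gz'.
  exists (x, y); split => //=.
  case: (ext_step If mm cM h w k kw lx) => /= -[D R]; [left|right]; split => //.
    rewrite /first_in_row filter_rcons /= Z.eqb_refl ohead_rcons -/(first_in_row y s).
    case E: (first_in_row y s) => [u|] //; have [us e] := fstr_in E.
    case: D => D _ _ _ _; have := fr _ _ D E.
    by have := R u.1; rewrite -e => /negbTE ->.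
  rewrite /first_in_col filter_rcons /= Z.eqb_refl ohead_rcons -/(first_in_col x s).
  case E: (first_in_col x s) => [u|] //; have [us e] := fstc_in E.
  case: D => D _ _ _ _; have := fcc _ _ D E.
  by have := R u.2; rewrite -e => /negbTE ->.
Qed.
End MidRound.

(** * Preservation of the shape by a complete round *)

Section Rounds.
Local Open Scope Z_scope.
Implicit Types f c g : Z -> Z -> bool.

(** The consequences of a round that hold for every order; they suffice to preserve [shape1] and
    [core]. *)
Record round f g : Prop := Round {
  rd_mid : mid_round f g;
  rd_mov : forall x y, ~~ f x y -> mover f x y -> g x y;
  rd_row : forall x y, (forall a, ~~ f a y) -> weakb f x y -> exists a, g a y;
  rd_col : forall x y, (forall a, ~~ f x a) -> weakb f x y -> exists a, g x a;
  rd_core : forall x y, g x y -> ~~ f x y -> mover g x y }.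

Lemma round_tr f g : round f g -> round (tr f) (tr g).
Proof.
case=> a b c d e; split; first exact: mid_tr.
- by move=> x y h /mover_tr m; apply: b.
- by move=> x y h; rewrite (wkb_tr f); apply: d.
- by move=> x y h; rewrite (wkb_tr f); apply: c.
- by move=> x y h h'; apply: mover_tr; apply: e.
Qed.
Lemma round_fl f g : round f g -> round (fl f) (fl g).
Proof.
case=> a b c d e; split; first exact: mid_fl.
- by move=> x y h /mover_fl; rewrite flK => m; apply: b.
- move=> x y h; rewrite (wkb_fl f) => w.
  have [u|u gu] := c _ _ _ w; last by exists (- u + 1); rewrite /fl fl1K.
  by have := h (- u + 1); rewrite /fl fl1K.
- by move=> x y h; rewrite (wkb_fl f); apply: d.
- by move=> x y h h'; have := mover_fl (e _ _ h h'); rewrite fl1K.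
Qed.
Lemma round_fv f g : round f g -> round (fv f) (fv g).
Proof. by move=> /round_tr/round_fl/round_tr. Qed.

Lemma inv_itv f x1 x2 x y : inv f -> f x1 y -> f x2 y -> x1 <= x <= x2 -> f x y.
Proof. by move=> /inv1/sh_itv; apply. Qed.

Lemma new_wk f g x y : mid_round f g -> g x y -> ~~ f x y -> weakb f x y.
Proof. by case=> _ K _ /K[->|[]]. Qed.

Lemma new_near f g x y : inv f -> mid_round f g -> (exists z, f z y) -> g x y -> ~~ f x y ->
  f (x + 1) y \/ f (x + -1) y.
Proof. by move=> If mg e gx h; apply: row_near => //; apply: new_wk mg gx h. Qed.

Lemma new_row f g x y : inv f -> mid_round f g -> (forall z, ~~ f z y) -> g x y ->
  (f x (y + -1) /\ forall u v, y + 1 <= v -> ~~ g u v) \/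
  (f x (y + 1) /\ forall u v, v <= y + -1 -> ~~ g u v).
Proof.
move=> If mg e gx; have w := new_wk mg gx (e x).
have [u [v [nr fu]]] := wk_nbr (e x) w; case: nr fu => fu.
- by rewrite (negbTE (e _)) in fu.
- by rewrite (negbTE (e _)) in fu.
- right; split => // a b l.
  have := @mid_up (fv f) (fv g) a (- y + 1) (- b + 1) x (inv_fv If) (mid_fv mg).
  by rewrite /fv fl1D !fl1K; apply => //; zar.
- by left; split => // a b l; exact: (@mid_up f g a y b x If mg e fu l).
Qed.

Lemma row_inner f g x1 x2 x y : inv f -> mid_round f g -> (exists z, f z y) ->
  g x1 y -> g x2 y -> x1 < x < x2 -> f x y.
Proof.
move=> If mg e g1 g2 l.
have N u : g u y -> exists p, f p y /\ u - 1 <= p <= u + 1.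
  move=> gu; have [fu|fu] := boolP (f u y); first by exists u; split => //; zar.
  by have [k|k] := new_near If mg e gu fu;
     [exists (u + 1)|exists (u + -1)]; split => //; zar.
have [p [fp lp]] := N _ g1; have [q [fq lq]] := N _ g2.
by apply: (inv_itv If fp fq); zar.
Qed.

Lemma row_lap_round f g : inv f -> round f g -> row_lap g.
Proof.
move=> If rd x x' y y' g1 g2 l; have mg := rd_mid rd; have [fg _ _] := mg.
have [[b fb]|e] := pselect (exists z, f z y).
  have L u v : f u v -> y < v -> exists z, g z y /\ g z (y + 1).
    move=> fu lv; have [z [h1 h2]] := sh_lap (inv1 If) fb fu lv.
    by exists z; split; apply: fg.
  have [f2|f2] := boolP (f x' y'); first exact: L f2 l.
  have [u [v [nr fu]]] := wk_nbr f2 (new_wk mg g2 f2).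
  case: nr fu => fu; try (apply: L fu _; zar).
  have [k|k] : y < y' + -1 \/ y' = y + 1 by zar.
    exact: L fu k.
  by subst y'; exists x'; split => //; apply: fg; rewrite zPN in fu.
have {}e z : ~~ f z y by apply/negP => fz; apply: e; exists z.
case: (new_row If mg e g1) => -[fx K].
  by rewrite (negbTE (K _ _ _)) // in g2; zar.
by exists x; split => //; apply: fg.
Qed.

(** A cell added in an empty row rests on a cell with a horizontal neighbour, whether it is a mover
    or lies above an end of a top row. *)
Lemma thick_round f g : inv f -> round f g -> thick g.
Proof.
move=> If rd a b y g1 g2.
suff H f' g' a' b' y' : inv f' -> round f' g' -> g' a' (y' + 1) -> g' b' (y' + -1) ->
  (forall z, ~~ f' z (y' + 1)) -> exists x, g' x y' /\ g' (x + 1) y'.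
  have [[z1 h1]|e1] := pselect (exists z, f z (y + 1)); last first.
    by apply: H If rd g1 g2 _ => z; apply/negP => fz; apply: e1; exists z.
  have [[z2 h2]|e2] := pselect (exists z, f z (y + -1)); last first.
    have := H (fv f) (fv g) b a (- y + 1) (inv_fv If) (round_fv rd).
    rewrite /fv !fl1D /= !fl1K => /(_ g2 g1); apply => z; apply/negP => fz.
    by apply: e2; exists z.
  have [fg _ _] := rd_mid rd; have [x [h3 h4]] := sh_thick (inv1 If) h1 h2.
  by exists x; split; apply: fg.
move=> {If rd g1 g2} If rd g1 g2 e; have mg := rd_mid rd; have [fg _ _] := mg.
case: (new_row If mg e g1); rewrite ?zPN => -[fx K]; last first.
  by rewrite (negbTE (K _ _ _)) // in g2; zar.
suff [k|k] : f' (a' + 1) y' \/ f' (a' + -1) y'.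
- by exists a'; split; apply: fg.
- by exists (a' + -1); rewrite zNP; split; apply: fg.
have w := new_wk mg g1 (e _).
have e2 : ~~ f' a' (y' + 1 + 1) by apply/negP => /fg; rewrite (negbTE (K _ _ _)) //; zar.
case: (weak_cases If (e a') w) => [[u [v [nr fu n]]]|[_ [[_ [_]]|[[_ [k _]]|[[_ [k _]]|[_ [k _]]]]]]].
- case: nr fu n; rewrite ?(negbTE (e _)) ?(negbTE e2) // zPN => _.
  have [k1|k1] := boolP (f' (a' + 1) y'); first by left.
  have [k2|k2] := boolP (f' (a' + -1) y'); first by right.
  by rewrite /coop_nb (negbTE k1) (negbTE k2); clear; lia.
- by case=> -[_ _ + _ _]; rewrite (zPN y') /fl ?fl1D => ->; [right|left].
- by rewrite (negbTE e2) in k.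
- by rewrite (negbTE (e _)) in k.
- by rewrite (negbTE (e _)) in k.
Qed.

Lemma tipL f x h : inv f -> (forall z, ~~ f z (h + 1)) ->
  f x h -> f (x + -1) h -> f (x + -2) h -> ~~ f (x + -3) h /\ ~~ weakb f (x + -3) h.
Proof.
move=> If e h0 h1 h2; have := inv_tip (inv_fl If).
move=> /(_ (- x + 1) h); rewrite (wkb_fl f) /fl !fl1D !fl1K /=.
by move=> /(_ (fun z => e _) h0 h1 h2) /andP.
Qed.

(** A kink created by the round is traced back to a violation of [no_kink], [tip_ok] or [core] in
    [f]. *)
Lemma no_kink_round f g : inv f -> round f g -> no_kink g.
Proof.
move=> If rd p h gF g1 g2 g3 gG; apply/negPn/negP => gq.
have mg := rd_mid rd; have [fg _ _] := mg.
have fq : ~~ f (p + -1) (h + 1) by apply: contra gq => /fg.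
have qr a b : f a (h + 1) -> f b (h + 1) -> a <= p + -1 <= b -> False.
  by move=> h1 h2 l; move: fq; rewrite (inv_itv If h1 h2 l).
have r0 : exists z, f z h.
  apply: contrapT => e; have {}e z : ~~ f z h by apply/negP => fz; apply: e; exists z.
  case: (new_row If mg e g1) => -[fu K]; last by rewrite (negbTE fq) in fu.
  by have := K p (h + 1); rewrite gG => /(_ ltac:(zar)).
have f1 : f (p + -1) h by apply: (row_inner If mg r0 g3 gF); zar.
have f2 : f (p + -2) h by apply: (row_inner If mg r0 g3 gF); zar.
(* If [(p, h + 1)] is new, either [f] already had the kink one step to the right, or the cell was
   picked above a top row of three cells, and then [tip_ok] forbids the new cell [(p - 3, h)]. *)
have [fG|fG] := boolP (f p (h + 1)); last first.
  have [r1|r1] := pselect (exists z, f z (h + 1)).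
    have [k|k] := new_near If mg r1 gG fG; last by rewrite (negbTE fq) in k.
    have [z [z1 z2]] := sh_lap (inv1 If) f1 k ltac:(zar).
    have lz : p + 1 <= z.
      have [//|l] : p + 1 <= z \/ z <= p + -1 \/ z = p by zar.
      case: l => [l|l]; first by case: (qr _ _ z2 k); zar.
      by subst z; rewrite z2 in fG.
    have := sh_kink (inv1 If) (p := p + 1) (h := h).
    rewrite zPN (negbTE fG) -!Z.add_assoc /= k; suff K b : p + -2 <= b <= p + 1 -> f b h.
      by rewrite !K //; zar.
    by move=> l; apply: (inv_itv If f2 z1); zar.
  have {}r1 z : ~~ f z (h + 1) by apply/negP => fz; apply: r1; exists z.
  case: (new_row If mg r1 gG); rewrite zPN => -[fF K].
    have [h1 h2] := tipL If r1 fF f1 f2.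
    by have := new_wk mg g3 h1; rewrite (negbTE h2).
  by have := K p h ltac:(zar); rewrite gF.
have [z [z1 z2]] := sh_lap (inv1 If) f1 fG ltac:(zar).
have fF : f p h.
  have [l|l] : p <= z \/ z <= p + -1 by zar.
    by apply: (inv_itv If f1 z1); zar.
  by case: (qr _ _ z2 fG); zar.
(* Since [(p - 1, h + 1)] was not filled, it was not a mover. *)
have nq u v : near (p + -1) (h + 1) u v -> f u v -> coop_nb f u v <= 2.
  move=> nr fu; apply: Znot_gt_le => l; move: gq; rewrite (rd_mov rd fq) //.
  by exists u, v; split => //; zar.
have f3 : ~~ f (p + -3) h.
  by apply: contra fq => k; apply: (sh_kink (inv1 If)).
have n1 : ~~ f (p + -1) (h + -1).
  have := nq _ _ (adjS _ _); rewrite zPN => /(_ f1).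
  by rewrite /coop_nb zNP zNN fF f2; case: (f (p + -1) (h + -1)) => //; clear; lia.
have up2 : ~~ f (p + -2) (h + 1) by apply/negP => k; apply: (qr _ _ k fG); zar.
have w3 := new_wk mg g3 f3.
(* Without this cell no neighbour could have made [(p - 3, h)] weak. *)
have d2 : f (p + -2) (h + -1).
  apply/negPn/negP => d2.
  have [u [v [nr fu n0 _]]] := (wkDP f3).1 w3.
  have e21 : p + -2 + -1 = p + -3 by zar.
  have e32 : p + -3 + 1 = p + -2 by zar.
  have l1 : 1 <= coop_nb f (p + -3) h by rewrite /coop_nb e32 f2; clear; lia.
  case: nr fu n0 => fu n0.
  - move: n0; rewrite {2}/coop_nb e32 e21 (negbTE d2) (negbTE up2) (negbTE f3).
    by clear -l1; lia.
  - have := inv_itv If fu f2; rewrite -Z.add_assoc /= => /(_ (p + -3)).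
    by rewrite (negbTE f3) => K; suff : false by []; apply: K; zar.
  - by apply: (qr _ _ fu fG); zar.
  - have [z' [z1' z2']] := sh_lap (inv1 If) fu fF ltac:(zar).
    rewrite zNP in z2'; have [l|l] : z' <= p + -3 \/ p + -2 <= z' by zar.
      by move: f3; rewrite (inv_itv If z2' f2) //; zar.
    by move: d2; rewrite (inv_itv If fu z1') //; zar.
have R b : p + -1 <= b -> ~~ f b (h + -1).
  by move=> l; apply: contra n1 => k; apply: (inv_itv If d2 k); zar.
have fR : ~~ f (p + 1) h.
  apply/negP => k; have := sh_kink (inv1 (inv_fv (inv_fl If))) (p := - (p + -2) + 1) (h := - h + 1).
  rewrite /fv /fl !fl1D !fl1K /= -!Z.add_assoc /= (negbTE n1) d2 k f2 f1.
  rewrite (_ : p + (-2 + 2) = p); last zar.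
  by rewrite fF; move=> /(_ isT isT isT isT isT).
(* Now [(p - 1, h)] has count two and no neighbour of count three, against [core]. *)
have [] := inv_core If; last by move=> sq; move: f2 f1 fF; rewrite !sq; clear; lia.
move=> /(_ _ _ f1)[|[u [v [nr fu]]]].
  by rewrite /coop_nb (negbTE n1) (negbTE fq); clear; lia.
case: nr fu => fu.
- rewrite zNP /coop_nb (negbTE fR) (negbTE (R p _)); last zar.
  by clear; lia.
- rewrite zNN /coop_nb (negbTE up2) -[p + -2 + -1]Z.add_assoc (negbTE f3).
  by clear; lia.
- by rewrite (negbTE fq) in fu.
- by rewrite (negbTE n1) in fu.
Qed.

(** Counts of old cells only grow and new cells are movers by [rd_core]. From the square, a cell is
    added beyond each horizontal side and gives the cell it rests on count three. *)
Lemma core_round f g : inv f -> round f g -> core g.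
Proof.
move=> If rd x y gx; have mg := rd_mid rd; have [fg _ _] := mg.
have [fx|fx] := boolP (f x y); last by right; apply: (rd_core rd).
case: (inv_core If) => [co|sq].
  case: (co _ _ fx) => [n|m]; [left|right; exact: mover_mono fg m].
  by have := @nb_mono f g x y fg; zar.
suff H f' g' : inv f' -> round f' g' -> is_square f' -> exists2 a, f' a 1 & 3 <= coop_nb g' a 1.
  have N a b : f a b -> b = y -> 3 <= coop_nb g a b -> 3 <= coop_nb g x y \/
      exists u v, [/\ near x y u v, g u v & 3 <= coop_nb g u v].
    move=> h1 e n; subst b; have [e|ne] : a = x \/ a <> x by zar.
      by left; rewrite -e.
    right; exists a, y; split => //; last exact: fg.
    have [->|->] : a = x + 1 \/ a = x + -1 by move: fx h1 ne; rewrite !sq; clear; lia.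
      by constructor.
    by constructor.
  have [e|e] : y = 1 \/ y = 0 by move: fx; rewrite sq; clear; lia.
    by have [a h1 h2] := H _ _ If rd sq; apply: N h1 _ h2.
  have [|a h1 h2] := H (fv f) (fv g) (inv_fv If) (round_fv rd).
    exact: (sq4_tr (sq4_fl (sq4_tr sq))).
  by apply: (N _ _ h1); rewrite // -(nb_fv g).
move=> {If rd fx mg gx fg sq} If rd sq; have mg := rd_mid rd; have [fg _ _] := mg.
have e a : ~~ f' a 2 by rewrite sq; clear; lia.
have w : weakb f' 0 2.
  by rewrite /weakb /top_rank /rank_as /coop_nb /= !sq.
have [a ga] := rd_row rd e w.
case: (new_row If mg e ga) => -[fa _]; last by move: fa; rewrite sq; clear; lia.
exists a => //; move: ga fa; rewrite /= => ga; rewrite sq => l.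
have : 2 <= coop_nb f' a 1 by rewrite /coop_nb !sq; move: l; clear; lia.
have H u v : Z.b2z (f' u v) <= Z.b2z (g' u v).
  by move: (fg u v); case: (f' u v) => [->|_] //; case: (g' u v).
have n2 : Z.b2z (g' a 2) = Z.b2z (f' a 2) + 1 by rewrite ga (negbTE (e _)).
have := H (a + 1) 1; have := H (a + -1) 1; have := H a 0; move: n2; rewrite /coop_nb /=.
by clear; repeat match goal with |- context[Z.b2z ?e] => move: (Z.b2z e) => ? end; lia.
Qed.

Lemma fin_round f g : inv f -> mid_round f g -> bounded g.
Proof.
move=> If mg; have [B H] := inv_fin If; exists (B + 1) => x y gx.
have [/H|fx] := boolP (f x y); first by zar.
have [u [v [nr]]] := wk_nbr fx (new_wk mg gx fx); case: nr => /H; zar.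
Qed.

Lemma shape_round f g : inv f -> round f g -> all_frames shape1 g.
Proof.
move=> If rd.
have A P : (forall f g, inv f -> round f g -> P g) -> all_frames P g.
  move=> H; apply: (@allfP _ (fun g => exists f, inv f /\ round f g)).
  - by move=> g' [f' [h1 h2]]; exists (tr f'); split; [exact: inv_tr|exact: round_tr].
  - by move=> g' [f' [h1 h2]]; exists (fl f'); split; [exact: inv_fl|exact: round_fl].
  - by move=> g' [f' [h1 h2]]; apply: H h1 h2.
  by exists f.
apply: A => f' g' If' rd'; split.
- by have [_ _ []] := rd_mid rd'.
- exact: row_lap_round rd'.
- exact: thick_round rd'.
- exact: no_kink_round rd'.
Qed.

(** [tip_ok] is not preserved by local reasons; it is recovered for [g] from the slacks or from the
    spiral regime. *)
Lemma inv_round f g : inv f -> round f g -> all_frames tip_ok g -> inv g.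
Proof.
move=> If rd tg; split => //.
- exact: shape_round rd.
- by left; apply: core_round rd.
- exact: fin_round (rd_mid rd).
- by have [x [y fx]] := inv_ne If; exists x, y; have [fg _ _] := rd_mid rd; apply: fg.
Qed.
End Rounds.

(** * Axis and diagonal extents and their growth in one round *)

Section Tips.
Local Open Scope Z_scope.
Implicit Types f c g : Z -> Z -> bool.

Definition top_row f m := (exists x, f x m) /\ forall x y, f x y -> y <= m.
Definition diag_extent f m := (exists x y, f x y /\ x + y = m) /\ forall x y, f x y -> x + y <= m.




Lemma topv_uniq f m m' : top_row f m -> top_row f m' -> m = m'.
Proof. by move=> [[x fx] H] [[y fy] H']; have := H _ _ fy; have := H' _ _ fx; zar. Qed.
Lemma diag_uniq f m m' : diag_extent f m -> diag_extent f m' -> m = m'.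
Proof.
move=> [[x [x' [fx e]]] H] [[y [y' [fy e']]] H'].
by have := H _ _ fy; have := H' _ _ fx; zar.
Qed.

Lemma diag_tr f m : diag_extent f m -> diag_extent (tr f) m.
Proof.
move=> [[x [y [fx e]]] H]; split; first by exists y, x; split => //; zar.
by move=> a b /H; zar.
Qed.

Lemma topv_row f h x y : top_row f h -> (forall a, ~~ f a y) -> row_lap f -> f x (y + -1) -> y = h + 1.
Proof.
move=> [[a fa] H] e rl fx; have := H _ _ fx => l.
have [//|l'] : y = h + 1 \/ y <= h by zar.
by have := up_empty rl fx e a l'; rewrite fa.
Qed.

Lemma topv_empty f h z y : top_row f h -> h < y -> ~~ f z y.
Proof. by move=> [_ H] l; apply/negP => /H; zar. Qed.

Lemma end_weak f x y : (forall a v, y <= v -> ~~ f a v) -> f x (y + -1) -> f (x + 1) (y + -1) ->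
  f x (y + -2) -> ~~ f (x + -1) (y + -1) -> weakb f x y.
Proof.
move=> e f1 f2 f3 f4; have E a v : y <= v -> f a v = false by move=> l; apply/negbTE/e.
apply/wkDP; first by apply: e; zar.
exists x, (y + -1); split => //; first by constructor.
  rewrite /coop_nb !zE f1 f2 f3 !(E _ y) ?(E _ (y + 1)) ?(negbTE f4); try zar.
have n2 : 2 <= coop_nb f x (y + -1) by rewrite /coop_nb !zE f2 f3; clear; lia.
move=> u v nr fu; apply: (@Z.le_lt_trans _ 1); last zar.
case: nr fu => fu.
- by rewrite /coop_nb !(E _ y) ?(E _ (y + 1)); try zar; clear; lia.
- by rewrite /coop_nb !(E _ y) ?(E _ (y + 1)) ?(negbTE f4); try zar; clear; lia.
- by rewrite /coop_nb !zE !(E _ y) ?(E _ (y + 1)) ?(E _ (y + 2)); try zar; clear; lia.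
- by rewrite f1 in fu.
Qed.

Lemma two_below f x h : inv f -> (forall z, ~~ f z (h + 1)) -> f x h -> f (x + 1) h ->
  ~~ f (x + -1) h -> ~~ f (x + 2) h -> f x (h + -1) /\ f (x + 1) (h + -1).
Proof.
move=> If e f1 f2 fL fR.
have [] := inv_core If => [co|sq]; last first.
  by move: f1 f2 (e x); rewrite !sq; clear; lia.
have nx : coop_nb f x h <= 2 by rewrite /coop_nb (negbTE (e _)) (negbTE fL); clear; lia.
have nx1 : coop_nb f (x + 1) h <= 2 by rewrite /coop_nb zPP (negbTE (e _)) (negbTE fR); clear; lia.
split.
  case: (co _ _ f1) => [|[u [v [nr fu]]]]; first zar.
  by case: nr fu; rewrite ?(negbTE (e _)) ?(negbTE fL) //; zar.
case: (co _ _ f2) => [|[u [v [nr fu]]]]; first zar.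
by case: nr fu; rewrite ?zE ?(negbTE (e _)) ?(negbTE fR) //; zar.
Qed.

(* Whether filling the cell z above the top row extends the diagonal sides to its left and to its right. *)
Definition tip_effect (dL dR : Z) (z : Z * Z) : bool * bool :=
  ((- z.1 + 1 + z.2 =? dL + 1), (z.1 + z.2 =? dR + 1)).

(* The possible lists of effects of the weak cells above a top row of slack U; only the first of
   these cells in the random order matters for the extents after the round. *)
Definition tip_options (U : Z) : seq (seq (bool * bool)) :=
  let L := (true, false) in let O := (false, false) in let R := (false, true) in
  if U =? 0 then [:: [::]] else
  if U =? 1 then [:: [::]; [:: L; R]] else
  if U =? 2 then [:: [::]; [:: L; O]; [:: O; R]; [:: L; O; R]; [:: O]] else
  [:: [::]; [:: L; O]; [:: O; R]; [:: O; O]].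

Lemma eqbT (a b : Z) : a = b -> (a =? b) = true. Proof. by move/Z.eqb_eq. Qed.
Lemma eqbF (a b : Z) : a <> b -> (a =? b) = false. Proof. by move/Z.eqb_neq. Qed.

(** Row [h] has [U + 1] places between the two diagonal sides, where [U] is the slack. A single top
    cell has no weak cell above it, two have both, three have the middle one and possibly the ends;
    three cells need slack at least 2, and the last hypothesis makes it exactly 2. *)
Lemma tip_opts f h dL dR : inv f -> top_row f h -> diag_extent (fl f) dL -> diag_extent f dR ->
  (dL + dR - 2 * h - 1 <= 2 \/ forall x, f x h -> f (x + 1) h -> ~~ f (x + 2) h) ->
  0 <= dL + dR - 2 * h - 1 /\
  exists G : seq (Z * Z), [/\ uniq G, (forall z : Z * Z, (z \in G) = weakb f z.1 z.2 && (z.2 =? h + 1)) &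
    [seq tip_effect dL dR z | z <- G] \in tip_options (dL + dR - 2 * h - 1)].
Proof.
move=> If tf [_ HL] [_ HR] HU.
have e a : ~~ f a (h + 1) by apply: topv_empty tf _; zar.
have bL x y : f x y -> - x + 1 + y <= dL.
  by move=> fx; apply: (HL (- x + 1)); rewrite /fl fl1K.
set U := dL + dR - 2 * h - 1 in HU *.
have U0 : 0 <= U.
  by have [[x fx] _] := tf; have := bL _ _ fx; have := HR _ _ fx; rewrite /U; zar.
split=> //.
have rl := sh_lap (inv1 If).
have T2 x : f x h -> f (x + 1) h -> ~~ f (x + -1) h -> ~~ f (x + 2) h ->
   exists G : seq (Z * Z), [/\ uniq G, (forall z : Z * Z, (z \in G) = weakb f z.1 z.2 && (z.2 =? h + 1)) &
    [seq tip_effect dL dR z | z <- G] \in tip_options U].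
  move=> f1 f2 fL fR; have [b1 b2] := two_below If e f1 f2 fL fR.
  have E a v : h + 1 <= v -> ~~ f a v by move=> l; apply: topv_empty tf _; zar.
  have w1 : weakb f x (h + 1).
    by apply: end_weak; rewrite ?zE // -[h + 1 + -2]Z.add_assoc.
  have w2 : weakb f (x + 1) (h + 1).
    have := @end_weak (fl f) (- (x + 1) + 1) (h + 1); rewrite (wkb_fl f) fl1K; apply.
    - by move=> a v l; apply: E.
    - by rewrite /fl fl1K zPN.
    - by rewrite /fl fl1D !zPN.
    - by rewrite /fl fl1K -[h + 1 + -2]Z.add_assoc.
    - by rewrite /fl fl1D !zE.
  exists [:: (x, h + 1); (x + 1, h + 1)]; split.
  - by rewrite /= inE andbT; apply/eqP => -[]; zar.
  - move=> [a b] /=; rewrite !inE; case: (Z.eqb_spec b (h + 1)) => [->|ne]; last first.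
      by rewrite andbF; apply/negbTE/norP; split; apply/eqP => -[]; zar.
    rewrite andbT; apply/idP/idP => [/orP[/eqP[->]|/eqP[->]] //|w].
    have [u [v [nr fu]]] := wk_nbr (e _) w.
    have Ef a' v' : h + 1 <= v' -> f a' v' = false by move=> l; apply/negbTE/E.
    case: nr fu => fu; try (by rewrite Ef in fu; zar); rewrite zPN in fu.
    suff [->|->] : a = x \/ a = x + 1 by rewrite eqxx ?orbT.
    have [l|[l|l]] : a <= x + -1 \/ x + 2 <= a \/ x <= a <= x + 1 by zar.
    + by move: fL; rewrite (inv_itv If fu f1) //; zar.
    + by move: fR; rewrite (inv_itv If f1 fu) //; zar.
    + by zar.
  - have l1 := bL _ _ f1; have l2 := HR _ _ f2.
    rewrite /= /tip_effect /= (eqbF (_ : - (x + 1) + 1 + (h + 1) <> dL + 1)); last zar.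
    rewrite (eqbF (_ : x + (h + 1) <> dR + 1)); last zar.
    rewrite /tip_options; have [u0|[u1|[u2|u3]]] : U = 0 \/ U = 1 \/ U = 2 \/ 3 <= U by zar.
    + by move: u0; rewrite /U; zar.
    + rewrite u1 /= !eqbT //; move: u1; rewrite /U; zar.
    + rewrite u2 /=; have [k|k] : dL = - x + 1 + h \/ dL = - x + 1 + h + 1.
        by move: u2; rewrite /U; zar.
      * by rewrite eqbT ?eqbF //; move: u2; rewrite /U; zar.
      * by rewrite eqbF ?eqbT //; move: u2; rewrite /U; zar.
    + rewrite !(@eqbF U); try zar.
      case: (Z.eqb_spec (- x + 1 + (h + 1)) (dL + 1)) => k1;
        case: (Z.eqb_spec (x + 1 + (h + 1)) (dR + 1)) => k2 //.
      by move: u3; rewrite /U; zar.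
have T3 x : f (x + -1) h -> f x h -> f (x + 1) h ->
   exists G : seq (Z * Z), [/\ uniq G, (forall z : Z * Z, (z \in G) = weakb f z.1 z.2 && (z.2 =? h + 1)) &
    [seq tip_effect dL dR z | z <- G] \in tip_options U].
  move=> f0 f1 f2; have [b fR fL] := mid3_below If e f0 f1 f2.
  have E a v : h + 1 <= v -> ~~ f a v by move=> l; apply: topv_empty tf _; zar.
  have wm : weakb f x (h + 1).
    apply: (mover_wk (inv_hv If) (e _)); exists x, h; split => //.
      by rewrite -{2}(zPN h); constructor.
    by rewrite /coop_nb f0 f2 b; clear; lia.
  have l0 := bL _ _ f0; have l2 := HR _ _ f2.
  have Ug : 2 <= U by rewrite /U; zar.
  have U2 : U = 2.
    case: HU => [|K]; first by zar.
    by have := K _ f0; rewrite zNP => /(_ f1); rewrite -Z.add_assoc f2.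
  exists [seq z <- [:: (x + -1, h + 1); (x, h + 1); (x + 1, h + 1)] | weakb f z.1 z.2]; split.
  - apply: filter_uniq; rewrite /= !inE !andbT; apply/andP; split.
      by apply/norP; split; apply/eqP => -[]; zar.
    by apply/eqP => -[]; zar.
  - move=> [a b']; rewrite mem_filter /=; case w: (weakb f a b') => //=.
    case: (Z.eqb_spec b' (h + 1)) => [eb|ne]; last first.
      by rewrite !inE; apply/negbTE; rewrite !negb_or; apply/and3P; split; apply/eqP => -[]; zar.
    subst b'; have [u [v [nr fu]]] := wk_nbr (e _) w.
    have Ef a' v' : h + 1 <= v' -> f a' v' = false by move=> l; apply/negbTE/E.
    case: nr fu => fu; try (by rewrite Ef in fu; zar); rewrite zPN in fu.
    rewrite !inE; suff [->|[->|->]] : a = x + -1 \/ a = x \/ a = x + 1 by rewrite eqxx ?orbT.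
    have [l|[l|l]] : a <= x + -2 \/ x + 2 <= a \/ x + -1 <= a <= x + 1 by zar.
    + by move: fL; rewrite (inv_itv If fu f1) //; zar.
    + by move: fR; rewrite (inv_itv If f1 fu) //; zar.
    + by zar.
  - rewrite U2 /= wm.
    have eL : tip_effect dL dR (x + -1, h + 1) = (true, false).
      by rewrite /tip_effect /= eqbT ?eqbF //; move: U2; rewrite /U; zar.
    have eM : tip_effect dL dR (x, h + 1) = (false, false).
      by rewrite /tip_effect /= !eqbF //; move: U2; rewrite /U; zar.
    have eR : tip_effect dL dR (x + 1, h + 1) = (false, true).
      by rewrite /tip_effect /= eqbF ?eqbT //; move: U2; rewrite /U; zar.
    by case: (weakb f (x + -1) _); case: (weakb f (x + 1) _); rewrite /= ?eL ?eM ?eR.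
have N : (forall z : Z * Z, weakb f z.1 (h + 1) = false) \/ exists z, weakb f z (h + 1).
  have [[z w]|K] := pselect (exists z, weakb f z (h + 1)); [by right; exists z|left].
  by move=> z; apply/negP => w; apply: K; exists z.1.
case: N => [N|[z w]].
  exists [::]; split => //.
    by move=> z; case: Z.eqb_spec => [->|]; rewrite ?andbF // in_nil N.
  by rewrite /tip_options; case: (U =? 0); case: (U =? 1); case: (U =? 2).
have E a v : h + 1 <= v -> ~~ f a v by move=> l; apply: topv_empty tf _; zar.
have TT x : f x h -> f (x + 1) h ->
   exists G : seq (Z * Z), [/\ uniq G, (forall z : Z * Z, (z \in G) = weakb f z.1 z.2 && (z.2 =? h + 1)) &
    [seq tip_effect dL dR z | z <- G] \in tip_options U].
  move=> f1 f2; have [fL|fL] := boolP (f (x + -1) h); first exact: (T3 x fL f1 f2).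
  have [fR|fR] := boolP (f (x + 2) h); last exact: (T2 x f1 f2 fL fR).
  by apply: (T3 (x + 1)); rewrite ?zPN // zPP.
case: (weak_cases If (e _) w) => [[u [v [nr fu n]]]|[_ K]].
  have Ef a' v' : h + 1 <= v' -> f a' v' = false by move=> l; apply/negbTE/E.
  case: nr fu n => fu; try (by rewrite Ef in fu; zar); rewrite zPN in fu *.
  move=> n; apply: (T3 z) => //.
    by move: n; rewrite /coop_nb (negbTE (e _)); case: (f (z + -1) h) => //; clear; lia.
  by move: n; rewrite /coop_nb (negbTE (e _)); case: (f (z + 1) h) => //; clear; lia.
case: K => [[_ [fz t]]|[[_ [k _]]|[[_ [k _]]|[_ [k _]]]]]; try by rewrite (negbTE (E _ _ _)) // in k; zar.
rewrite zPN in fz; case: t => -[_ _ + _ _]; rewrite (zPN h) => fm.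
  by apply: (TT (z + -1)); rewrite ?zNP.
by apply: (TT z) => //; move: fm; rewrite /fl fl1D.
Qed.


Lemma new_top f g h y x : inv f -> mid_round f g -> top_row f h -> g x y -> h < y ->
  y = h + 1 /\ f x h.
Proof.
move=> If mg tf gx l; have fx := topv_empty x tf l.
have [u [v [nr fu]]] := wk_nbr fx (new_wk mg gx fx).
have [_ H] := tf.
have e : y = h + 1 by case: nr fu => /H; zar.
split => //; subst y; case: nr fu => fu; try by have := H _ _ fu; zar.
by rewrite zPN in fu.
Qed.

Lemma fstr_some s y (z : Z * Z) : z \in s -> z.2 = y -> exists z', first_in_row y s = Some z'.
Proof.
by move=> zs e; case E: (first_in_row y s) => [z'|]; [exists z'|case: (fst_mem E zs)].
Qed.
Lemma fstc_some s y (z : Z * Z) : z \in s -> z.1 = y -> exists z', first_in_col y s = Some z'.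
Proof.
by move=> zs e; case E: (first_in_col y s) => [z'|]; [exists z'|case: (fstc_mem E zs)].
Qed.

Definition enum_weak f (s : seq (Z * Z)) := uniq s /\ forall z : Z * Z, (z \in s) = weakb f z.1 z.2.

Lemma enum_new f s (z : Z * Z) : inv f -> enum_weak f s -> z \in s -> ~~ f z.1 z.2 /\ weakb f z.1 z.2.
Proof.
move=> If [_ ws]; rewrite ws => w; split => //; apply/negP => fz.
by have := noC If fz; rewrite w.
Qed.

Lemma midrun_of f s : inv f -> enum_weak f s -> midrun f s (run f s).
Proof. by move=> If es; apply: midrunP => // [|z]; [case: es|exact: enum_new]. Qed.

Lemma round_of f s : inv f -> enum_weak f s -> round f (run f s).
Proof.
move=> If es; have mr := midrun_of If es; have [us ws] := es; split.
- exact: mr_mid mr.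
- move=> x y fx m; apply: (mr_mov mr (z := (x, y))) => //.
  by rewrite ws; apply: mover_wk => //; apply: inv_hv.
- move=> x y e w; have [z E] := @fstr_some s y (x, y) ltac:(by rewrite ws) erefl.
  by exists z.1; have [_ <-] := fstr_in E; apply: (mr_fstr mr e E).
- move=> x y e w; have [z E] := @fstc_some s x (x, y) ltac:(by rewrite ws) erefl.
  by exists z.2; have [_ <-] := fstc_in E; apply: (mr_fstc mr e E).
- exact: mr_core mr.
Qed.

Lemma topv_round f s h : inv f -> enum_weak f s -> top_row f h ->
  top_row (run f s) (h + Z.b2z (first_in_row (h + 1) s)).
Proof.
move=> If es tf; have mr := midrun_of If es; have mg := mr_mid mr; have [fg _ _] := mg.
have [[a fa] H] := tf.
have e b : ~~ f b (h + 1) by apply: topv_empty tf _; zar.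
case E: (first_in_row (h + 1) s) => [z|] /=; last first.
  rewrite Z.add_0_r; split; first by exists a; apply: fg.
  move=> x y gx; apply: Znot_gt_le => l.
  have [ey fx] := new_top If mg tf gx ltac:(zar); subst y.
  case: (mr_sub mr gx) => [|xs]; first by rewrite (negbTE (e _)).
  exact: fst_mem E _ xs erefl.
have gz := mr_fstr mr e E; have [_ ez] := fstr_in E; split; first by exists z.1; rewrite -ez.
move=> x y gx; apply: Znot_gt_le => l.
by have [ey _] := new_top If mg tf gx ltac:(zar); zar.
Qed.

(** First picks always flip, so a first pick on the line [d + 1] moves the side; conversely [mr_ext]
    traces any cell beyond [d] to such a pick. *)
Lemma diag_round f s h hE d : inv f -> enum_weak f s -> top_row f h -> top_row (tr f) hE -> diag_extent f d ->
  diag_extent (run f s) (d + Z.b2z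
   ((if first_in_row (h + 1) s is Some z then z.1 + z.2 =? d + 1 else false) ||
    (if first_in_col (hE + 1) s is Some z then z.1 + z.2 =? d + 1 else false))).
Proof.
move=> If es tf tE dg; have mr := midrun_of If es; have mg := mr_mid mr; have [fg _ _] := mg.
have [[a [b [fab eab]]] H] := dg.
have up x y : run f s x y -> x + y <= d + 1.
  move=> gx; have [/H|fx] := boolP (f x y); first by zar.
  have [u [v [nr]]] := wk_nbr fx (new_wk mg gx fx).
  by case: nr => /H; zar.
have e1 q : ~~ f q (h + 1) by apply: topv_empty tf _; zar.
have e2 q : ~~ f (hE + 1) q by apply: (topv_empty q tE); zar.
set B := (X in Z.b2z X); case EB: B => /=; last first.
  rewrite Z.add_0_r; split; first by exists a, b; split => //; apply: fg.
  move=> x y gx; apply: Znot_gt_le => l; move/negP: EB; apply.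
  have [z [lz K]] := mr_ext mr H gx ltac:(zar).
  apply/orP; case: K => -[E D]; [left|right].
  - have ez : z.2 = h + 1 by case: D => D1 D2 _ _ _; apply: topv_row tf D1 (sh_lap (inv1 If)) D2.
    have gz : run f s z.1 z.2 by apply: (mr_fstr mr _ E); rewrite ez.
    by rewrite -ez E; apply/eqbT; have := up _ _ gz; zar.
  - have ez : z.1 = hE + 1.
      by case: D => D1 D2 _ _ _; apply: topv_row tE D1 (sh_lap (inv1 (inv_tr If))) D2.
    have gz : run f s z.1 z.2 by apply: (mr_fstc mr _ E); rewrite ez.
    by rewrite -ez E; apply/eqbT; have := up _ _ gz; zar.
split => //; have : exists z, run f s z.1 z.2 /\ z.1 + z.2 = d + 1.
  move: EB; rewrite /B => /orP[].
    case E: (first_in_row _ s) => [z|] //= /Z.eqb_eq ez; exists z; split => //.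
    by apply: (mr_fstr mr _ E).
  case E: (first_in_col _ s) => [z|] //= /Z.eqb_eq ez; exists z; split => //.
  by apply: (mr_fstc mr _ E).
by case=> z [h1 h2]; exists z.1, z.2.
Qed.

(** A mover flips in any order, and any other weak cell lies in an empty row or column, whose first
    pick flips. *)
Lemma run_grow f s : inv f -> enum_weak f s -> s <> [::] ->
  exists x y, run f s x y /\ ~~ f x y.
Proof.
case: s => // z s If es _; have rd := round_of If es.
have [h w] := enum_new If es (mem_head _ _).
have [[u gu]|K] := pselect (exists u, run f (z :: s) u z.2 /\ ~~ f u z.2); first by exists u, z.2.
have [[u gu]|K'] := pselect (exists u, run f (z :: s) z.1 u /\ ~~ f z.1 u); first by exists z.1, u.
exfalso; case: (weak_cases If h w) => [m|[_ C]].
  by apply: K; exists z.1; split => //; apply: rd_mov rd _ _ h m.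
have R : (forall a, ~~ f a z.2) -> False.
  by move=> e; have [a ga] := rd_row rd e w; apply: K; exists a.
have R' : (forall a, ~~ f z.1 a) -> False.
  by move=> e; have [a ga] := rd_col rd e w; apply: K'; exists a.
case: C => [[_ [_ [[e _ _ _ _]|[e _ _ _ _]]]]|[[_ [_ [[e _ _ _ _]|[e _ _ _ _]]]]|
  [[_ [_ [[e _ _ _ _]|[e _ _ _ _]]]]|[_ [_ [[e _ _ _ _]|[e _ _ _ _]]]]]]].
- by apply: R.
- by apply: R => a; have := e (- a + 1); rewrite /fl fl1K.
- by apply: R => a; have := e a; rewrite /fv fl1K.
- by apply: R => a; have := e (- a + 1); rewrite /fl /fv !fl1K.
- by apply: R'.
- by apply: R' => a; have := e (- a + 1); rewrite /fl /tr fl1K.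
- by apply: R' => a; have := e a; rewrite /fv /tr fl1K.
- by apply: R' => a; have := e (- a + 1); rewrite /fl /fv /tr !fl1K.
Qed.

(* Three cells in the top row need slack 2 there, and a weak fourth cell would need slack at the
   adjacent tip as well. *)
Lemma tip_ok_U f h hE dL dR dS : all_frames shape1 f -> top_row f h -> top_row (tr f) hE ->
  diag_extent (fl f) dL -> diag_extent f dR -> diag_extent (fl (tr f)) dS ->
  dL + dR - 2 * h - 1 <= 2 -> (dL + dR - 2 * h - 1 = 2 -> dR + dS - 2 * hE - 1 = 0) -> tip_ok f.
Proof.
move=> sf tf tE [_ HL] [_ HR] [_ HS] U2 UE x y e f0 f1 f2.
have [ri rl _ _] := allf_id sf; have [ci cl _ _] := allf_id (allf_tr sf).
have bL a b : f a b -> - a + 1 + b <= dL.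
  by move=> fx; apply: (HL (- a + 1)); rewrite /fl fl1K.
have bS a b : f a b -> - b + 1 + a <= dS.
  by move=> fx; apply: (HS (- b + 1)); rewrite /fl /tr fl1K.
have ey : y = h.
  have := @topv_row f h x (y + 1) tf e rl; rewrite zPN => /(_ f0); zar.
subst y; have l0 := bL _ _ f0; have l2 := HR _ _ f2.
have f3 : ~~ f (x + 3) h by apply/negP => /HR; zar.
rewrite f3 /=; apply/negP => w.
(* Three cells fill all [U + 1 <= 3] places between the diagonals, so the slack is 2 and the end
   cell touches the right side. *)
have dR2 : dR = x + 2 + h by zar.
have {}UE : dR + dS - 2 * hE - 1 = 0 by apply: UE; zar.
have f4 : ~~ f (x + 4) h by apply/negP => /HR; zar.
have N a b : dR < a + b -> f a b = false by move=> l; apply/negbTE/negP => /HR; zar.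
have x34 : x + 3 + 1 = x + 4 by zar.
have x32 : x + 3 + -1 = x + 2 by zar.
have nu : coop_nb f (x + 2) h <= 2.
  by rewrite /coop_nb (N _ (h + 1)) ?(N (x + 2 + 1) h); [clear; lia|zar..].
have [fd|fd] := boolP (f (x + 3) (h + -1)).
  have nd : coop_nb f (x + 3) (h + -1) <= 2.
    by rewrite /coop_nb (N _ (h + -1 + 1)) ?(N (x + 3 + 1)); [clear; lia|zar..].
  have [u [v [nr fu n1 _]]] := (wkDP f3).1 w.
  have n0 : 2 <= coop_nb f (x + 3) h by rewrite /coop_nb x32 f2 fd; clear; lia.
  case: nr fu n1 => fu; rewrite ?x32; try zar; by rewrite N in fu; zar.
have n0 : coop_nb f (x + 3) h = 1.
  by rewrite /coop_nb x32 x34 f2 (negbTE fd) (negbTE f4) (negbTE (e _)).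
have ce : forall z, ~~ f (x + 3) z.
  apply: (@row_empty (tr f) h (x + 3) (allf_tr sf)); rewrite ?(wkb_tr f) ?(nb_tr f) // /tr.
  by rewrite x32.
have hEx : x + 3 = hE + 1.
  by apply: (@topv_row (tr f) hE h (x + 3) tE ce cl); rewrite /tr x32.
have [u [v [nr fu n1 _]]] := (wkDP f3).1 w.
have fb : f (x + 2) (h + -1).
  apply/negPn/negP => nb2; suff : coop_nb f u v <= 1 by zar.
  case: nr fu {n1} => fu; try by rewrite N in fu; zar.
    rewrite x32 /coop_nb (N _ (h + 1)) ?(N (x + 2 + 1) h) ?(negbTE nb2); [clear; lia|zar..].
  by rewrite fu in fd.
(* Column [hE = x + 2] would contain two cells, which gives the right tip slack at least 1. *)
by have := bS _ _ fb; zar.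
Qed.
End Tips.

(** * Rotations, cyclic indexing of the extents, and slacks *)

Section Rotations.
Local Open Scope Z_scope.
Implicit Types f c g p q : Z -> Z -> bool.

Definition rot f := fl (tr f).
Definition rotn k f := iter k rot f.
Definition rotz (z : Z * Z) : Z * Z := (- z.2 + 1, z.1).
Definition flz (z : Z * Z) : Z * Z := (- z.1 + 1, z.2).

Lemma rotnS k f : rotn k.+1 f = rot (rotn k f). Proof. by []. Qed.

Lemma rot3 f : rotn 3 f = tr (fl f).
Proof. by apply/funext => x; apply/funext => y; rewrite /rotn /= /rot /fl /tr fl1K. Qed.
Lemma rot4 f : rotn 4 f = f.
Proof. by apply/funext => x; apply/funext => y; rewrite /rotn /= /rot /fl /tr !fl1K. Qed.
Lemma rotn4 k f : rotn (k + 4)%N f = rotn k f.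
Proof. by rewrite /rotn iterD -[iter 4 _ _]/(rotn 4 f) rot4. Qed.
Lemma rot_fl f : rot (fl f) = fl (rotn 3 f).
Proof. by rewrite rot3. Qed.
Lemma fl_rot f : fl (rot f) = tr f. Proof. exact: flK. Qed.

Lemma rotn_fl k f : rotn k (fl f) = fl (rotn (k * 3)%N f).
Proof.
by elim: k => // k IH; rewrite rotnS IH rot_fl /rotn -iterD mulSn.
Qed.

Lemma inv_rot f : inv f -> inv (rot f). Proof. by move=> /inv_tr/inv_fl. Qed.
Lemma inv_rotn k f : inv f -> inv (rotn k f).
Proof. by move=> If; elim: k => //= k; exact: inv_rot. Qed.
Lemma wkb_rot f z : weakb (rot f) (rotz z).1 (rotz z).2 = weakb f z.1 z.2.
Proof. by rewrite (wkb_fl (tr f)) (wkb_tr f) /= fl1K. Qed.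

Lemma rotz_inj : injective rotz.
Proof. by move=> [a b] [a' b'] []; move=> h1 h2; congr pair; zar. Qed.
Lemma flz_inj : injective flz.
Proof. by move=> [a b] [a' b'] []; move=> h1 h2; congr pair; zar. Qed.
Lemma rotz_surj z : exists u, z = rotz u.
Proof. by exists (z.2, - z.1 + 1); rewrite /rotz /= fl1K -surjective_pairing. Qed.
Lemma flzK : involutive flz.
Proof. by move=> [a b]; rewrite /flz /= fl1K. Qed.

Lemma upd_rot f z : flip_weak (rot f) (rotz z) = rot (flip_weak f z).
Proof.
apply/funext => x; apply/funext => y; rewrite /flip_weak wkb_rot /rot /fl /tr /=.
have -> : (x =? - z.2 + 1) = (- x + 1 =? z.2).
  by apply/idP/idP => /Z.eqb_spec h; apply/Z.eqb_spec; zar.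
by rewrite (andbC (_ =? z.2)).
Qed.
Lemma upd_fl f z : flip_weak (fl f) (flz z) = fl (flip_weak f z).
Proof.
apply/funext => x; apply/funext => y; rewrite /flip_weak (wkb_fl f) /fl /= fl1K.
have -> // : (x =? - z.1 + 1) = (- x + 1 =? z.1).
by apply/idP/idP => /Z.eqb_spec h; apply/Z.eqb_spec; zar.
Qed.
Lemma run_rot f s : run (rot f) (map rotz s) = rot (run f s).
Proof. by rewrite /run; elim: s f => //= z s IH f; rewrite upd_rot IH. Qed.
Lemma run_fl f s : run (fl f) (map flz s) = fl (run f s).
Proof. by rewrite /run; elim: s f => //= z s IH f; rewrite upd_fl IH. Qed.
Lemma enum_rot f s : enum_weak f s -> enum_weak (rot f) (map rotz s).
Proof.
move=> [us ws]; split; first by rewrite map_inj_uniq //; exact: rotz_inj.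
by move=> z; have [u ->] := rotz_surj z; rewrite (mem_map rotz_inj) wkb_rot.
Qed.
Lemma enum_fl f s : enum_weak f s -> enum_weak (fl f) (map flz s).
Proof.
move=> [us ws]; split; first by rewrite map_inj_uniq //; exact: flz_inj.
by move=> z; rewrite -(flzK z) (mem_map flz_inj) ws (wkb_fl f) /= fl1K.
Qed.
Definition rot_seq k (s : seq (Z * Z)) := iter k (map rotz) s.
Lemma run_rotn k f s : run (rotn k f) (rot_seq k s) = rotn k (run f s).
Proof. by elim: k => //= k IH; rewrite run_rot IH. Qed.
Lemma enum_rotn k f s : enum_weak f s -> enum_weak (rotn k f) (rot_seq k s).
Proof. by move=> H; elim: k => //= k; exact: enum_rot. Qed.

Lemma fstr_rot y s : first_in_row y (map rotz s) = omap rotz (first_in_col y s).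
Proof. by rewrite /first_in_row /first_in_col; elim: s => //= z s; case: (z.1 =? y). Qed.
Lemma fstr_fl y s : first_in_row y (map flz s) = omap flz (first_in_row y s).
Proof. by rewrite /first_in_row; elim: s => //= z s; case: (z.2 =? y). Qed.

Lemma topv_fl f h : top_row f h -> top_row (fl f) h.
Proof.
move=> [[x fx] H]; split; first by exists (- x + 1); rewrite /fl fl1K.
by move=> a b /H.
Qed.
Lemma topv_rot f h : top_row (rot f) h -> top_row (tr f) h.
Proof. by move=> /topv_fl; rewrite fl_rot. Qed.
Lemma diag_fl_rot f d : diag_extent f d -> diag_extent (fl (rot f)) d.
Proof. by rewrite fl_rot; exact: diag_tr. Qed.

(* h k and d k are the extents in the k-th axis and diagonal directions; the tip in direction
   k + 1 lies between the diagonal sides k and k + 1. *)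
Definition dims f (d h : nat -> Z) := forall k, diag_extent (rotn k f) (d k) /\ top_row (rotn k f) (h k).


Lemma dims_uniq f d h d' h' : dims f d h -> dims f d' h' -> forall k, d k = d' k /\ h k = h' k.
Proof.
move=> D D' k; have [a b] := D k; have [a' b'] := D' k.
by split; [apply: diag_uniq a a'|apply: topv_uniq b b'].
Qed.

Lemma dims4 f d h k : dims f d h -> d (k + 4)%N = d k /\ h (k + 4)%N = h k.
Proof.
move=> D; have [a b] := D (k + 4)%N; have [a' b'] := D k.
by rewrite rotn4 in a b; split; [apply: diag_uniq a a'|apply: topv_uniq b b'].
Qed.

(** A reflection reverses the cyclic order: [3 k] is [- k] modulo 4, and diagonal directions, lying
    between the axes, become [- k - 1]. *)
Lemma dims_fl f d h : dims f d h -> dims (fl f) (fun k => d (k * 3 + 3)%N) (fun k => h (k * 3)%N).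
Proof.
move=> D k; have [a b] := D (k * 3)%N; rewrite rotn_fl; split; last exact: topv_fl.
have [c _] := D (k * 3 + 3)%N; have := diag_fl_rot c.
by rewrite -rotnS -addnS rotn4.
Qed.

(* The room for growth of the tip in direction k + 1, which cannot advance when it is 0. *)
Definition slack (d h : nat -> Z) k := d k + d k.+1 - 2 * h k.+1 - 1.
Definition total_slack (d h : nat -> Z) := slack d h 0 + slack d h 1 + slack d h 2 + slack d h 3.

Lemma sumU_fl f d h : dims f d h ->
  total_slack (fun k => d (k * 3 + 3)%N) (fun k => h (k * 3)%N) = total_slack d h.
Proof.
move=> D.
have P i j : (i + 4)%N = j -> d j = d i /\ h j = h i by move=> <-; exact: dims4.
have [a1 b1] := P 11%N 15%N erefl; have [a2 b2] := P 7%N 11%N erefl.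
have [a3 b3] := P 3%N 7%N erefl; have [a4 b4] := P 8%N 12%N erefl.
have [a5 b5] := P 4%N 8%N erefl; have [a6 b6] := P 0%N 4%N erefl.
have [a7 b7] := P 5%N 9%N erefl; have [a8 b8] := P 1%N 5%N erefl.
have [a9 b9] := P 2%N 6%N erefl; clear P D.
rewrite /total_slack /slack.
change (d 3%N + d 6%N - 2 * h 3%N - 1 + (d 6%N + d 9%N - 2 * h 6%N - 1) +
 (d 9%N + d 12%N - 2 * h 9%N - 1) + (d 12%N + d 15%N - 2 * h 12%N - 1) =
 d 0%N + d 1%N - 2 * h 1%N - 1 + (d 1%N + d 2%N - 2 * h 2%N - 1) +
 (d 2%N + d 3%N - 2 * h 3%N - 1) + (d 3%N + d 4%N - 2 * h 4%N - 1)).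
zar.
Qed.

Lemma allf_rot P f : (forall k, P (rotn k f) /\ P (fl (rotn k f))) -> all_frames P f.
Proof.
move=> H; have [a0 b0] := H 0%N; have [a1 b1] := H 1%N; have [a2 b2] := H 2%N.
have [a3 b3] := H 3%N; rewrite rot3 in a3 b3; split; split.
- exact: a0.
- exact: b0.
- rewrite -[fv f]flK.
  suff <- : rotn 2 f = fl (fv f) by [].
  by [].
- by [].
- by rewrite -fl_rot.
- by [].
- have -> : tr (fv f) = fl (tr f) by []. by [].
- suff <- : fl (tr (fl f)) = tr (fl (fv f)) by [].
  by [].
Qed.

(** A tip of slack 2 uses up the whole budget, so its neighbours have slack 0, as [tip_ok_U]
    requires. *)
Lemma tip_ok_sumU f d h : all_frames shape1 f -> dims f d h -> total_slack d h <= 2 ->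
  (forall k, 0 <= slack d h k) -> all_frames tip_ok f.
Proof.
move=> sf D S U0.
have shk k : all_frames shape1 (rotn k f).
  by elim: k => //= k IH; apply/allf_fl/allf_tr.
have U4 k : slack d h (k + 4)%N = slack d h k.
  by rewrite /slack -addSn; have [-> _] := dims4 k D; have [-> ->] := dims4 k.+1 D.
have pair k : slack d h k = 2 -> slack d h k.+1 = 0 /\ slack d h k.+3 = 0.
  move=> e; have S' : slack d h k + slack d h k.+1 + slack d h k.+2 + slack d h k.+3 <= 2.
    elim: k {e} => [//|k IH]; apply: Z.le_trans IH.
    by have := U4 k; rewrite addnS addnS addnS addnS addn0; zar.
  by have := (U0 k.+1, U0 k.+2, U0 k.+3) => -[[]]; zar.
have le2 k : slack d h k <= 2.
  have -> : slack d h k = slack d h (k %% 4)%N.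
    rewrite {1}(divn_eq k 4) addnC; elim: (k %/ 4)%N => [|m IH]; first by rewrite mul0n addn0.
    by rewrite mulSn (addnC 4%N) addnA U4.
  have : (k %% 4 < 4)%N by rewrite ltn_mod.
  have := (U0 0%N, U0 1%N, U0 2%N, U0 3%N); move: S; rewrite /total_slack => S [[[]]].
  by case: (k %% 4)%N => [|[|[|[|//]]]]; zar.
have main k : tip_ok (rotn k.+1 f).
  have [a1 b1] := D k.+1; have [a2 b2] := D k.+2; have [a0 b0] := D k.
  apply: (tip_ok_U (shk _) b1 (topv_rot b2) (dL := d k) (dR := d k.+1) (dS := d k.+2)) => //.
  - exact: diag_fl_rot.
  - exact: le2.
  - by move=> /pair[].
have mainf k : tip_ok (fl (rotn k.+1 f)).
  have [a1 b1] := D k.+1; have [a2 b2] := D k; have [a3 b3] := D (k + 3)%N.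
  apply: (tip_ok_U (allf_fl (shk _)) (topv_fl b1) (hE := h k) (dL := d k.+1) (dR := d k) (dS := d (k + 3)%N)).
  - have -> : tr (fl (rotn k.+1 f)) = rotn k f by rewrite rotnS fl_rot.
    exact: b2.
  - by rewrite flK.
  - exact: diag_fl_rot.
  - have -> : tr (fl (rotn k.+1 f)) = rotn k f by rewrite rotnS fl_rot.
    by have := diag_fl_rot a3; rewrite -rotnS -addnS rotn4.
  - by have := le2 k; rewrite /slack; zar.
  - move=> e; have [_] := pair k ltac:(by rewrite /slack; zar).
    by rewrite /slack; have := dims4 k D; rewrite !addnS !addn0 => -[-> ->]; zar.
apply: allf_rot => k; rewrite -(rotn4 k) addnS; split; [exact: main|exact: mainf].
Qed.
End Rotations.

(** * Growth from the 2 x 2 square at total slack 4 *)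

Section Spiral.
Local Open Scope Z_scope.
Implicit Types f c g p q : Z -> Z -> bool.

Inductive status := Pend | DoneL | DoneR.
Definition mirror s := match s with Pend => Pend | DoneL => DoneR | DoneR => DoneL end.
Definition tip_height n s : Z := if s is Pend then n else n + 1.

Record corner n s f : Prop := Corner {
  c_top : top_row f (tip_height n s);
  c_dR : forall x y, f x y -> x + y <= n + 2;
  c_dL : forall x y, f x y -> - x + 1 + y <= n + 2;
  c_R : s = DoneR -> f 1 (n + 1);
  c_L : s = DoneL -> f 0 (n + 1) }.

(** Unless this tip has pushed its right side out itself, the cells on the outer line come from the
    next tip and are still more than [r] rows below level [n]. *)
Definition frontR n r s f := s <> DoneR -> forall x y, f x y -> x + y = n + 2 -> y <= n - 1 - r.
Definition frontL n r s f := s <> DoneL -> forall x y, f x y -> - x + 1 + y = n + 2 -> y <= n - 1 - r.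
(** The inner line on the left is filled up to [r] rows below the tip. At [r = 0] the top row is the
    pair [(0, n)], [(1, n)], and a pick becomes unavoidable ([pend_weak]). *)
Definition pending n r s f := s = Pend -> f 1 n /\
  exists x y, [/\ f x y, - x + 1 + y = n + 1 & n - r <= y].

Lemma corner_fl n s f : corner n s f -> corner n (mirror s) (fl f).
Proof.
case=> t a b c d; split.
- by move: (topv_fl t); case: (s).
- by move=> x y /b; rewrite fl1K.
- by move=> x y /a.
- by case: (s) c d => // c d _; rewrite /fl; apply: d.
- by case: (s) c d => // c d _; rewrite /fl; apply: c.
Qed.
Lemma frontL_fl n r s f : frontL n r s f -> frontR n r (mirror s) (fl f).
Proof.
by move=> H ne x y /H; rewrite fl1K; apply; case: (s) ne.
Qed.
Lemma frontR_fl n r s f : frontR n r s f -> frontL n r (mirror s) (fl f).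
Proof. by move=> H ne x y /H; apply; case: (s) ne. Qed.

Definition tiprow s x : Prop :=
  match s with Pend => 0 <= x <= 1 | DoneL => x = 0 | DoneR => x = 1 end.

(** At the height of the tip the fronts have not arrived, so the diagonals leave only the columns 0
    and 1; this makes [tip_ok] vacuous in [corner_tip_ok]. *)
Lemma corner_row n r s f x : 0 <= r -> corner n s f -> frontR n r s f -> frontL n r s f ->
  f x (tip_height n s) -> tiprow s x.
Proof.
move=> r0 [_ a b _ _] fr fL fx; have := a _ _ fx; have := b _ _ fx.
have hR : s <> DoneR -> x + tip_height n s <> n + 2.
  by move=> ne e; have := fr ne _ _ fx e; rewrite /tip_height; case: (s); zar.
have hL : s <> DoneL -> - x + 1 + tip_height n s <> n + 2.
  by move=> ne e; have := fL ne _ _ fx e; rewrite /tip_height; case: (s); zar.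
move: hR hL; rewrite /tiprow /tip_height; case: (s) => hR hL h1 h2.
- by have := hR ltac:(by []); have := hL ltac:(by []); zar.
- by have := hR ltac:(by []); zar.
- by have := hL ltac:(by []); zar.
Qed.

Section Corner.
Variables (n r : Z) (s : status) (f : Z -> Z -> bool).
Hypotheses (r0 : 0 <= r) (If : inv f) (cf : corner n s f).
Hypotheses (fR : frontR n r s f) (fL : frontL n r s f).

Lemma corner_DR x y : tip_end f x y -> [/\ s = Pend, x = 1 & y = n + 1].
Proof.
case=> e f1 f2 _ _; have ey := topv_row (c_top cf) e (sh_lap (inv1 If)) f1.
have h1 := corner_row r0 cf fR fL (x := x); have h2 := corner_row r0 cf fR fL (x := x + -1).
rewrite ey zPN in f1 f2; move: (h1 f1) (h2 f2) ey; rewrite /tiprow /tip_height.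
by case: (s) => l1 l2 ey; [split => //; zar|zar|zar].
Qed.

Lemma corner_DL x y : tip_end (fl f) x y -> [/\ s = Pend, x = 1 & y = n + 1].
Proof.
case=> e f1 f2 _ _.
have ey := topv_row (topv_fl (c_top cf)) e (sh_lap (inv1 (inv_fl If))) f1.
have h1 := corner_row r0 cf fR fL (x := - x + 1); have h2 := corner_row r0 cf fR fL (x := - (x + -1) + 1).
rewrite ey zPN in f1 f2; move: (h1 f1) (h2 f2) ey; rewrite /tiprow /tip_height.
by case: (s) => l1 l2 ey; [split => //; zar|zar|zar].
Qed.

Lemma corner_tip_ok : row_lap f -> tip_ok f.
Proof.
move=> rl x h e f1 f2 f3; exfalso.
have eh : h + 1 = tip_height n s + 1.
  by apply: (topv_row (x := x) (c_top cf) e rl); rewrite zPN.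
have {}eh : h = tip_height n s by zar.
subst h; move: (corner_row r0 cf fR fL f1) (corner_row r0 cf fR fL f3).
by rewrite /tiprow; case: (s); zar.
Qed.

(** After its pick the top row is a single cell, which can produce neither a mover nor a tip cell
    above it. *)
Lemma corner_notip sq : s <> Pend -> enum_weak f sq -> first_in_row (tip_height n s + 1) sq = None.
Proof.
move=> ns es; case E: (first_in_row _ _) => [z|] //; exfalso.
have [zs ez] := fstr_in E; have [fz w] := enum_new If es zs.
have tf := c_top cf; have [_ H] := tf.
have [K|[_ K]] := weak_cases If fz w.
  case: K => u [v [nr fu n3]].
  have [eu ev] : u = z.1 /\ v = tip_height n s.
    by case: nr fu {n3} => /H; zar.
  subst u v; have row x : f x (tip_height n s) -> x = z.1.
    move: (corner_row r0 cf fR fL fu) => l0 /(corner_row r0 cf fR fL).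
    by move: l0 ns; rewrite /tiprow; case: (s) => // l0 _; zar.
  have k1 : f (z.1 + 1) (tip_height n s) = false by apply/negbTE/negP => /row; zar.
  have k2 : f (z.1 + -1) (tip_height n s) = false by apply/negbTE/negP => /row; zar.
  by move: n3; rewrite /coop_nb k1 k2; clear; lia.
case: K => [[_ [_ []]]|[[_ [k _]]|[[_ [k _]]|[_ [k _]]]]]; try by have := H _ _ k; zar.
  by case/corner_DR.
by case/corner_DL.
Qed.

End Corner.

(* New cells on the line x + y = n + 2: the front advances by at most one, or they are picks of
   the tip above (status s) or of the tip on the right (status s'). *)
Lemma new_side n r s s' f g x y : 0 <= r -> inv f -> corner n s f -> frontR n r s f -> frontL n r s f ->
  corner n s' (rot f) -> frontR n r s' (rot f) -> frontL n r s' (rot f) ->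
  mid_round f g -> g x y -> ~~ f x y -> n + 2 <= x + y ->
  x + y = n + 2 /\ [\/ s <> DoneR -> y <= n - r,
    [/\ s = Pend, x = 1, y = n + 1 & tip_end f x y] | [/\ s' = Pend, x = n + 1, y = 1 & tip_end (tr f) y x]].
Proof.
move=> r0 If cf fR fL cf' fR' fL' mg gx fx l; have w := new_wk mg gx fx.
have HR := c_dR cf.
case: (weak_cases If fx w) => [[u [v [nr fu n3]]]|[_ K]].
  have luv := HR _ _ fu.
  have [e|e] : x + y = n + 2 \/ n + 3 <= x + y by zar.
    split => //; constructor 1 => ns; have H := fR ns.
    case: nr fu n3 luv => fu n3 luv; try zar.
      have : f (x + -1) (y + 1).
        move: n3; rewrite /coop_nb zNP (negbTE fx); case: (f (x + -1) (y + 1)) => //.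
        by clear; lia.
      by move=> k; have := H _ _ k; zar.
    have : f (x + 1) (y + -1).
      move: n3; rewrite /coop_nb zNP (negbTE fx); case: (f (x + 1) (y + -1)) => //.
      by clear; lia.
    by move=> k; have := H _ _ k; zar.
  have N a b : n + 3 <= a + b -> f a b = false by move=> l'; apply/negbTE/negP => /HR; zar.
  exfalso; case: nr fu n3 luv => fu n3 luv; try zar.
    by move: n3; rewrite /coop_nb zNP (negbTE fx) (N _ (y + 1)); [clear; lia|zar].
  by move: n3; rewrite /coop_nb zNP (negbTE fx) (N (x + 1)); [clear; lia|zar].
case: K => [[_ [_ []]]|[[_ [k _]]|[[_ [_ []]]|[_ [k _]]]]]; try by have := HR _ _ k; zar.
- move=> D; have [es ex ey] := corner_DR r0 If cf fR fL D.
  by split; [zar|constructor 2].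
- by case/(corner_DL r0 If cf fR fL) => _; zar.
- move=> D; rewrite -fl_rot in D.
  have [es ex ey] := corner_DL r0 (inv_rot If) cf' fR' fL' D.
  by rewrite fl_rot in D; split; [zar|constructor 3].
- by case/(corner_DR r0 (inv_rot If) cf' fR' fL') => _; zar.
Qed.

Lemma frontR_step n r s s' f sq : 1 <= n -> 1 <= r <= n - 1 -> inv f ->
  corner n s f -> frontR n r s f -> frontL n r s f ->
  corner n s' (rot f) -> frontR n r s' (rot f) -> frontL n r s' (rot f) ->
  enum_weak f sq -> s <> DoneR -> (s = Pend -> first_in_row (n + 1) sq <> Some (1, n + 1)) ->
  forall x y, run f sq x y -> x + y = n + 2 -> y <= n - 1 - (r - 1).
Proof.
move=> n1 lr If cf fR fL cf' fR' fL' es ns nf x y gx exy.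
have mr := midrun_of If es; have mg := mr_mid mr.
have [fx|fx] := boolP (f x y); first by have := fR ns _ _ fx exy; zar.
have NS := fun x y => @new_side n r s s' f (run f sq) x y ltac:(zar) If cf fR fL cf' fR' fL' mg.
have [_ []] := NS _ _ gx fx ltac:(zar).
- by move=> /(_ ns); zar.
- move=> [ep ex ey D]; exfalso; subst x y.
  (* If [(1, n + 1)] is not the first pick, then [(2, n)] was filled first; but it lies on the same
     outer line, too high for the front to have reached it. *)
  have [k|k] := mr_dbl mr D gx; first exact: nf ep k.
  have [f2|f2] := boolP (f (1 + 1) (n + 1 + -1)).
    by have := fR ns _ _ f2; zar.
  have [_ []] := NS _ _ k f2 ltac:(zar).
  + by move=> /(_ ns); zar.
  + by case=> _; zar.
  + by case=> _; zar.
- by case=> _ _ ->; zar.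
Qed.

Definition next_status s (o : option (Z * Z)) := if s is Pend then
  (if o is Some z then (if z.1 =? 1 then DoneR else DoneL) else Pend) else s.

(** The tip on the left is described by [p] with status [s1], the one on the right by [rot f] with
    status [s2]; both may send fronts along the sides of the tip of [f]. *)
Lemma corner_step n r s p sq : let f := rot p in let g := run f sq in forall s1 s2,
  0 <= r -> inv f ->
  corner n s1 p -> frontR n r s1 p -> frontL n r s1 p ->
  corner n s f -> frontR n r s f -> frontL n r s f ->
  corner n s2 (rot f) -> frontR n r s2 (rot f) -> frontL n r s2 (rot f) ->
  enum_weak f sq -> corner n (next_status s (first_in_row (n + 1) sq)) g.
Proof.
move=> f g s1 s2 r0 If c1 fR1 fL1 cf fR fL c2 fR2 fL2 es.
have mr := midrun_of If es; have mg := mr_mid mr; have [fg _ _] := mg.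
have tg := topv_round If es (c_top cf).
have e a : s = Pend -> ~~ f a (n + 1).
  by move=> ep; have := c_top cf; rewrite ep => tf; apply: topv_empty tf _; rewrite /tip_height; zar.
have pick z : s = Pend -> first_in_row (n + 1) sq = Some z -> [/\ g z.1 z.2, z.2 = n + 1 & 0 <= z.1 <= 1].
  move=> ep E; have [zs ez] := fstr_in E.
  have gz : g z.1 z.2 by apply: (mr_fstr mr _ E) => a; apply: e.
  split => //; have := c_top cf; rewrite ep => tf.
  have [_ fz] := new_top If mg tf gz ltac:(rewrite /tip_height; zar).
  by have := corner_row r0 cf fR fL (x := z.1); rewrite ep => /(_ fz).
split.
- move: tg; case Es: s => /=; last 2 first.
  + by have := corner_notip r0 If cf fR fL (sq := sq); rewrite Es => -> //; rewrite Z.add_0_r.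
  + by have := corner_notip r0 If cf fR fL (sq := sq); rewrite Es => -> //; rewrite Z.add_0_r.
  by case: (first_in_row (n + 1) sq) => [z|] /=; rewrite ?Z.add_0_r //; case: (z.1 =? 1).
- move=> x y gx; have [/(c_dR cf) //|fx] := boolP (f x y).
  apply: Znot_gt_le => l.
  by have [] := new_side r0 If cf fR fL c2 fR2 fL2 mg gx fx ltac:(zar); zar.
- move=> x y gx; have [/(c_dL cf) //|fx] := boolP (f x y).
  apply: Znot_gt_le => l.
  have efp : rot (fl f) = fl p by rewrite /rot /f fl_rot.
  have Ip : rot (fl f) = rot (fl f) by [].
  have [] := @new_side n r (mirror s) (mirror s1) (fl f) (fl g) (- x + 1) y r0 (inv_fl If)
    (corner_fl cf) (frontL_fl fL) (frontR_fl fR).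
  + by rewrite efp; exact: corner_fl.
  + by rewrite efp; exact: frontL_fl.
  + by rewrite efp; exact: frontR_fl.
  + exact: mid_fl.
  + by rewrite /fl fl1K.
  + by rewrite /fl fl1K.
  + zar.
  zar.
- case Es: s => //=; last by move=> _; apply/fg/(c_R cf).
  case E: (first_in_row (n + 1) sq) => [z|] //; case: Z.eqb_spec => // ez _.
  by have [gz ez2 _] := pick z Es E; rewrite ez ez2 in gz.
- case Es: s => //=; last by move=> _; apply/fg/(c_L cf).
  case E: (first_in_row (n + 1) sq) => [z|] //; case: Z.eqb_spec => // ez _.
  have [gz ez2 l] := pick z Es E; have e0 : z.1 = 0 by zar.
  by rewrite e0 ez2 in gz.
Qed.

(** Iterating [no_kink] leftwards from [t] fills row [h + 1] up to two cells from [a]. *)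
Lemma kink_run f a t h : no_kink f -> row_itv f -> f a h -> f t h -> f t (h + 1) ->
  forall x, a + 2 <= x <= t -> f x (h + 1).
Proof.
move=> nk ri fa ft ft1 x [l1 l2]; have [m] := ubnP (Z.to_nat (t - x)).
elim: m x l1 l2 => // m IH x l1 l2 lm.
have [->//|l] : x = t \/ x + 1 <= t by zar.
have := IH (x + 1) ltac:(zar) l ltac:(zar) => k.
have r b : a <= b <= t -> f b h by apply: ri.
by have := nk (x + 1) h; rewrite zPN; apply; rewrite ?r //; zar.
Qed.

Lemma cross f x1 y1 x2 y2 (c : Z) : inv f -> y1 <= y2 -> f x1 y1 -> f x2 y2 ->
  x1 <= c <= x2 \/ x2 <= c <= x1 -> exists y, f c y /\ y1 <= y <= y2.
Proof.
move=> If; have [m] := ubnP (Z.to_nat (y2 - y1)); elim: m x1 y1 => // m IH x1 y1 lm l f1 f2 lc.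
have [e|l'] : y1 = y2 \/ y1 < y2 by zar.
  subst y2; exists y1; split; last zar.
  by case: lc => lc; [apply: (inv_itv If f1 f2)|apply: (inv_itv If f2 f1)].
have [z [h1 h2]] := sh_lap (inv1 If) f1 f2 l'.
have [lz|lz] : (x1 <= c <= z \/ z <= c <= x1) \/ (z <= c <= x2 \/ x2 <= c <= z) by zar.
  exists y1; split; last zar.
  by case: lz => lz; [apply: (inv_itv If f1 h1)|apply: (inv_itv If h1 f1)].
have [y [fy ly]] := IH z (y1 + 1) ltac:(zar) ltac:(zar) h2 f2 lz.
by exists y; split => //; zar.
Qed.

(** The front cell on the inner line is [(- r, n - r)]. Unless already filled, the next cell
    [(- r + 1, n - r + 1)] is a mover: the cell below it has a cooperator on each side by
    [kink_run], and one underneath. *)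
Lemma speed n r f g u v : inv f -> round f g -> 1 <= r <= n - 1 -> f 1 n ->
  (forall x y, f x y -> - x + 1 + y <= n + 2) ->
  (forall x y, f x y -> - x + 1 + y = n + 2 -> y <= n - 1 - r) ->
  f u v -> n <= u -> 0 <= v <= 1 ->
  (exists x y, [/\ f x y, - x + 1 + y = n + 1 & n - r <= y]) ->
  exists x y, [/\ g x y, - x + 1 + y = n + 1 & n - (r - 1) <= y].
Proof.
move=> If rd lr f1n bL bL2 fuv lu lv [x0 [y0 [f0 e0 l0]]].
have [fg _ _] := rd_mid rd.
have [l|ey0] : n - (r - 1) <= y0 \/ y0 = n - r by zar.
  by exists x0, y0; split => //; apply: fg.
have ex0 : x0 = - r by zar.
subst x0; clear l0 e0; exists (- r + 1), (y0 + 1); split; [|zar..].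
have [/fg //|fz] := boolP (f (- r + 1) (y0 + 1)).
have nL x y : n - r <= y -> n + 2 <= - x + 1 + y -> f x y = false.
  by move=> l1 l2; apply/negbTE/negP => k; have := bL _ _ k; have := bL2 _ _ k; zar.
have [t [t1 t2]] := sh_lap (inv1 If) f0 f1n ltac:(zar).
have lt : - r + 2 <= t.
  have [//|[e|l]] : - r + 2 <= t \/ t = - r + 1 \/ t <= - r by zar.
    by rewrite -e t2 in fz.
  by rewrite nL in t2; zar.
have [ri rl _ nk] := inv1 If.
have fr := kink_run nk ri f0 t1 t2 (x := - r + 2) ltac:(zar).
have R b : - r <= b <= t -> f b y0 by apply: ri.
have fw : f (- r + 1) y0 by apply: R; zar.
have fv1 : f (- r + 1 + 1) y0 by apply: R; zar.
have fz0 : f (- r + 1 + -1) y0 by rewrite zPN.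
have [fb|fb] := boolP (f (- r + 1) (y0 + -1)).
  apply: (rd_mov rd fz); exists (- r + 1), y0; split => //.
    by rewrite -{2}(zPN y0); constructor.
  by rewrite /coop_nb fv1 fz0 fb; clear; lia.
have fzb : f (- r) (y0 + -1).
  have [] := inv_core If => [co|sq]; last by move: f0; rewrite sq; clear -lr; lia.
  have nz : f (- r + -1) y0 = false by rewrite nL //; zar.
  have nz2 : f (- r) (y0 + 1) = false by rewrite nL //; zar.
  case: (co _ _ f0) => [|[a [b [nr fa]]]]; first by rewrite /coop_nb nz nz2; clear; lia.
  case: nr fa => fa; rewrite ?nz ?nz2 // in fa *.
  by rewrite /coop_nb (negbTE fz) (negbTE fb); clear; lia.
(* A hole at [(- r + 1, y0 - 1)] is impossible: the configuration reaches [(u, v)] on the right tip,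
   so column convexity, row convexity or [no_kink] fills it, according to the height [v]. *)
have [l|[l|l]] : v < y0 + -1 \/ v = y0 + -1 \/ v = y0 by zar.
- have [y' [k l']] := @cross f u v (- r) (y0 + -1) (- r + 1) If ltac:(zar) fuv fzb ltac:(zar).
  have [_ ci] := inv_hv If; move/negP: fb; case; apply: (ci _ _ (y0 + -1) _ k fw); zar.
- rewrite l in fuv; move/negP: fb; case; apply: (ri _ _ _ _ fzb fuv); zar.
- have R2 b : - r <= b <= u -> f b y0 by apply: ri f0 _; rewrite -l.
  have := sh_kink (inv1 (inv_fv (inv_fl If))) (p := - (- r) + 1) (h := - y0 + 1).
  rewrite /fv /fl !fl1D !fl1K /= (negbTE fb) fzb !R2; zar.
Qed.

(* The growth from the 2 x 2 square, where the total slack stays 4: the tips have width 2 until a pick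
   at height n + 1 (status DoneL or DoneR) starts two fronts that move along the adjacent diagonal
   sides, one step per round; r bounds the distance they still have to cover before level n + 1. *)
Definition spiral n r (st : nat -> status) f := [/\ 1 <= n, 0 <= r <= n - 1 &
  forall k, let q := rotn k f in
  [/\ corner n (st k) q, frontR n r (st k) q, frontL n r (st k) q, pending n r (st k) q &
   (exists x y, q x y /\ x + y = n + 2) -> st k = DoneR \/ st k.+1 = DoneL]].

Definition alldone n (st : nat -> status) f := 1 <= n /\ forall k, let q := rotn k f in
  [/\ corner n (st k) q, st k <> Pend &
   (exists x y, q x y /\ x + y = n + 2) -> st k = DoneR \/ st k.+1 = DoneL].

End Spiral.

(** * One round of the spiral, and the class of good configurations *)

Section GoodConfigurations.
Local Open Scope Z_scope.
Implicit Types f c g p q : Z -> Z -> bool.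

Definition next_statuses n (st : nat -> status) (s : seq (Z * Z)) k :=
  next_status (st k) (first_in_row (n + 1) (rot_seq k s)).

Lemma rot_pred f k : rot (rotn (k + 3) f) = rotn k f.
Proof. by rewrite -rotnS -addnS rotn4. Qed.

Lemma spiral_corner n r st f s k : inv f -> enum_weak f s -> spiral n r st f ->
  corner n (next_statuses n st s k) (rotn k (run f s)).
Proof.
move=> If es [n1 lr sp]; have r0 : 0 <= r by zar.
have [a1 a2 a3 _ _] := sp (k + 3)%N; have [b1 b2 b3 _ _] := sp k.
have [c1 c2 c3 _ _] := sp k.+1.
have := @corner_step n r (st k) (rotn (k + 3) f) (rot_seq k s); rewrite rot_pred => /=.
move=> /(_ (st (k + 3)%N) (st k.+1) r0 (inv_rotn k If) a1 a2 a3 b1 b2 b3 c1 c2 c3).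
by move=> /(_ (enum_rotn k es)); rewrite run_rotn.
Qed.

Lemma spiral_side n r st f s k : inv f -> enum_weak f s -> spiral n r st f ->
  (exists x y, rotn k (run f s) x y /\ x + y = n + 2) ->
  next_statuses n st s k = DoneR \/ next_statuses n st s k.+1 = DoneL.
Proof.
move=> If es [n1 lr sp] [x [y [gx exy]]]; have r0 : 0 <= r by zar.
have [b1 b2 b3 _ sd] := sp k; have [c1 c2 c3 _ _] := sp k.+1.
rewrite /next_statuses; have [e|e] := pselect (exists x y, rotn k f x y /\ x + y = n + 2).
  by case: (sd e) => ->; [left|right].
have Iq := inv_rotn k If; have eq := enum_rotn k es.
have mr := midrun_of Iq eq; rewrite run_rotn in mr.
have M a b : rotn k f a b -> a + b <= n + 1.
  move=> fab; have := c_dR b1 fab => l; apply: Znot_gt_le => l'; apply: e.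
  by exists a, b; split => //; zar.
have [z [lz [[E D]|[E D]]]] := mr_ext mr M gx ltac:(zar).
  have [-> ex ey] := corner_DR r0 Iq b1 b2 b3 D; left.
  by rewrite -ey E /= ex.
rewrite -fl_rot in D; have [-> ex ey] := corner_DL r0 (inv_rot Iq) c1 c2 c3 D; right.
have -> : rot_seq k.+1 s = map rotz (rot_seq k s) by [].
by rewrite fstr_rot -ey E /= ex.
Qed.

(** At [r = 0] the top row consists of two cells, and the cell above its left end is weak by
    [end_weak]. *)
Lemma pend_weak n st f s : inv f -> enum_weak f s -> 1 <= n -> st = Pend ->
  corner n st f -> frontR n 0 st f -> frontL n 0 st f -> pending n 0 st f ->
  exists z, first_in_row (n + 1) s = Some z.
Proof.
move=> If es n1 ep cf fR fL /(_ ep)[f1 [x [y [fx exy ly]]]]; subst st.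
have tf := c_top cf; have [_ H] := tf; rewrite /tip_height in tf H.
have ey : y = n by have := H _ _ fx; zar.
have ex : x = 0 by zar.
subst x y; have row a : f a n -> 0 <= a <= 1 by move=> fa; apply: (corner_row _ cf fR fL fa); zar.
have e a v : n + 1 <= v -> ~~ f a v by move=> l; apply: topv_empty tf _; zar.
have n0 : ~~ f (0 + -1) n by apply/negP => /row; zar.
have n2 : ~~ f (0 + 2) n by apply/negP => /row; zar.
have [b0 _] := @two_below f 0 n If (fun a => e a _ (Z.le_refl _)) fx f1 n0 n2.
have w : weakb f 0 (n + 1).
  by apply: end_weak; rewrite ?zE // -[n + 1 + -2]Z.add_assoc.
by apply: (@fstr_some s (n + 1) (0, n + 1)) => //; have [_ ->] := es.
Qed.

Lemma spiral_alldone n st f s : inv f -> enum_weak f s -> spiral n 0 st f ->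
  alldone n (next_statuses n st s) (run f s).
Proof.
move=> If es sp; have [n1 lr sp'] := sp; split => // k /=; split.
- exact: spiral_corner sp.
- have [b1 b2 b3 b4 _] := sp' k; rewrite /next_statuses /next_status; case Es: (st k) => //.
  have [z ->] := pend_weak (inv_rotn k If) (enum_rotn k es) n1 Es b1 b2 b3 b4.
  by case: (z.1 =? 1).
- exact: spiral_side sp.
Qed.

Lemma spiral_step n r st f s : inv f -> enum_weak f s -> 1 <= r -> spiral n r st f ->
  spiral n (r - 1) (next_statuses n st s) (run f s).
Proof.
move=> If es r1 sp; have [n1 lr sp'] := sp; split => //; first zar.
have lr' : 1 <= r <= n - 1 by zar.
move=> k q; have [a1 a2 a3 _ _] := sp' (k + 3)%N; have [b1 b2 b3 b4 _] := sp' k.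
have [c1 c2 c3 _ _] := sp' k.+1.
have Iq := inv_rotn k If; have eq := enum_rotn k es; split.
- exact: spiral_corner sp.
- move=> ns x y; rewrite /q -run_rotn; apply: (frontR_step n1 lr' Iq b1 b2 b3 c1 c2 c3 eq).
    by move=> e; apply: ns; rewrite /next_statuses e.
  by move=> e E; apply: ns; rewrite /next_statuses e E.
- move=> ns x y; rewrite /q -run_rotn => gx exy.
  have efp : rot (fl (rotn k f)) = fl (rotn (k + 3) f).
    by rewrite rot_fl /rotn -iterD addnC.
  have := @frontR_step n r (mirror (st k)) (mirror (st (k + 3)%N)) (fl (rotn k f)) (map flz (rot_seq k s)) n1 lr'
    (inv_fl Iq) (corner_fl b1) (frontL_fl b3) (frontR_fl b2).
  rewrite efp run_fl => /(_ (corner_fl a1) (frontL_fl a3) (frontR_fl a2) (enum_fl eq)).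
  move=> H; apply: (H _ _ (- x + 1)); rewrite /fl ?fl1K //.
    by move=> e; apply: ns; rewrite /next_statuses; case: (st k) e.
  rewrite fstr_fl => e; case E: (first_in_row _ _) => [z|] //= [e1 e2]; apply: ns.
  rewrite /next_statuses E; case: (st k) e => //= _; rewrite (_ : z.1 = 0) //; zar.
- move=> ep; rewrite /next_statuses in ep; have [Es En] : st k = Pend /\ first_in_row (n + 1) (rot_seq k s) = None.
    by case: (st k) ep => //=; case: (first_in_row _ _) => // z; case: (z.1 =? 1).
  have [f1n fr] := b4 Es; have rd := round_of Iq eq; rewrite run_rotn in rd.
  have [fg _ _] := rd_mid rd; split; first exact: fg.
  have [[x fx] _] := c_top c1; have r0 : 0 <= r by zar.
  have lx := corner_row r0 c1 c2 c3 fx.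
  have lx' : 0 <= x <= 1 by move: lx; rewrite /tiprow; case: (st k.+1); zar.
  apply: (speed Iq rd lr' f1n (c_dL b1) _ (u := tip_height n (st k.+1)) (v := - x + 1) fx _ _ fr).
  + by move=> a b; apply: b3; rewrite Es.
  + by rewrite /tip_height; case: (st k.+1); zar.
  + zar.
- exact: spiral_side sp.
Qed.

Definition regime f := exists n r st, spiral n r st f \/ spiral n r st (fl f).

Lemma spiral_new n f : 1 <= n ->
  (forall k, let q := rotn k f in [/\ top_row q (n + 1), forall x y, q x y -> x + y <= n + 2,
    q 1 (n + 1) & forall x y, q x y -> - x + 1 + y <= n + 2]) ->
  spiral (n + 1) n (fun=> Pend) f.
Proof.
move=> n1 H; split; [zar|zar|] => k q; have [t a b c] := H k; split.
- split => //.
  + by move=> x y /a; zar.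
  + by move=> x y /c; zar.
- by move=> _ x y /a; zar.
- by move=> _ x y /c; zar.
- move=> _; split => //; have [_ _ b' _] := H (k + 3)%N.
  exists (- n), 1; split; [|zar|zar].
  rewrite /q -(rot_pred f k) /rot /fl /tr.
  by rewrite Z.opp_involutive.
- by case=> x [y [/a]]; zar.
Qed.

Lemma rotn_mod4 k m f : rotn (k + 4 * m) f = rotn k f.
Proof.
by elim: m => [|m IH]; rewrite ?muln0 ?addn0 // mulnS [(4 + _)%N]addnC addnA rotn4.
Qed.

(** Each tip pushes one of its two sides, so four tips can push all four sides only by turning the
    same way. The result is a pinwheel, which is the spiral one level higher with all tips pending;
    if all turned left, it is reflected. *)
Lemma alldone_next n st f : alldone n st f ->
  (forall k, exists x y, rotn k f x y /\ x + y = n + 2) -> regime f.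
Proof.
move=> [n1 ad] ext.
have S k : st k = DoneR \/ st k.+1 = DoneL by have [_ _] := ad k; apply; apply: ext.
have N k : st k <> Pend by have [] := ad k.
have T k : top_row (rotn k f) (n + 1).
  by have [[t _ _ _ _] ne _] := ad k; move: t ne; case: (st k).
have [[k0 e0]|K] := pselect (exists k, st k = DoneL).
  have L k : st (k0 + k)%N = DoneL.
    elim: k => [|k IH]; first by rewrite addn0.
    by rewrite addnS; have [|//] := S (k0 + k)%N; rewrite IH.
  have {}L k : rotn k f 0 (n + 1).
    rewrite -(rotn_mod4 k k0); have [[_ _ _ _ c] _ _] := ad (k + 4 * k0)%N; apply: c.
    by have := L (k + 3 * k0)%N; rewrite addnCA -mulSn.
  exists (n + 1), n, (fun=> Pend); right; apply: spiral_new => // k; rewrite /= rotn_fl.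
  have [[_ a b _ _] _ _] := ad (k * 3)%N; split.
  + by apply/topv_fl/T.
  + by move=> x y /b; rewrite fl1K.
  + exact: L.
  + by move=> x y /a.
have R k : st k = DoneR by case e: (st k) (N k) => // _; case: K; exists k.
exists (n + 1), n, (fun=> Pend); left; apply: spiral_new => // k /=.
have [[_ a b c _] _ _] := ad k; split => //; exact: c.
Qed.

Lemma Uv_ge0 f d h k : dims f d h -> 0 <= slack d h k.
Proof.
move=> D; have [[_ H] _] := D k; have [[_ H'] [[x fx] _]] := D k.+1.
by have := H' _ _ fx; have := H _ _ fx; rewrite /slack; zar.
Qed.

(** All heights are [n + 1] and all diagonal extents at most [n + 2]; a single side that falls short
    lowers the total slack from 4 to at most 2. *)
Lemma alldone_reg n st f d h : dims f d h -> alldone n st f -> total_slack d h <= 2 \/ regime f.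
Proof.
move=> D ad; have [n1 ad'] := ad.
have eh k : h k = n + 1.
  have [_ t] := D k; have [[t' _ _ _ _] ne _] := ad' k; apply: topv_uniq t _.
  by move: t' ne; case: (st k).
have diag_of_seq k : d k <= n + 2.
  by have [[[x [y [fx <-]]] _] _] := D k; have [[_ a _ _ _] _ _] := ad' k; apply: a.
have [e|ne] := pselect (forall k, d k = n + 2).
  right; apply: alldone_next ad _ => k; have [[[x [y [fx exy]]] _] _] := D k.
  by exists x, y; rewrite e in exy.
left; move/existsNP: ne => [k nk]; have := dims4 0 D => -[e4 _].
have : exists j, (j < 4)%N /\ d j <> n + 2.
  exists (k %% 4)%N; split; first by rewrite ltn_mod.
  move=> e; apply: nk; rewrite -e; have [[a b] _] := (D k, tt).
  have [c _] := D (k %% 4)%N; apply: diag_uniq a _.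
  by rewrite [in rotn k f](divn_eq k 4) addnC mulnC rotn_mod4.
move=> [j [lj nj]]; rewrite /total_slack /slack !eh.
have := (diag_of_seq 0%N, diag_of_seq 1%N, diag_of_seq 2%N, diag_of_seq 3%N) => -[[[l0 l1] l2] l3].
by move: e4 lj nj; rewrite add0n => e4; case: j => [|[|[|[|//]]]] _ nj; zar.
Qed.

Lemma regime_step f s d h : inv f -> enum_weak f s -> regime f -> dims (run f s) d h ->
  total_slack d h <= 2 \/ regime (run f s).
Proof.
have main f' s' n r st d' h' : inv f' -> enum_weak f' s' -> dims (run f' s') d' h' -> spiral n r st f' ->
   total_slack d' h' <= 2 \/ regime (run f' s').
  move=> If es D sp; have [n1 lr _] := sp.
  have [r1|e] : 1 <= r \/ r = 0 by zar.
    right; exists n, (r - 1), (next_statuses n st s'); left; exact: spiral_step.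
  by subst r; apply: alldone_reg D (spiral_alldone If es sp).
move=> If es [n [r [st [sp|sp]]]] D; first exact: main sp.
have D' := dims_fl D; rewrite -run_fl in D'.
have := main _ _ _ _ _ _ _ (inv_fl If) (enum_fl es) D' sp.
rewrite (sumU_fl D) run_fl => -[|[n' [r' [st' K]]]]; [by left|right].
by exists n', r', st'; case: K; [right|rewrite flK; left].
Qed.

Lemma shape_rotn f k : all_frames shape1 f -> all_frames shape1 (rotn k f).
Proof. by move=> sf; elim: k => //= k IH; apply/allf_fl/allf_tr. Qed.

Lemma spiral_tips n r st f : all_frames shape1 f -> spiral n r st f -> all_frames tip_ok f.
Proof.
move=> sf [n1 lr sp]; have r0 : 0 <= r by zar.
apply: allf_rot => k; have [a b c _ _] := sp k; have sk := shape_rotn k sf; split.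
  by apply: (corner_tip_ok r0 a b c); case: (allf_id sk).
apply: (corner_tip_ok r0 (corner_fl a) (frontL_fl c) (frontR_fl b)).
by case: (allf_id (allf_fl sk)).
Qed.

Lemma regime_tips f : all_frames shape1 f -> regime f -> all_frames tip_ok f.
Proof.
move=> sf [n [r [st [sp|sp]]]]; first exact: spiral_tips sp.
by rewrite -[f]flK; apply: allf_fl; apply: spiral_tips sp; apply: allf_fl.
Qed.

Lemma regime_width f h k x : regime f -> top_row (rotn k f) h ->
  rotn k f x h -> rotn k f (x + 1) h -> ~~ rotn k f (x + 2) h.
Proof.
move=> [n [r [st [[n1 lr sp]|[n1 lr sp]]]]] t f1 f2; apply/negP => f3; have r0 : 0 <= r by zar.
  have [c a b _ _] := sp k; have e := topv_uniq t (c_top c); subst h.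
  move: (corner_row r0 c a b f1) (corner_row r0 c a b f3).
  by rewrite /tiprow; case: (st k); zar.
have [c a b _ _] := sp (k * 3)%N; rewrite rotn_fl in c a b.
have ek : rotn (k * 3 * 3)%N f = rotn k f.
  have -> : (k * 3 * 3 = k + 4 * (2 * k))%N by lia.
  exact: rotn_mod4.
rewrite ek in c a b; have e := topv_uniq (topv_fl t) (c_top c); subst h.
have R y : rotn k f y (tip_height n (st (k * 3)%N)) -> tiprow (st (k * 3)%N) (- y + 1).
  by move=> fy; apply: (corner_row r0 c a b); rewrite /fl fl1K.
move: (R _ f1) (R _ f3).
by rewrite /tiprow; case: (st (k * 3)%N); zar.
Qed.

Lemma Uv_le f d h k : dims f d h -> total_slack d h <= 2 -> slack d h k <= 2.
Proof.
move=> D; have U4 j : slack d h (j + 4)%N = slack d h j.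
  by rewrite /slack -addSn; have [-> _] := dims4 j D; have [-> ->] := dims4 j.+1 D.
have -> : slack d h k = slack d h (k %% 4)%N.
  rewrite {1}(divn_eq k 4) addnC; elim: (k %/ 4)%N => [|m IH]; first by rewrite mul0n addn0.
  by rewrite mulSn (addnC 4%N) addnA U4.
have : (k %% 4 < 4)%N by rewrite ltn_mod.
have u0 j := @Uv_ge0 f d h j D.
have := (u0 0%N, u0 1%N, u0 2%N, u0 3%N); rewrite /total_slack => -[[[]]].
by case: (k %% 4)%N => [|[|[|[|//]]]]; zar.
Qed.

(** The regime stands in at total slack 4 for [tip_ok_sumU], and through [regime_width] it limits
    top rows to two cells, as [tip_opts] needs for slacks above 2. *)
Definition good f d h := [/\ inv f, dims f d h &
  total_slack d h = 0 \/ total_slack d h = 2 \/ (total_slack d h = 4 /\ regime f)].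

Lemma good_tips f d h k : good f d h -> exists G : seq (Z * Z), [/\ uniq G,
  (forall z : Z * Z, (z \in G) = weakb (rotn k.+1 f) z.1 z.2 && (z.2 =? h k.+1 + 1)) &
  [seq tip_effect (d k) (d k.+1) z | z <- G] \in tip_options (slack d h k)].
Proof.
move=> [If D S]; have [a1 b1] := D k.+1; have [a0 b0] := D k.
have [|_ H] := tip_opts (inv_rotn k.+1 If) b1 (diag_fl_rot a0 : diag_extent (fl (rotn k.+1 f)) _) a1.
  have [l|[_ R]] : total_slack d h <= 2 \/ (total_slack d h = 4 /\ regime f).
    by case: S => [->|[->|R]]; [left|left|right].
    by left; exact: (@Uv_le f d h k D l).
  by right=> x; apply: regime_width R b1.
exact: H.
Qed.

Definition pushes_right (e : option (bool * bool)) := if e is Some v then v.2 else false.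
Definition pushes_left (e : option (bool * bool)) := if e is Some v then v.1 else false.

Definition first_effect (d h : nat -> Z) s k :=
  omap (tip_effect (d k) (d k.+1)) (first_in_row (h k.+1 + 1) (rot_seq k.+1 s)).

(** Side [k + 1] lies between the tips [k] and [k + 1]: either can push it, and a push by both
    counts once, hence the disjunction. *)
Lemma dims_step f s d h d' h' : inv f -> enum_weak f s -> dims f d h -> dims (run f s) d' h' ->
  forall k, d' k.+1 = d k.+1 + Z.b2z (pushes_right (first_effect d h s k) || pushes_left (first_effect d h s k.+1)) /\
    h' k.+1 = h k.+1 + Z.b2z (first_effect d h s k).
Proof.
move=> If es D D' k; have Iq := inv_rotn k.+1 If; have eq := enum_rotn k.+1 es.
have [a1 b1] := D k.+1; have [a2 b2] := D k.+2; have [a1' b1'] := D' k.+1.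
rewrite -run_rotn in a1' b1'; split.
  apply: (diag_uniq a1'); have := diag_round Iq eq b1 (topv_rot b2) a1.
  congr (diag_extent _ (_ + Z.b2z _)); congr (_ || _); rewrite /first_effect.
    by case: (first_in_row _ _).
  have -> : rot_seq k.+2 s = map rotz (rot_seq k.+1 s) by [].
  rewrite fstr_rot; case: (first_in_col _ _) => [z|] //=.
  by congr (_ =? _); zar.
apply: (topv_uniq b1'); have := topv_round Iq eq b1.
by rewrite /first_effect; case: (first_in_row _ _).
Qed.

End GoodConfigurations.

(** * The weight table and its verification by computation *)

Section Weights.
Local Open Scope Z_scope.

(* A numerical supersolution of [drift_check], scaled by 1000 and indexed by the slacks read as
   base 5 digits. *)
Definition weight_table : seq (Z * Z) :=
  [:: (0, 1000); (250, 1860); (150, 2180); (50, 1860); (130, 2290); (30, 2180); (10, 1860);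
   (126, 2180); (26, 2290); (6, 2180); (2, 1860); (500, 2418); (400, 2832); (300, 2667);
   (200, 2832); (100, 2418); (380, 2975); (280, 3012); (180, 3069); (80, 2832); (260,
   2730); (160, 3012); (60, 2667); (140, 2975); (40, 2832); (20, 2418); (376, 2832); (276,
   3069); (176, 3012); (76, 2975); (256, 3012); (156, 3164); (56, 3012); (136, 3012); (36,
   3069); (16, 2832); (252, 2667); (152, 3012); (52, 2730); (132, 3069); (32, 3012); (12,
   2667); (128, 2832); (28, 2975); (8, 2832); (4, 2418)].

Definition weight (a b c d : Z) : Z :=
  let i := a + 5 * (b + 5 * (c + 5 * d)) in
  foldr (fun p acc => if i =? p.1 then p.2 else acc) 0 weight_table.

(** A tip without weak cells has the single alternative of making no pick. *)
Definition choices (o : seq (bool * bool)) := if o is [::] then [:: None] else map Some o.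

Definition side_gain e e' := Z.b2z (pushes_right e || pushes_left e').

(* The factor (21/20)^a for the a sides gained, multiplied by 20^4 = 160000. *)
Definition outcome_weight (a b c d : Z) (e0 e1 e2 e3 : option (bool * bool)) : Z :=
  let a0 := side_gain e0 e1 in let a1 := side_gain e1 e2 in
  let a2 := side_gain e2 e3 in let a3 := side_gain e3 e0 in
  weight (a + a3 + a0 - 2 * Z.b2z e0) (b + a0 + a1 - 2 * Z.b2z e1)
     (c + a1 + a2 - 2 * Z.b2z e2) (d + a2 + a3 - 2 * Z.b2z e3) *
  21 ^ (a0 + a1 + a2 + a3) * 20 ^ (4 - (a0 + a1 + a2 + a3)).

Definition slack_ok (x : Z) := (x =? 0) || (x =? 2) || (x =? 4).

Definition slack_step_ok (a b c d : Z) (e0 e1 e2 e3 : option (bool * bool)) :=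
  let a0 := side_gain e0 e1 in let a1 := side_gain e1 e2 in
  let a2 := side_gain e2 e3 in let a3 := side_gain e3 e0 in
  slack_ok (a + b + c + d + 2 * (a0 + a1 + a2 + a3) -
    2 * (Z.b2z e0 + Z.b2z e1 + Z.b2z e2 + Z.b2z e3)) &&
  (a + b + c + d + 2 * (a0 + a1 + a2 + a3) -
    2 * (Z.b2z e0 + Z.b2z e1 + Z.b2z e2 + Z.b2z e3) <=? a + b + c + d).

Definition sumZ (A : Type) (F : A -> Z) (s : seq A) := foldr (fun x acc => F x + acc) 0 s.

Definition sizeZ (A : Type) (s : seq A) := sumZ (fun=> 1) s.

(** The first picks at the four tips are independent and uniform ([sum_first4]), so the mean is a
    fourfold average; multiplying by the numbers of alternatives keeps the test in integers. The
    second conjunct confines the total slack to 0, 2, 4 and forbids its increase. *)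
Definition drift_check (a b c d : Z) :=
  all (fun o0 => all (fun o1 => all (fun o2 => all (fun o3 =>
    let c0 := choices o0 in let c1 := choices o1 in let c2 := choices o2 in let c3 := choices o3 in
    (sumZ (fun e0 => sumZ (fun e1 => sumZ (fun e2 => sumZ (outcome_weight a b c d e0 e1 e2) c3) c2) c1) c0 <=?
     sizeZ c0 * sizeZ c1 * sizeZ c2 * sizeZ c3 * (160000 * weight a b c d)) &&
    all (fun e0 => all (fun e1 => all (fun e2 => all (slack_step_ok a b c d e0 e1 e2) c3) c2) c1) c0)
   (tip_options d)) (tip_options c)) (tip_options b)) (tip_options a).

Definition dom5 : seq Z := [:: 0; 1; 2; 3; 4].

Lemma drift_check_all : all (fun a => all (fun b => all (fun c => all (fun d =>
  if slack_ok (a + b + c + d) then drift_check a b c d else true) dom5) dom5) dom5) dom5.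
Proof. by vm_compute. Qed.

Lemma mem_dom5 x : 0 <= x -> x <= 4 -> x \in dom5.
Proof.
move=> l1 l2; have [->|[->|[->|[->|->]]]] // : x = 0 \/ x = 1 \/ x = 2 \/ x = 3 \/ x = 4.
zar.
Qed.

Lemma drift_checkP a b c d : 0 <= a -> 0 <= b -> 0 <= c -> 0 <= d -> slack_ok (a + b + c + d) -> drift_check a b c d.
Proof.
move=> a0 b0 c0 d0 s; have s4 : a + b + c + d <= 4.
  by move: s; rewrite /slack_ok => /orP[/orP[]|] /Z.eqb_eq; zar.
have M := mem_dom5.
have /allP/(_ a (M a a0 ltac:(zar)))/allP/(_ b (M b b0 ltac:(zar))) := drift_check_all.
by move=> /allP/(_ c (M c c0 ltac:(zar)))/allP/(_ d (M d d0 ltac:(zar))); rewrite s.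
Qed.

Lemma vt_ge1 a b c d : 0 <= a -> 0 <= b -> 0 <= c -> 0 <= d -> slack_ok (a + b + c + d) ->
  1000 <= weight a b c d <= 3164.
Proof.
have : all (fun a => all (fun b => all (fun c => all (fun d =>
  if slack_ok (a + b + c + d) then (1000 <=? weight a b c d) && (weight a b c d <=? 3164) else true)
    dom5) dom5) dom5) dom5.
  by vm_compute.
move=> H a0 b0 c0 d0 s; have s4 : a + b + c + d <= 4.
  by move: s; rewrite /slack_ok => /orP[/orP[]|] /Z.eqb_eq; zar.
have M := mem_dom5.
have /allP/(_ a (M a a0 ltac:(zar)))/allP/(_ b (M b b0 ltac:(zar))) := H.
move=> /allP/(_ c (M c c0 ltac:(zar)))/allP/(_ d (M d d0 ltac:(zar))); rewrite s /=.
by case/andP => /Z.leb_le ? /Z.leb_le.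
Qed.

Lemma sokP f d h : good f d h -> slack_ok (slack d h 0 + slack d h 1 + slack d h 2 + slack d h 3).
Proof.
by case=> _ _; rewrite /total_slack /slack_ok => -[->|[->|[-> _]]].
Qed.

End Weights.

(** * Decision procedures for finite shapes given as lists of cells *)

Section Shapes.
Local Open Scope Z_scope.
Implicit Types l s : seq (Z * Z).

Definition of_seq l : Z -> Z -> bool := fun x y => has (fun z => (z.1 =? x) && (z.2 =? y)) l.

Lemma shpP l x y : reflect ((x, y) \in l) (of_seq l x y).
Proof.
apply: (iffP hasP) => [[z zl /andP[/Z.eqb_eq e1 /Z.eqb_eq e2]]|h].
  by rewrite -e1 -e2 -surjective_pairing.
by exists (x, y) => //=; rewrite !Z.eqb_refl.
Qed.
Lemma shpE l x y : of_seq l x y = ((x, y) \in l).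
Proof. by apply/shpP/idP. Qed.

Definition trz (z : Z * Z) : Z * Z := (z.2, z.1).
Definition fvz (z : Z * Z) : Z * Z := (z.1, - z.2 + 1).

Lemma shp_fl l : fl (of_seq l) = of_seq (map flz l).
Proof.
apply/funext => x; apply/funext => y; rewrite /fl /of_seq has_map; apply: eq_has => z /=.
by congr (_ && _); apply/idP/idP => /Z.eqb_eq e; apply/Z.eqb_eq; zar.
Qed.
Lemma shp_fv l : fv (of_seq l) = of_seq (map fvz l).
Proof.
apply/funext => x; apply/funext => y; rewrite /fv /of_seq has_map; apply: eq_has => z /=.
by congr (_ && _); apply/idP/idP => /Z.eqb_eq e; apply/Z.eqb_eq; zar.
Qed.
Lemma shp_tr l : tr (of_seq l) = of_seq (map trz l).
Proof.
by apply/funext => x; apply/funext => y; rewrite /tr /of_seq has_map; apply: eq_has => z /=; rewrite andbC.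
Qed.

Definition zrange (a b : Z) : seq Z := [seq a + Z.of_nat i | i <- iota 0 (Z.to_nat (b - a + 1))].
Lemma mem_zrange a b x : a <= x <= b -> x \in zrange a b.
Proof.
move=> l; apply/mapP; exists (Z.to_nat (x - a)); last by zar.
by rewrite mem_iota; zar.
Qed.

Definition row_itv_b l := all (fun z1 => all (fun z2 =>
  if z1.2 =? z2.2 then all (fun x => of_seq l x z1.2) (zrange z1.1 z2.1) else true) l) l.
Definition row_lap_b l := all (fun z1 => all (fun z2 =>
  if z1.2 <? z2.2 then has (fun u => (u.2 =? z1.2) && of_seq l u.1 (u.2 + 1)) l else true) l) l.
Definition thick_b l := all (fun z1 => all (fun z2 =>
  if z1.2 =? z2.2 + 2 then has (fun u => (u.2 =? z2.2 + 1) && of_seq l (u.1 + 1) u.2) l else true) l) l.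
Definition no_kink_b l := all (fun z => let: (p, h) := (z.1, z.2 + -1) in
  [&& of_seq l p h, of_seq l (p + -1) h, of_seq l (p + -2) h & of_seq l (p + -3) h] ==> of_seq l (p + -1) (h + 1)) l.
Definition tip_ok_b l := all (fun z => let: (x, h) := (z.1, z.2) in
  if [&& all (fun u => negb (u.2 =? h + 1)) l, of_seq l (x + 1) h & of_seq l (x + 2) h]
  then ~~ of_seq l (x + 3) h && ~~ weakb (of_seq l) (x + 3) h else true) l.
Definition core_b l := all (fun z => (3 <=? coop_nb (of_seq l) z.1 z.2) ||
  has (fun u => of_seq l u.1 u.2 && (3 <=? coop_nb (of_seq l) u.1 u.2))
   [:: (z.1 + 1, z.2); (z.1 + -1, z.2); (z.1, z.2 + 1); (z.1, z.2 + -1)]) l.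

Definition frame_b l := [&& row_itv_b l, row_lap_b l, thick_b l, no_kink_b l & tip_ok_b l].

Lemma frame_bP l : frame_b l -> shape1 (of_seq l) /\ tip_ok (of_seq l).
Proof.
case/and5P => /allP h1 /allP h2 /allP h3 /allP h4 /allP h5; split; first split.
- move=> x1 x2 x y /shpP f1 /shpP f2 lx; have /allP/(_ _ f2) := h1 _ f1.
  by rewrite /= Z.eqb_refl => /allP/(_ x (mem_zrange lx)).
- move=> x x' y y' /shpP f1 /shpP f2 ly; have /allP/(_ _ f2) /= := h2 _ f1.
  case: Z.ltb_spec => // [_|]; last zar.
  case/hasP => -[a b] ab /andP[/= /Z.eqb_eq eb f]; exists a.
  by rewrite -eb; split => //; apply/shpP.
- move=> a b y /shpP f1 /shpP f2; have /allP/(_ _ f2) /= := h3 _ f1.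
  rewrite (eqbT (_ : y + 1 = y + -1 + 2)); last zar.
  case/hasP => -[p q] pq /andP[/= /Z.eqb_eq eb f]; exists p.
  have ey : y = q by zar.
  by rewrite ey; split => //; apply/shpP.
- move=> p h f0 f1 f2 f3 /shpP g; have := h4 _ g; rewrite /= zPN f0 f1 f2 f3 /=.
  by rewrite ?zNP.
- move=> x h e /shpP f0 f1 f2; have := h5 _ f0; rewrite /= f1 f2 !andbT.
  suff -> : all (fun u => ~~ (u.2 =? h + 1)) l by [].
  apply/allP => -[a b] ab /=; apply/negP => /Z.eqb_eq eb.
  by have /negP := e a; apply; apply/shpP; rewrite -eb.
Qed.

Lemma core_bP l : core_b l -> core (of_seq l).
Proof.
move=> /allP H x y /shpP /H /= /orP[/Z.leb_le|]; first by left.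
move=> h; right; move: h; rewrite /= orbF.
have N := (adjE x y, adjW x y, adjN x y, adjS x y).
by move=> /or4P[] /andP[f /Z.leb_le n]; eexists _, _; (split; [|exact: f|exact: n]); constructor.
Qed.

Definition shape_b l := all frame_b [:: l; map flz l; map fvz l; map flz (map fvz l);
  map trz l; map trz (map flz l); map trz (map fvz l); map trz (map flz (map fvz l))].

Lemma shape_bP l : shape_b l -> all_frames shape1 (of_seq l) /\ all_frames tip_ok (of_seq l).
Proof.
move=> /= /andP[/frame_bP[a0 b0]] /andP[/frame_bP[a1 b1]] /andP[/frame_bP[a2 b2]].
move=> /andP[/frame_bP[a3 b3]] /andP[/frame_bP[a4 b4]] /andP[/frame_bP[a5 b5]].
move=> /andP[/frame_bP[a6 b6]] /andP[/frame_bP[a7 b7] _].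
rewrite -!shp_fv -!shp_fl -!shp_fv -!shp_tr -?shp_fl -?shp_fv in a1 b1 a2 b2 a3 b3 a4 b4 a5 b5 a6 b6 a7 b7.
by split; split; split.
Qed.

Lemma fin_shp l : bounded (of_seq l).
Proof.
elim: l => [|z l [B H]]; first by exists 0.
exists (Z.abs B + Z.abs z.1 + Z.abs z.2) => x y; rewrite /of_seq /= => /orP[|/H]; last zar.
by move=> /andP[/Z.eqb_eq e1 /Z.eqb_eq e2]; zar.
Qed.

(** Starting the fold at the head keeps the maximum attained even when all values are negative. *)
Definition max_over (F : Z * Z -> Z) l : Z := foldr (fun z m => Z.max (F z) m) (F (head (0, 0) l)) l.

Lemma lmaxP F l : l != [::] ->
  (exists z : Z * Z, z \in l /\ F z = max_over F l) /\ forall z : Z * Z, z \in l -> F z <= max_over F l.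
Proof.
rewrite /max_over; case: l => // a l _; set i := F (head _ _).
have H s : (exists z : Z * Z, z \in a :: s /\ F z = foldr (fun z m => Z.max (F z) m) i s) /\
   forall z : Z * Z, z \in s -> F z <= foldr (fun z m => Z.max (F z) m) i s.
  elim: s => [|b s [[z [zs e]] IH]] /=.
    by split => //; exists a; rewrite mem_head.
  split; last first.
    move=> u; rewrite inE => /orP[/eqP ->|/IH]; zar.
  have [->|->] : Z.max (F b) (foldr (fun z m => Z.max (F z) m) i s) = F b \/
     Z.max (F b) (foldr (fun z m => Z.max (F z) m) i s) = F z by zar.
    by exists b; rewrite !inE eqxx orbT.
  by exists z; move: zs; rewrite !inE => /orP[->|->]; rewrite ?orbT.
have [[z [zs e]] K] := H (a :: l); split => //.
by exists z; split => //; move: zs; rewrite !inE => /orP[->|].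
Qed.

Lemma rotn_shp k l : rotn k (of_seq l) = of_seq (map (iter k rotz) l).
Proof.
elim: k => [|k IH]; first by rewrite map_id.
rewrite rotnS IH /rot shp_tr shp_fl -!map_comp.
by congr of_seq; apply: eq_map => z.
Qed.

Definition diag_of_seq l k := max_over (fun z => (iter k rotz z).1 + (iter k rotz z).2) l.
Definition top_of_seq l k := max_over (fun z => (iter k rotz z).2) l.

Lemma dims_shp l : l != [::] -> dims (of_seq l) (diag_of_seq l) (top_of_seq l).
Proof.
move=> ne k; rewrite rotn_shp; split.
  have [[z [zl e]] H] := lmaxP (fun z => (iter k rotz z).1 + (iter k rotz z).2) ne; split.
    exists (iter k rotz z).1, (iter k rotz z).2; split => //.
    by apply/shpP; rewrite -surjective_pairing; apply: map_f.
  by move=> x y /shpP/mapP[u ul eu]; have := H _ ul; rewrite -eu.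
have [[z [zl e]] H] := lmaxP (fun z => (iter k rotz z).2) ne; split.
  exists (iter k rotz z).1; rewrite /top_of_seq -e.
  by apply/shpP; rewrite -surjective_pairing; apply: map_f.
by move=> x y /shpP/mapP[u ul eu]; have := H _ ul; rewrite -eu.
Qed.

Definition lsumU l := let d := diag_of_seq l in let h := top_of_seq l in
  2 * (d 0%N + d 1%N + d 2%N + d 3%N) - 2 * (h 0%N + h 1%N + h 2%N + h 3%N) - 4.

Lemma lsumUE l : l != [::] -> total_slack (diag_of_seq l) (top_of_seq l) = lsumU l.
Proof.
move=> ne; have [e1 e2] := dims4 0 (dims_shp ne).
by rewrite /total_slack /slack /lsumU; rewrite !add0n in e1 e2; zar.
Qed.

Definition good_b l := [&& l != [::], shape_b l, core_b l & (lsumU l =? 0) || (lsumU l =? 2)].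

Lemma good_bP l : good_b l -> good (of_seq l) (diag_of_seq l) (top_of_seq l).
Proof.
case/and4P => ne /shape_bP[s t] /core_bP c u; split.
- split => //; [by left|exact: fin_shp|].
  by case: l ne {s t c u} => // -[x y] l _; exists x, y; rewrite /of_seq /= !Z.eqb_refl.
- exact: dims_shp.
- by rewrite lsumUE //; case/orP: u => /Z.eqb_eq; auto.
Qed.

(* The only tetromino of total slack 4. *)
Definition square : seq (Z * Z) := [:: (0, 0); (1, 0); (0, 1); (1, 1)].

Lemma good_square : good (of_seq square) (diag_of_seq square) (top_of_seq square).
Proof.
have [s t] : all_frames shape1 (of_seq square) /\ all_frames tip_ok (of_seq square).
  by apply: shape_bP; vm_compute.
have sq : is_square (of_seq square).
  move=> x y; rewrite shpE !inE /=; apply/idP/idP.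
    by move=> /or4P[] /eqP[-> ->].
  move=> /andP[/andP[/Z.leb_le a /Z.leb_le b] /andP[/Z.leb_le c /Z.leb_le d]].
  have [->|->] : x = 0 \/ x = 1 by zar.
    by have [->|->] : y = 0 \/ y = 1 by zar.
  by have [->|->] : y = 0 \/ y = 1 by zar.
split.
- by split => //; [right|exact: fin_shp|exists 0, 0].
- exact: dims_shp.
right; right; split; first by rewrite lsumUE.
exists 1, 0, (fun=> Pend); left; split; [zar|zar|].
have R k : rotn k (of_seq square) = of_seq square.
  elim: k => // k IH; rewrite rotnS IH -[rot _]/(rotn 1 _) rotn_shp.
  apply/funext => x; apply/funext => y; rewrite !shpE.
  by rewrite /= !inE; case: eqP; case: eqP; case: eqP; case: eqP.
move=> k; rewrite /= R; have S x y : of_seq square x y -> 0 <= x <= 1 /\ 0 <= y <= 1.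
  by rewrite sq => /andP[/andP[/Z.leb_le a /Z.leb_le b] /andP[/Z.leb_le c /Z.leb_le d]].
split.
- split => //; try by move=> x y /S; zar.
  by split; [exists 0|move=> x y /S; rewrite /tip_height; zar].
- by move=> _ x y /S; zar.
- by move=> _ x y /S; zar.
- by move=> _; split => //; exists 0, 1.
- by case=> x [y [/S]]; zar.
Qed.

End Shapes.

(** * Exhaustive computation of the first round *)

Section FirstRound.
Local Open Scope Z_scope.
Implicit Types l s : seq (Z * Z).

Definition lex_lt (u v : Z * Z) := (u.1 <? v.1) || ((u.1 =? v.1) && (u.2 <? v.2)).
(** Sorted lists make equal shapes reached in different orders syntactically equal, so that [undup]
    merges them. *)
Fixpoint insert_sorted (z : Z * Z) l := if l is u :: l' then
  (if lex_lt z u then z :: l else u :: insert_sorted z l') else [:: z].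

Lemma mem_insz z l u : (u \in insert_sorted z l) = (u == z) || (u \in l).
Proof.
elim: l => [|v l IH] //=; case: ifP => _; first by rewrite inE.
by rewrite !inE IH orbCA.
Qed.

Definition flip_weak_seq l (z : Z * Z) := if weakb (of_seq l) z.1 z.2 then
  (if z \in l then [seq u <- l | u != z] else insert_sorted z l) else l.

Lemma shp_eq l l' : l =i l' -> of_seq l = of_seq l'.
Proof. by move=> h; apply/funext => x; apply/funext => y; rewrite !shpE h. Qed.

Lemma shp_updl l z : of_seq (flip_weak_seq l z) = flip_weak (of_seq l) z.
Proof.
apply/funext => x; apply/funext => y; rewrite /flip_weak /flip_weak_seq; case: (weakb _ _ _); rewrite ?andbF // andbT.
have E : (x =? z.1) && (y =? z.2) = ((x, y) == z).
  apply/andP/eqP => [[/Z.eqb_eq -> /Z.eqb_eq ->]|<-]; first by rewrite -surjective_pairing.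
  by rewrite !Z.eqb_refl.
rewrite E; case: ifP => zl; rewrite !shpE ?mem_filter ?mem_insz; case: eqP => [->|] //=.
- by rewrite zl.
- by rewrite zl.
Qed.

(** A state pairs the current shape with the cells still to be updated; the cells already updated
    matter only through the shape. *)
Definition outstep (L : seq (seq (Z * Z) * seq (Z * Z))) :=
  undup (flatten [seq [seq (flip_weak_seq p.1 z, [seq u <- p.2 | u != z]) | z <- p.2] | p <- L]).

Definition weak_list l := [seq z <- undup (l ++ flatten [seq [:: (z.1 + 1, z.2); (z.1 + -1, z.2);
   (z.1, z.2 + 1); (z.1, z.2 + -1)] | z <- l]) | weakb (of_seq l) z.1 z.2].

Definition outcomes l := [seq p.1 | p <- iter (size (weak_list l)) outstep [:: (l, weak_list l)]].

Lemma outstepP (L : seq (seq (Z * Z) * seq (Z * Z))) l w s : (l, w) \in L -> uniq w -> perm_eq s w ->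
  exists l', (l', [::]) \in iter (size w) outstep L /\ run (of_seq l) s = of_seq l'.
Proof.
elim: s L l w => [|z s IH] L l w lw uw pw.
  by move: (perm_size pw) lw => /= /esym/size0nil -> lw; exists l.
have zw : z \in w by rewrite -(perm_mem pw) mem_head.
have pw' : perm_eq s [seq u <- w | u != z].
  have := perm_filter (fun u => u != z) pw; rewrite /= eqxx /= => h.
  have us : uniq (z :: s) by rewrite (perm_uniq pw).
  suff <- : [seq u <- s | u != z] = s by [].
  rewrite (eq_in_filter (a2 := predT)) ?filter_predT // => u us'.
  by apply/eqP => e; move: us; rewrite /= -e us'.
have in1 : (flip_weak_seq l z, [seq u <- w | u != z]) \in outstep L.
  rewrite mem_undup; apply/flattenP; exists [seq (flip_weak_seq l z, [seq u <- w | u != z]) | z <- w].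
    by apply/mapP; exists (l, w).
  by apply/mapP; exists z.
have [l' [h1 h2]] := IH _ _ _ in1 (filter_uniq _ uw) pw'.
exists l'; split; last by rewrite /run /= -shp_updl.
have -> : size w = (size [seq u <- w | u != z]).+1 by rewrite -(perm_size pw) -(perm_size pw').
by rewrite iterSr.
Qed.

Lemma enum_wlist l : enum_weak (of_seq l) (weak_list l).
Proof.
split; first by apply: filter_uniq; apply: undup_uniq.
move=> z; rewrite mem_filter; case w: (weakb _ _ _) => //=; rewrite mem_undup mem_cat.
case zl: (z \in l) => //=; have fz : ~~ of_seq l z.1 z.2 by rewrite shpE -surjective_pairing zl.
have [u [v [nr /shpP fu]]] := wk_nbr fz w.
apply/flattenP; exists [:: (u + 1, v); (u + -1, v); (u, v + 1); (u, v + -1)].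
  by apply/mapP; exists (u, v).
rewrite [z]surjective_pairing; case: nr {fu} => /=; rewrite !inE ?zE eqxx ?orbT //.
Qed.

Lemma outsP l s : enum_weak (of_seq l) s -> exists l', l' \in outcomes l /\ run (of_seq l) s = of_seq l'.
Proof.
move=> [us ws]; have [uw ww] := enum_wlist l.
have [|l' [h1 h2]] := @outstepP [:: (l, weak_list l)] l (weak_list l) s (mem_head _ _) uw.
  by apply: uniq_perm => // z; rewrite ws ww.
by exists l'; split => //; apply/mapP; exists (l', [::]).
Qed.

Definition tetI : seq (Z * Z) := [:: (0, 0); (1, 0); (2, 0); (3, 0)].
Definition tetL : seq (Z * Z) := [:: (0, 0); (1, 0); (2, 0); (2, 1)].
Definition tetS : seq (Z * Z) := [:: (0, 0); (1, 0); (1, 1); (2, 1)].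
Definition tetT : seq (Z * Z) := [:: (0, 0); (1, 0); (1, 1); (2, 0)].
Definition slow_tetrominoes := [:: tetI; tetL; tetS].

(* The outcomes of the first round that are not [good]: stable hexominoes, and shapes that die out. *)
Definition degenerate_shapes : seq (seq (Z * Z)) := [::
  [:: (0, 0); (1, -1); (1, 0); (1, 1); (2, 0); (3, 0)];
  [:: (0, 0); (1, 0); (2, -1); (2, 0); (2, 1); (3, 0)];
  [:: (0, 0); (2, 0)]; [:: (1, 1)]; [:: (1, 0)]; [::]].

(** Contains the standard tetrominoes and every outcome of the first round of a slow one, and limits
    the sum of the four diagonal extents to 32 ([dims_box]). *)
Definition box l := all (fun z => [&& -2 <=? z.1, z.1 <=? 5, -2 <=? z.2 & z.2 <=? 5]) l.

(** The size condition lets [start_pot] recognise the slow tetrominoes among the configurations that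
    are not good by their four cells. *)
Lemma pre4_outs : all (fun p => all (fun l => [&& uniq l, box l &
  good_b l || ((size l != 4%N) && (l \in degenerate_shapes))]) (outcomes p)) slow_tetrominoes.
Proof. by vm_compute. Qed.

Lemma smalls_outs : all (fun p => [&& uniq p, size p != 4%N &
  (weak_list p == [::]) || ((p != [::]) && all (fun l => l == [::]) (outcomes p))]) degenerate_shapes.
Proof. by vm_compute. Qed.

Lemma good_tetT : good_b tetT. Proof. by vm_compute. Qed.

Lemma dims_box l d h : box l -> dims (of_seq l) d h -> d 0%N + d 1%N + d 2%N + d 3%N <= 32.
Proof.
move=> /allP bl D; have B x y : of_seq l x y -> -2 <= x <= 5 /\ -2 <= y <= 5.
  by move=> /shpP/bl/and4P[/Z.leb_le /= h1 /Z.leb_le h2 /Z.leb_le h3 /Z.leb_le h4].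
have [[[x0 [y0 [/B f0 e0]]] _] _] := D 0%N.
have [[[x1 [y1 [f1 e1]]] _] _] := D 1%N; have {}f1 := B _ _ f1.
have [[[x2 [y2 [f2 e2]]] _] _] := D 2%N; have {}f2 := B _ _ f2.
have [[[x3 [y3 [f3 e3]]] _] _] := D 3%N; have {}f3 := B _ _ f3.
clear B bl D; zar.
Qed.
End FirstRound.

Local Open Scope ring_scope.

(** * First elements of disjoint classes in a uniform ordering *)

Section FirstInOrder.
Variables (T : eqType) (R : comNzRingType).
Implicit Types (s : seq T) (p q : pred T).

Definition first p s := ohead [seq z <- s | p z].
Definition firsts p s := if [seq z <- s | p z] is [::] then [:: None] else map Some [seq z <- s | p z].

Definition swap (a b z : T) := if z == a then b else if z == b then a else z.

Lemma swapK a b : involutive (swap a b).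
Proof.
move=> z; rewrite /swap; have [->|za] := eqVneq z a.
  by have [->|] := eqVneq b a; rewrite ?eqxx.
by have [->|zb] := eqVneq z b; rewrite ?eqxx // (negbTE za) (negbTE zb).
Qed.

Lemma first_map p f s : {in s, forall z, p (f z) = p z} ->
  first p (map f s) = omap f (first p s).
Proof.
rewrite /first; elim: s => //= z s IH H; rewrite H ?mem_head //.
case: (p z) => //=; apply: IH => u us; apply: H; rewrite inE us orbT //.
Qed.

Lemma perm_swap s0 a b : a \in s0 -> b \in s0 -> uniq s0 ->
  perm_eq [seq map (swap a b) s | s <- permutations s0] (permutations s0).
Proof.
move=> sa sb us; have inj : injective (map (swap a b)) by apply/inj_map/inv_inj/swapK.
apply: uniq_perm; rewrite ?map_inj_uniq ?permutations_uniq // => s.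
have M t : (map (swap a b) t \in permutations s0) = (t \in permutations s0).
  rewrite !mem_permutations; have e : perm_eq (map (swap a b) s0) s0.
    apply: uniq_perm => // [|z]; first by rewrite map_inj_uniq //; apply/inv_inj/swapK.
    rewrite -(swapK a b z) (mem_map (inv_inj (swapK a b))) swapK /swap.
    by have [->|_] := eqVneq z a; [rewrite sa sb|have [->|//] := eqVneq z b; rewrite sa sb].
  rewrite -(permPr e); apply/idP/idP => [|h]; last exact: perm_map.
  by apply: perm_map_inj; apply/inv_inj/swapK.
have -> : s = map (swap a b) (map (swap a b) s).
  by rewrite (mapK (swapK a b)).
by rewrite (mem_map inj) !M.
Qed.

Definition swap_stable s0 p (H : option T -> seq T -> R) := forall a b s o,
  a \in s0 -> p a -> b \in s0 -> p b -> s \in permutations s0 ->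
  H o (map (swap a b) s) = H o s.

(** In probabilistic terms: in a uniform ordering the first member of the class [p] is uniform on
    the class, and independent of whatever is unaffected by swapping two members. *)
Lemma sum_first s0 p H : uniq s0 -> swap_stable s0 p H ->
  (size (firsts p s0))%:R * \sum_(s <- permutations s0) H (first p s) s =
  \sum_(s <- permutations s0) \sum_(o <- firsts p s0) H o s.
Proof.
move=> us SH; set G := [seq z <- s0 | p z].
have FE s : s \in permutations s0 -> perm_eq [seq z <- s | p z] G.
  by rewrite mem_permutations; apply: perm_filter.
rewrite /firsts -/G; case EG : G => [|g0 G'].
  rewrite mul1r; rewrite big_seq [RHS]big_seq; apply: eq_bigr => s sp.
  rewrite big_seq1 /first; have := FE _ sp; rewrite EG => /perm_size.
  by move/size0nil => ->.
rewrite -EG size_map.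
have GP g : g \in G -> g \in s0 /\ p g by rewrite mem_filter => /andP[].
pose K g o := \sum_(s <- permutations s0) (first p s == Some g)%:R * H o s.
(* Swapping [g] and [g'] permutes the orderings, exchanges the events that one or the other comes
   first, and leaves [H o] unchanged. *)
have KE g g' o : g \in G -> g' \in G -> K g o = K g' o.
  move=> /GP[sg pg] /GP[sg' pg']; rewrite /K -(perm_big _ (perm_swap sg sg' us)) big_map.
  rewrite big_seq [RHS]big_seq; apply: eq_bigr => s sp; rewrite SH //; congr (_%:R * _).
  rewrite first_map; last first.
    by move=> z _; rewrite /swap; have [->|_] := eqVneq z g; rewrite ?pg ?pg' //;
       have [->|] := eqVneq z g'; rewrite ?pg ?pg'.
  congr nat_of_bool; case: (first p s) => [z|] //=; apply/eqP/eqP => -[].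
    by move=> e; congr Some; rewrite -(swapK g g' z) e /swap eqxx.
  by move=> ->; rewrite /swap eqxx; have [->|] := eqVneq g' g.
have D s (f : T -> R) : s \in permutations s0 ->
    exists2 g, g \in G & first p s = Some g /\ \sum_(g <- G) (first p s == Some g)%:R * f g = f g.
  move=> sp; have := FE _ sp; rewrite /first; case E: [seq z <- s | p z] => [|g t] pe.
    by move/perm_size: pe; rewrite EG.
  have gG : g \in G by rewrite -(perm_mem pe) mem_head.
  exists g => //; split => //.
  rewrite (bigD1_seq g) ?filter_uniq //= eqxx mul1r big1 ?addr0 // => g' ne.
  by case: eqP => [[e]|]; [rewrite e eqxx in ne|rewrite mul0r].
transitivity ((size G)%:R * \sum_(g <- G) K g (Some g)).
  congr (_ * _); rewrite /K exchange_big /= big_seq [RHS]big_seq; apply: eq_bigr => s sp.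
  by have [g _ [e1 e2]] := D s (fun g => H (Some g) s) sp; rewrite [RHS]e2 e1.
transitivity (\sum_(g' <- G) \sum_(g <- G) K g (Some g')).
  rewrite mulr_sumr big_seq [RHS]big_seq; apply: eq_bigr => g' gg'.
  rewrite (eq_big_seq (fun=> K g' (Some g'))); last by move=> g gg; apply: KE.
  by rewrite big_const_seq count_predT iter_addr_0 mulr_natl.
rewrite [RHS]exchange_big /= big_map; apply: eq_bigr => g' _.
rewrite /K exchange_big /= big_seq [RHS]big_seq; apply: eq_bigr => s sp.
by have [g _ [_ ->]] := D s (fun=> H (Some g') s) sp.
Qed.

Lemma first_swap s0 p q a b s : (forall z, z \in s0 -> p z -> ~~ q z) ->
  a \in s0 -> p a -> b \in s0 -> p b -> s \in permutations s0 ->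
  first q (map (swap a b) s) = first q s.
Proof.
move=> D sa pa sb pb; rewrite mem_permutations => sp; have qa := D _ sa pa; have qb := D _ sb pb.
have -> : first q (map (swap a b) s) = omap (swap a b) (first q s).
  apply: first_map => z _; rewrite /swap.
  have [->|_] := eqVneq z a; first by rewrite (negbTE qa) (negbTE qb).
  by have [->|//] := eqVneq z b; rewrite (negbTE qa) (negbTE qb).
rewrite /first; case E: [seq z <- s | q z] => [|z t] //=; congr Some.
have : q z by have : z \in [seq z <- s | q z]; [rewrite E mem_head|rewrite mem_filter => /andP[]].
rewrite /swap; have [->|_] := eqVneq z a; first by rewrite (negbTE qa).
by have [->|//] := eqVneq z b; rewrite (negbTE qb).
Qed.

(** A swap inside one class does not move the first members of classes disjoint from it, so
    [sum_first] applies to the four classes in turn. *)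
Lemma sum_first4 s0 (p0 p1 p2 p3 : pred T) (F : option T -> option T -> option T -> option T -> R) :
  uniq s0 ->
  (forall z, z \in s0 -> [/\ p0 z -> [&& ~~ p1 z, ~~ p2 z & ~~ p3 z],
     p1 z -> ~~ p2 z && ~~ p3 z & p2 z -> ~~ p3 z]) ->
  (size (firsts p0 s0) * size (firsts p1 s0) * size (firsts p2 s0) * size (firsts p3 s0))%:R *
   \sum_(s <- permutations s0) F (first p0 s) (first p1 s) (first p2 s) (first p3 s) =
  (size s0)`!%:R * \sum_(o0 <- firsts p0 s0) \sum_(o1 <- firsts p1 s0)
    \sum_(o2 <- firsts p2 s0) \sum_(o3 <- firsts p3 s0) F o0 o1 o2 o3.
Proof.
move=> us D.
have d30 z : z \in s0 -> p3 z -> ~~ p0 z.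
  by move=> /D[h _ _]; apply: contraTN => /h /and3P[].
have d31 z : z \in s0 -> p3 z -> ~~ p1 z.
  by move=> /D[_ h _]; apply: contraTN => /h /andP[].
have d32 z : z \in s0 -> p3 z -> ~~ p2 z by move=> /D[_ _ h]; apply: contraTN => /h.
have d20 z : z \in s0 -> p2 z -> ~~ p0 z.
  by move=> /D[h _ _]; apply: contraTN => /h /and3P[].
have d21 z : z \in s0 -> p2 z -> ~~ p1 z.
  by move=> /D[_ h _]; apply: contraTN => /h /andP[].
have d10 z : z \in s0 -> p1 z -> ~~ p0 z.
  by move=> /D[h _ _]; apply: contraTN => /h /and3P[].
rewrite !natrM -!mulrA.
rewrite (sum_first (H := fun o s => F (first p0 s) (first p1 s) (first p2 s) o)) //; last first.
  move=> a b s o sa pa sb pb sp.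
  by rewrite (first_swap d30 sa pa sb pb sp) (first_swap d31 sa pa sb pb sp)
    (first_swap d32 sa pa sb pb sp).
rewrite (sum_first (H := fun o s => \sum_(o3 <- firsts p3 s0) F (first p0 s) (first p1 s) o o3)) //;
  last first.
  move=> a b s o sa pa sb pb sp.
  by rewrite (first_swap d20 sa pa sb pb sp) (first_swap d21 sa pa sb pb sp).
rewrite (sum_first (H := fun o s => \sum_(o2 <- firsts p2 s0) \sum_(o3 <- firsts p3 s0)
  F (first p0 s) o o2 o3)) //; last first.
  by move=> a b s o sa pa sb pb sp; rewrite (first_swap d10 sa pa sb pb sp).
rewrite (sum_first (H := fun o s => \sum_(o1 <- firsts p1 s0) \sum_(o2 <- firsts p2 s0)
  \sum_(o3 <- firsts p3 s0) F o o1 o2 o3)) //.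
by rewrite big_const_seq count_predT size_permutations // iter_addr_0 mulr_natl.
Qed.
End FirstInOrder.

(** * The potential of a good configuration and its drift *)

Section Potential.
Local Open Scope Z_scope.
Implicit Types f g : Z -> Z -> bool.

Lemma rotz4 z : iter 4 rotz z = z.
Proof. by case: z => a b; rewrite /rotz /= !fl1K. Qed.

Lemma rots_map k s : rot_seq k s = map (iter k rotz) s.
Proof.
elim: k => [|k IH]; first by rewrite map_id.
by rewrite /rot_seq iterS -/(rot_seq k s) IH -map_comp.
Qed.

Lemma rots4 k s : rot_seq (k + 4)%N s = rot_seq k s.
Proof.
rewrite !rots_map; apply: eq_map => z; rewrite iterD; congr iter.
exact: rotz4.
Qed.

Lemma effk4 f d h s k : dims f d h -> first_effect d h s (k + 4)%N = first_effect d h s k.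
Proof.
move=> D; rewrite /first_effect -addSn; have [-> _] := dims4 k D; have [-> ->] := dims4 k.+1 D.
by rewrite rots4.
Qed.

Definition at_tip (h : nat -> Z) k : pred (Z * Z) := fun z => (iter k.+1 rotz z).2 =? h k.+1 + 1.
Definition effect_at (d : nat -> Z) k (z : Z * Z) := tip_effect (d k) (d k.+1) (iter k.+1 rotz z).

Lemma effk_first d h s k : first_effect d h s k = omap (effect_at d k) (first (at_tip h k) s).
Proof.
rewrite /first_effect rots_map /first_in_row filter_map /first /at_tip.
by case: [seq x <- s | _].
Qed.

Lemma good_firsts f d h s k : good f d h -> enum_weak f s ->
  exists2 o, o \in tip_options (slack d h k) &
  perm_eq [seq omap (effect_at d k) e | e <- firsts (at_tip h k) s] (choices o).
Proof.
move=> gd es; have [G [uG mG oG]] := good_tips k gd; exists [seq tip_effect (d k) (d k.+1) z | z <- G] => //.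
have [ur wr] := enum_rotn k.+1 es.
have pG : perm_eq [seq iter k.+1 rotz z | z <- s & at_tip h k z] G.
  rewrite -(filter_map (iter k.+1 rotz) (fun z => z.2 =? h k.+1 + 1)) -rots_map.
  by apply: uniq_perm; rewrite ?filter_uniq // => z; rewrite mem_filter wr mG andbC.
have E : perm_eq [seq effect_at d k z | z <- s & at_tip h k z] [seq tip_effect (d k) (d k.+1) z | z <- G].
  by rewrite -(perm_map_eq _ _ _) || (have := perm_map (tip_effect (d k) (d k.+1)) pG; rewrite -map_comp).
rewrite /firsts; case Es: [seq z <- s | at_tip h k z] E => [|z t] E.
  by move: (perm_size E) => /=; case: G {uG mG oG pG E} => //.
have : size [seq tip_effect (d k) (d k.+1) z | z <- G] != 0%N by rewrite -(perm_size E).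
rewrite /choices; case EG: [seq tip_effect (d k) (d k.+1) z | z <- G] => [|v vs] // _.
rewrite -EG; apply: perm_trans (perm_map Some E).
by rewrite -!map_comp; exact: perm_refl.
Qed.

Lemma perm_enum f s0 s : enum_weak f s0 -> s \in permutations s0 -> enum_weak f s.
Proof.
move=> [u0 w0]; rewrite mem_permutations => p; split; first by rewrite (perm_uniq p).
by move=> z; rewrite (perm_mem p).
Qed.

Lemma effk_mem f d h s0 s k : good f d h -> enum_weak f s0 -> s \in permutations s0 ->
  first_effect d h s k \in [seq omap (effect_at d k) e | e <- firsts (at_tip h k) s0].
Proof.
move=> gd es sp; rewrite effk_first; apply/mapP; exists (first (at_tip h k) s) => //.
move: sp; rewrite mem_permutations => /(perm_filter (at_tip h k)) p.
rewrite /first /firsts; case E: [seq z <- s | at_tip h k z] p => [|z t] p.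
  by move: (perm_size p) => /= /esym/size0nil ->; rewrite mem_head.
have : z \in [seq z <- s0 | at_tip h k z] by rewrite -(perm_mem p) mem_head.
case: [seq z <- s0 | at_tip h k z] => [//|u v zu] /=.
by rewrite -[Some u :: _]/(map Some (u :: v)); apply: map_f.
Qed.

Lemma Uv_step f s d h d' h' : inv f -> enum_weak f s -> dims f d h -> dims (run f s) d' h' ->
  let e := first_effect d h s in let a k := side_gain (e k) (e k.+1) in
  [/\ slack d' h' 0 = slack d h 0 + a 3%N + a 0%N - 2 * Z.b2z (e 0%N),
      slack d' h' 1 = slack d h 1 + a 0%N + a 1%N - 2 * Z.b2z (e 1%N),
      slack d' h' 2 = slack d h 2 + a 1%N + a 2%N - 2 * Z.b2z (e 2%N) &
      slack d' h' 3 = slack d h 3 + a 2%N + a 3%N - 2 * Z.b2z (e 3%N)] /\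
  d' 0%N + d' 1%N + d' 2%N + d' 3%N = d 0%N + d 1%N + d 2%N + d 3%N + (a 0%N + a 1%N + a 2%N + a 3%N).
Proof.
move=> If es D D' e a; have S := dims_step If es D D'.
have := S 0%N; have := S 1%N; have := S 2%N; have := S 3%N.
rewrite -/(first_effect d h s) -/e -/(a 0%N) -/(a 1%N) -/(a 2%N) -/(a 3%N).
have [e4 _] := dims4 0 D; have [e4' _] := dims4 0 D'; rewrite !add0n in e4 e4'.
rewrite /slack => -[d4 h4] [d3 h3] [d2 h2] [d1 h1].
rewrite -[d' 0%N]e4' -[d 0%N]e4.
have A k : Z.b2z (pushes_right (first_effect d h s k) || pushes_left (first_effect d h s k.+1)) = a k by [].
rewrite !A in d1 d2 d3 d4; rewrite -/e in h1 h2 h3 h4.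
by split; [split|]; zar.
Qed.

Lemma sumU_step f s0 s d h d' h' : good f d h -> enum_weak f s0 -> s \in permutations s0 ->
  dims (run f s) d' h' -> slack_ok (total_slack d' h') /\ total_slack d' h' <= total_slack d h.
Proof.
move=> gd es0 sp D'; have es := perm_enum es0 sp; have [If D S] := gd.
have [[u0 u1 u2 u3] _] := Uv_step If es D D'.
have := drift_checkP (@Uv_ge0 f d h 0 D) (@Uv_ge0 f d h 1 D) (@Uv_ge0 f d h 2 D) (@Uv_ge0 f d h 3 D) (sokP gd).
have [v0 m0 p0] := good_firsts 0 gd es0; have [v1 m1 p1] := good_firsts 1 gd es0.
have [v2 m2 p2] := good_firsts 2 gd es0; have [v3 m3 p3] := good_firsts 3 gd es0.
move=> /allP/(_ _ m0)/allP/(_ _ m1)/allP/(_ _ m2)/allP/(_ _ m3)/andP[_].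
have c k o (p : perm_eq [seq omap (effect_at d k) e | e <- firsts (at_tip h k) s0] (choices o)) :
    first_effect d h s k \in choices o by rewrite -(perm_mem p); apply: effk_mem gd es0 sp.
move=> /allP/(_ _ (c _ _ p0))/allP/(_ _ (c _ _ p1))/allP/(_ _ (c _ _ p2))/allP/(_ _ (c _ _ p3)).
have e40 : first_effect d h s 4 = first_effect d h s 0 := effk4 s 0 D.
rewrite /slack_step_ok => /andP[s1 /Z.leb_le s2].
have eS : total_slack d' h' = slack d h 0 + slack d h 1 + slack d h 2 + slack d h 3 +
   2 * (side_gain (first_effect d h s 0) (first_effect d h s 1) +
        side_gain (first_effect d h s 1) (first_effect d h s 2) +
        side_gain (first_effect d h s 2) (first_effect d h s 3) +
        side_gain (first_effect d h s 3) (first_effect d h s 0)) -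
   2 * (Z.b2z (first_effect d h s 0) + Z.b2z (first_effect d h s 1) +
        Z.b2z (first_effect d h s 2) + Z.b2z (first_effect d h s 3)).
  rewrite /total_slack u0 u1 u2 u3 e40; clear.
  repeat match goal with
  | |- context [side_gain ?a ?b] => generalize (side_gain a b)
  | |- context [slack ?a ?b ?c] => generalize (slack a b c)
  | |- context [Z.b2z ?a] => generalize (Z.b2z a) end.
  by intros; lia.
by rewrite -eS in s1 s2; split.
Qed.

Lemma good_step f s0 s d h d' h' : good f d h -> enum_weak f s0 -> s \in permutations s0 ->
  dims (run f s) d' h' -> good (run f s) d' h'.
Proof.
move=> gd es0 sp D'; have es := perm_enum es0 sp.
have [s1 s2] := sumU_step gd es0 sp D'; have [If D S] := gd.
have rd := round_of If es; have sg := shape_round If rd.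
have e3 : total_slack d' h' = 0 \/ total_slack d' h' = 2 \/ total_slack d' h' = 4.
  by move: s1; rewrite /slack_ok => /orP[/orP[]|] /Z.eqb_eq; auto.
have L : total_slack d' h' <= 2 -> inv (run f s).
  by move=> l; apply: (inv_round If rd); apply: (tip_ok_sumU sg D' l) => k; apply: Uv_ge0 D'.
case: e3 => [e|[e|e]].
- by split => //; [apply: L; rewrite e|left].
- by split => //; [apply: L; rewrite e|right; left].
have R : regime f by case: S => [S|[S|[_ //]]]; rewrite S e in s2.
have [l|R'] := regime_step If es R D'; first by rewrite e in l.
by split => //; [apply: (inv_round If rd); apply: regime_tips|right; right].
Qed.

Lemma top_weak q h1 h2 h3 x : top_row q h1 -> top_row (rot q) h2 -> top_row (rot (rot q)) h3 ->
  weakb q x (h1 + 1) -> x <= h2 /\ - h1 + 1 <= h3.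
Proof.
move=> t1 [_ H2] [_ H3] w; have [_ H1] := t1.
have fu : ~~ q x (h1 + 1) by apply: topv_empty t1 _; zar.
have [a [b [nr fab]]] := wk_nbr fu w.
have fb : q x h1.
  by case: nr fab => fab; have := H1 _ _ fab; try zar; rewrite zPN in fab.
split; first by apply: (H2 (- h1 + 1)); rewrite /rot /fl /tr fl1K.
by apply: (H3 (- x + 1)); rewrite /rot /fl /tr !fl1K.
Qed.

(** A weak cell beyond one tip stays within the axis extents of the next two directions. Applied
    cyclically, this gives the disjointness required by [sum_first4]. *)
Lemma tip_sep f s d h k z : inv f -> dims f d h -> enum_weak f s -> z \in s -> at_tip h k z ->
  ~~ at_tip h k.+1 z /\ ~~ at_tip h k.+2 z.
Proof.
move=> If D es zs; rewrite /at_tip; move=> /Z.eqb_eq eu.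
have [_ wr] := enum_rotn k.+1 es.
have [_ t1] := D k.+1; have [_ t2] := D k.+2; have [_ t3] := D k.+3.
have : iter k.+1 rotz z \in rot_seq k.+1 s by rewrite rots_map; apply: map_f.
rewrite wr eu => w; have [l2 l3] := top_weak t1 t2 t3 w.
rewrite [iter k.+2 _ _]iterS [iter k.+3 _ _]iterS [iter k.+2 _ _]iterS.
move: (iter k.+1 rotz z) eu l2 => u eu l2.
by split; apply/negP => /Z.eqb_eq; rewrite /rotz /= ?eu; clear -l2 l3; zar.
Qed.

Section Real.
Local Open Scope ring_scope.
Variable R : realFieldType.

Definition ratZ (z : Z) : R := (int_of_Z z)%:~R.

Lemma zrD (x y : Z) : ratZ (x + y)%BZ = ratZ x + ratZ y.
Proof. by rewrite /ratZ -[(x + y)%BZ]/(x + y) rmorphD /= rmorphD. Qed.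
Lemma zrM (x y : Z) : ratZ (x * y)%BZ = ratZ x * ratZ y.
Proof. by rewrite /ratZ -[(x * y)%BZ]/(x * y) rmorphM /= rmorphM. Qed.
Lemma zr_ge0 (x : Z) : (0 <= x)%BZ -> 0 <= ratZ x.
Proof. by case: x => // p _; rewrite /ratZ /= ler0z. Qed.
Lemma ler_zr (x y : Z) : (x <= y)%BZ -> ratZ x <= ratZ y.
Proof.
move=> l; have -> : y = (x + (y - x))%BZ by zar.
by rewrite zrD lerDl; apply: zr_ge0; zar.
Qed.
Lemma zr_nat n : ratZ (Z.of_nat n) = n%:R.
Proof. by elim: n => // n IH; rewrite Nat2Z.inj_succ -Z.add_1_r zrD IH -natr1. Qed.
Lemma zr_exp (x : Z) (n : nat) : ratZ (x ^ Z.of_nat n)%BZ = ratZ x ^+ n.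
Proof.
elim: n => // n IH.
by rewrite Nat2Z.inj_succ Z.pow_succ_r ?zrM ?IH ?exprS //; zar.
Qed.
Lemma zr_sumz (A : Type) (F : A -> Z) s : ratZ (sumZ F s) = \sum_(x <- s) ratZ (F x).
Proof. by elim: s => [|x s IH]; rewrite ?big_nil // big_cons /= zrD IH. Qed.
Lemma zr_zsize (A : Type) (s : seq A) : ratZ (sizeZ s) = (size s)%:R.
Proof. by rewrite /sizeZ zr_sumz big_const_seq count_predT iter_addr_0. Qed.

(** Half a weight is at least 500 and the power at least [n^2 / 1000], so the value is at least
    [n^2 / 2], twice the bound [n^2 / 4] on the number of cells; one of these halves is given up in
    [Phi]. *)
Definition potential (d h : nat -> Z) : R :=
  ratZ (weight (slack d h 0) (slack d h 1) (slack d h 2) (slack d h 3)) / 2%:R *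
  (21%:R / 20%:R) ^+ Z.to_nat (d 0%N + d 1%N + d 2%N + d 3%N)%BZ.

(** A single cell measured in two opposite directions already gives 2. Hence the exponent in
    [potential] is nonnegative and [Z.to_nat] loses nothing. *)
Lemma dims_ge2 f d h k : inv f -> dims f d h -> (2 <= d k + d k.+2)%BZ.
Proof.
move=> If D; have [_ _ _ _ [x [y fxy]]] := inv_rotn k If.
have [[_ H] _] := D k; have [[_ H'] _] := D k.+2.
have e : rotn k.+2 f (- x + 1) (- y + 1) by rewrite !rotnS /rot /fl /tr !fl1K.
by have := H _ _ fxy; have := H' _ _ e; zar.
Qed.

Lemma potential_step_one f s0 s d h d' h' : good f d h -> enum_weak f s0 -> s \in permutations s0 ->
  dims (run f s) d' h' ->
  potential d' h' = (21%:R / 20%:R) ^+ Z.to_nat (d 0%N + d 1%N + d 2%N + d 3%N)%BZ / (2%:R * 20%:R ^+ 4) *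
    ratZ (outcome_weight (slack d h 0) (slack d h 1) (slack d h 2) (slack d h 3)
       (first_effect d h s 0) (first_effect d h s 1) (first_effect d h s 2) (first_effect d h s 3)).
Proof.
move=> gd es0 sp D'; have es := perm_enum es0 sp; have [If D S] := gd.
have [[u0 u1 u2 u3] ed] := Uv_step If es D D'.
have e40 : first_effect d h s 4 = first_effect d h s 0 := effk4 s 0 D.
rewrite /potential ed u0 u1 u2 u3 /= e40 /outcome_weight; clear ed u0 u1 u2 u3 e40 S.
set a := (side_gain _ _ + _ + _ + _)%BZ; set n := (d 0%N + _ + _ + _)%BZ.
have n0 : (0 <= n)%BZ by have := @dims_ge2 f d h 0 If D; have := @dims_ge2 f d h 1 If D; rewrite /n; clear; zar.
have a0 : (0 <= a <= 4)%BZ.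
  have B e e' : (0 <= side_gain e e' <= 1)%BZ by rewrite /side_gain; case: (_ || _).
  have := (B (first_effect d h s 0) (first_effect d h s 1), B (first_effect d h s 1) (first_effect d h s 2),
    B (first_effect d h s 2) (first_effect d h s 3), B (first_effect d h s 3) (first_effect d h s 0)).
  by move=> [[[]]]; rewrite /a; clear; do 4!move: (side_gain _ _) => ?; lia.
rewrite Z2Nat.inj_add //; last zar.
have [k ek lk] : exists2 k, a = Z.of_nat k & (k <= 4)%N by exists (Z.to_nat a); zar.
rewrite ek Nat2Z.id exprD; have -> : (4 - Z.of_nat k)%BZ = Z.of_nat (4 - k) by zar.
rewrite !zrM !zr_exp -[21%BZ]/(Z.of_nat 21) -[20%BZ]/(Z.of_nat 20) !zr_nat.
set v := ratZ _; set q := _ ^+ Z.to_nat n; rewrite expr_div_n.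
have -> : 20%:R ^+ 4 = 20%:R ^+ (4 - k) * 20%:R ^+ k :> R by rewrite -exprD subnK.
have h1 : 20%:R ^+ k != 0 :> R by rewrite expf_neq0 // pnatr_eq0.
have h2 : 20%:R ^+ (4 - k) != 0 :> R by rewrite expf_neq0 // pnatr_eq0.
have h3 : 2%:R != 0 :> R by rewrite pnatr_eq0.
move: (20%:R ^+ k) (20%:R ^+ (4 - k)) (2%:R) h1 h2 h3 => x y t h1 h2 h3.
by field; rewrite ?h1 ?h2 ?h3.
Qed.

Lemma potential_step f s0 d h (dd hh : seq (Z * Z) -> nat -> Z) : good f d h -> enum_weak f s0 ->
  (forall s, s \in permutations s0 -> dims (run f s) (dd s) (hh s)) ->
  \sum_(s <- permutations s0) potential (dd s) (hh s) <= (size s0)`!%:R * potential d h.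
Proof.
move=> gd es0 DD; have [If D S] := gd; have [us ws] := es0.
set W := fun e0 e1 e2 e3 : option (bool * bool) =>
  ratZ (outcome_weight (slack d h 0) (slack d h 1) (slack d h 2) (slack d h 3) e0 e1 e2 e3).
set Q : R := (21%:R / 20%:R) ^+ Z.to_nat (d 0%N + d 1%N + d 2%N + d 3%N)%BZ.
have -> : \sum_(s <- permutations s0) potential (dd s) (hh s) = Q / (2%:R * 20%:R ^+ 4) *
    \sum_(s <- permutations s0) W (first_effect d h s 0) (first_effect d h s 1)
      (first_effect d h s 2) (first_effect d h s 3).
  rewrite mulr_sumr big_seq [RHS]big_seq; apply: eq_bigr => s sp.
  exact: (potential_step_one gd es0 sp (DD s sp)).
have Q0 : 0 < Q by rewrite exprn_gt0 // divr_gt0 ?ltr0n.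
suff H : \sum_(s <- permutations s0) W (first_effect d h s 0) (first_effect d h s 1)
      (first_effect d h s 2) (first_effect d h s 3) <=
    (size s0)`!%:R * (20%:R ^+ 4 * ratZ (weight (slack d h 0) (slack d h 1) (slack d h 2) (slack d h 3))).
  rewrite /potential -/Q; set v := ratZ _ in H *; set n := _%:R in H *.
  have -> : n * (v / 2%:R * Q) = Q / (2%:R * 20%:R ^+ 4) * (n * (20%:R ^+ 4 * v)).
    have h3 : 2%:R != 0 :> R by rewrite pnatr_eq0.
    have h4 : 20%:R ^+ 4 != 0 :> R by rewrite expf_neq0 // pnatr_eq0.
    move: (20%:R ^+ 4) (2%:R) h3 h4 => x t h3 h4.
    by field; rewrite ?h3 ?h4.
  by rewrite ler_pM2l // divr_gt0 // mulr_gt0 ?exprn_gt0 ?ltr0n.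
have [v0 m0 p0] := good_firsts 0 gd es0; have [v1 m1 p1] := good_firsts 1 gd es0.
have [v2 m2 p2] := good_firsts 2 gd es0; have [v3 m3 p3] := good_firsts 3 gd es0.
have := drift_checkP (@Uv_ge0 f d h 0 D) (@Uv_ge0 f d h 1 D) (@Uv_ge0 f d h 2 D) (@Uv_ge0 f d h 3 D) (sokP gd).
move=> /allP/(_ _ m0)/allP/(_ _ m1)/allP/(_ _ m2)/allP/(_ _ m3)/andP[/Z.leb_le C _].
move/ler_zr: C; rewrite !zrM !zr_zsize zr_sumz.
have -> : ratZ 160000 = 20%:R ^+ 4 by rewrite -[160000%BZ]/(20 ^ Z.of_nat 4)%BZ zr_exp -[20%BZ]/(Z.of_nat 20) zr_nat.
set c0 := choices v0 in p0 *; set c1 := choices v1 in p1 *.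
set c2 := choices v2 in p2 *; set c3 := choices v3 in p3 *.
have -> : \sum_(e0 <- c0) ratZ (sumZ (fun e1 => sumZ (fun e2 => sumZ
    (outcome_weight (slack d h 0) (slack d h 1) (slack d h 2) (slack d h 3) e0 e1 e2) c3) c2) c1) =
   \sum_(e0 <- c0) \sum_(e1 <- c1) \sum_(e2 <- c2) \sum_(e3 <- c3) W e0 e1 e2 e3.
  apply: eq_bigr => e0 _; rewrite zr_sumz; apply: eq_bigr => e1 _; rewrite zr_sumz.
  by apply: eq_bigr => e2 _; rewrite zr_sumz.
(* The check runs over the tabulated effects; [E] and [Sz] carry it over to the actual weak cells
   beyond each tip. *)
have E (k : nat) c (F : option (bool * bool) -> R) :
   perm_eq [seq omap (effect_at d k) e | e <- firsts (at_tip h k) s0] c ->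
   \sum_(e <- c) F e = \sum_(o <- firsts (at_tip h k) s0) F (omap (effect_at d k) o).
  by move=> p; rewrite -(perm_big _ p) big_map.
have Sz (k : nat) c : perm_eq [seq omap (effect_at d k) e | e <- firsts (at_tip h k) s0] c ->
   size c = size (firsts (at_tip h k) s0) by move/perm_size; rewrite size_map.
rewrite (E _ _ _ p0) (Sz _ _ p0) (Sz _ _ p1) (Sz _ _ p2) (Sz _ _ p3).
under eq_bigr => e0 _.
  rewrite (E _ _ _ p1); under eq_bigr => e1 _.
    rewrite (E _ _ _ p2); under eq_bigr => e2 _ do rewrite (E _ _ _ p3).
    over.
  over.
move=> C; have sz k : (0 < size (firsts (at_tip h k) s0))%N.
  by rewrite /firsts; case: [seq z <- s0 | at_tip h k z].
have N0 : 0 < (size (firsts (at_tip h 0) s0) * size (firsts (at_tip h 1) s0) *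
    size (firsts (at_tip h 2) s0) * size (firsts (at_tip h 3) s0))%:R :> R.
  by rewrite ltr0n !muln_gt0 !sz.
rewrite -(ler_pM2l N0).
under eq_bigr => s _ do rewrite !effk_first.
rewrite (@sum_first4 _ _ s0 (at_tip h 0) (at_tip h 1) (at_tip h 2) (at_tip h 3)
  (fun a b c e => W (omap (effect_at d 0) a) (omap (effect_at d 1) b)
    (omap (effect_at d 2) c) (omap (effect_at d 3) e))) //.
  rewrite mulrCA; apply: ler_wpM2l; first exact: ler0n.
  by apply: le_trans C _; rewrite !natrM -!mulrA.
move=> z zs; have T k := tip_sep (k := k) If D es0 zs.
have e40 : at_tip h 4 z = at_tip h 0 z.
  have e5 : iter 5 rotz z = iter 1 rotz z by rewrite iterS rotz4.
  by rewrite /at_tip e5; have [_ ->] := dims4 1 D.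
split => h0; first (apply/and3P; split); last by have [] := T _ h0.
- by have [] := T _ h0.
- by have [] := T _ h0.
- by apply: contraTN h0 => /T[]; rewrite e40.
- by apply/andP; have [] := T _ h0.
Qed.
End Real.
End Potential.

Local Open Scope classical_set_scope.
Local Open Scope ring_scope.

(** * Almost sure stopping and a mean bound from a drift condition *)

Section Process.
Variables (V : choiceType) (adj : rel V) (R : realType) (T : R).
Variables (d : measure_display) (Omega : measurableType d) (P : probability Omega R).
Variables (c0 : config V) (sigma : nat -> Omega -> seq V).
Hypothesis PD : PD_process adj T P c0 sigma.

Notation worder := (weak_ordering adj T).
Notation upd := (update adj T).
Notation rnd := (fun c s => foldl upd c s).

Variables (Good : config V -> Prop) (Phi : config V -> R) (N : config V -> nat).
Hypotheses (Good0 : Good c0)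
  (GoodS : forall c s, Good c -> worder c s -> Good (rnd c s))
  (PhiS : forall c s0, Good c -> worder c s0 ->
     \sum_(s <- permutations s0) Phi (rnd c s) <=
       (size s0)`!%:R * (Phi c - (s0 != [::])%:R))
  (PhiN : forall c, Good c -> (N c)%:R <= Phi c).

(** A reference ordering, from which the others are obtained as permutations. The default [[::]]
    never intervenes on histories in [hist], by [hist_spec]. *)
Definition enumw (c : config V) : seq V := xget [::] [set s | worder c s].
Definition cfg (l : seq (seq V)) : config V := foldl (fun c s => rnd c s) c0 l.

Fixpoint hist t : seq (seq (seq V)) :=
  if t is t'.+1 then [seq rcons l s | l <- hist t', s <- permutations (enumw (cfg l))]
  else [:: [::]].

Definition pr (l : seq (seq V)) : R := \prod_(s <- l) ((size s)`!%:R)^-1.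
Definition cyl (l : seq (seq V)) : set Omega :=
  [set w | forall i, (i < size l)%N -> sigma i w = nth [::] l i].

Lemma cfg_rcons l s : cfg (rcons l s) = rnd (cfg l) s.
Proof. by rewrite /cfg foldl_rcons. Qed.

Lemma evolve_cfg h t : evolve adj T c0 h t = cfg [seq h i | i <- iota 0 t].
Proof.
by elim: t => // t IH; rewrite [LHS]/= IH -[in RHS]addn1 iotaD map_cat cats1 cfg_rcons.
Qed.

Lemma size_hist t l : l \in hist t -> size l = t.
Proof.
elim: t l => [|t IH] l; first by rewrite inE => /eqP ->.
by move=> /allpairsPdep [l' [s [/IH <- _ ->]]]; rewrite size_rcons.
Qed.

Lemma cyl_evolve l w : cyl l w -> evolve adj T c0 (sigma ^~ w) (size l) = cfg l.
Proof.
move=> h; rewrite evolve_cfg; congr cfg; apply: (@eq_from_nth _ [::]).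
  by rewrite size_map size_iota.
move=> i; rewrite size_map size_iota => li.
by rewrite (nth_map 0%N) ?size_iota // nth_iota // add0n h.
Qed.

Lemma pr_gt0 l : 0 < pr l.
Proof. by apply: prodr_gt0 => s _; rewrite invr_gt0 ltr0n fact_gt0. Qed.

Lemma cyl_rcons l s : cyl (rcons l s) =
  [set w | forall i, (i <= size l)%N -> sigma i w = nth [::] (rcons l s) i].
Proof. by apply/seteqP; split => w h i; rewrite ?size_rcons => li; apply: h; rewrite ?size_rcons. Qed.

(** That the weak vertices after [l] can be listed follows from probability: the cylinder of [l] has
    positive measure, hence a point, and [PD_ordering] at that point supplies an ordering. *)
Lemma hist_spec t l : l \in hist t -> [/\ P (cyl l) = (pr l)%:E, worder (cfg l) (enumw (cfg l)) &
  Good (cfg l)].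
Proof.
suff H l' : P (cyl l') = (pr l')%:E -> worder (cfg l') (enumw (cfg l')).
  elim: t l => [|t IH] l.
    rewrite inE => /eqP ->; have e : P (cyl [::]) = (pr [::])%:E.
      have -> : cyl [::] = setT by apply/seteqP; split.
      by rewrite probability_setT /pr big_nil.
    by split => //; exact: H.
  move=> /allpairsPdep [l' [s [l't sp ->]]]; have [Pl wl Gl] := IH _ l't.
  have ws : worder (cfg l') s.
    move: wl => [ul wl]; split.
      by rewrite (perm_uniq (_ : perm_eq s (enumw (cfg l')))) // -mem_permutations.
    move=> v; rewrite (perm_mem (_ : perm_eq s (enumw (cfg l')))) //.
    by rewrite -mem_permutations.
  have e : P (cyl (rcons l' s)) = (pr (rcons l' s))%:E.
    rewrite cyl_rcons; have -> := PD_uniform PD (h := nth [::] (rcons l' s)) (t := size l').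
      rewrite nth_rcons ltnn eqxx /pr -cats1 big_cat big_seq1 /= EFinM -/(pr l') -Pl.
      congr (P _ * _)%E; apply/seteqP; split => w h i li.
        by rewrite h // nth_cat li.
      by have := h i li; rewrite nth_cat li.
    rewrite nth_rcons ltnn eqxx; move: ws.
    congr weak_ordering; rewrite evolve_cfg; congr cfg.
    apply: (@eq_from_nth _ [::]); first by rewrite size_map size_iota.
    move=> i li; rewrite (nth_map 0%N) ?size_iota // nth_iota // add0n nth_rcons li //.
  split => //; first exact: H.
  by rewrite cfg_rcons; apply: GoodS.
move=> e; have : cyl l' !=set0.
  apply/set0P/eqP => K; move: e; rewrite K measure0 => -[] k.
  by have := pr_gt0 l'; rewrite -k ltxx.
move=> [w hw]; have := PD_ordering PD (size l') w.
rewrite (cyl_evolve hw) => wo.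
by rewrite /enumw; case: xgetP => [s -> //|/(_ (sigma (size l') w))].
Qed.

Definition hw t w := [seq sigma i w | i <- iota 0 t].

Lemma hwS t w : hw t.+1 w = rcons (hw t w) (sigma t w).
Proof. by rewrite /hw -addn1 iotaD map_cat cats1. Qed.

Lemma cyl_hw t w l : size l = t -> cyl l w <-> l = hw t w.
Proof.
move=> sl; split => [h|->].
  apply: (@eq_from_nth _ [::]); first by rewrite size_map size_iota.
  move=> i li; rewrite (nth_map 0%N) ?size_iota -?sl // nth_iota // add0n h //.
move=> i; rewrite size_map size_iota => li.
by rewrite (nth_map 0%N) ?size_iota // nth_iota // add0n.
Qed.

Lemma hw_hist t w : hw t w \in hist t.
Proof.
elim: t => // t IH; rewrite hwS; apply/allpairsPdep; exists (hw t w), (sigma t w).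
split => //; rewrite mem_permutations; have [_ [ue we] _] := hist_spec IH.
have := PD_ordering PD t w; rewrite evolve_cfg -/(hw t w) => -[us ws].
by apply: uniq_perm => // v; apply/idP/idP => [/ws/we|/we/ws].
Qed.

Lemma uniq_hist t : uniq (hist t).
Proof.
elim: t => // t IH; apply: allpairs_uniq_dep => //.
  by move=> l _; exact: permutations_uniq.
move=> [l s] [l' s'] _ _ /= e; have := congr1 (fun x => (belast [::] x, last [::] x)) e.
by have /rcons_inj[-> ->] := e.
Qed.

Lemma mcyl l : measurable (cyl l).
Proof.
have -> : cyl l = \bigcap_(i in `I_(size l)) [set w | sigma i w = nth [::] l i].
  by apply/seteqP; split => w h i /= li; apply: h.
by apply: bigcap_measurableType => i _; apply: (PD_measurable PD).
Qed.

(** The cylinders of length [t] form a finite partition, so every function of the history is simple;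
    this settles measurability and turns integrals into finite sums. *)
Lemma sum_hist (K : seq (seq V) -> R) t w :
  K (hw t w) = \sum_(l <- hist t) K l * \1_(cyl l) w.
Proof.
rewrite (bigD1_seq (hw t w)) ?uniq_hist ?hw_hist //= big1_seq ?addr0.
  by rewrite indicE mem_set ?mulr1 //; apply/(cyl_hw w (size_hist (hw_hist t w))).
move=> l /andP[ne lt]; rewrite indicE memNset ?mulr0 //.
by move/(cyl_hw w (size_hist lt)) => e; rewrite e eqxx in ne.
Qed.

Lemma integral_hist (K : seq (seq V) -> R) t : (forall l, 0 <= K l) ->
  (\int[P]_w (K (hw t w))%:E = (\sum_(l <- hist t) pr l * K l)%:E)%E.
Proof.
move=> K0; under eq_integral do rewrite sum_hist -sumEFin.
rewrite ge0_integral_sum //.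
- rewrite -sumEFin big_seq [RHS]big_seq; apply: eq_bigr => l lt.
  under eq_integral do rewrite EFinM.
  transitivity ((K l)%:E * \int[P]_w (\1_(cyl l) w)%:E)%E.
    apply: ge0_integralZl => //.
    - by apply/measurable_EFinP; apply: measurable_indic; apply: mcyl.
    - by rewrite lee_fin.
  have -> : (\int[P]_w (\1_(cyl l) w)%:E = (pr l)%:E)%E.
    have [<- _ _] := hist_spec lt.
    by rewrite integral_indic //; [rewrite setIT|exact: mcyl].
  by rewrite -EFinM mulrC.
- move=> l; apply/measurable_EFinP; apply: measurable_funM => //.
  by apply: measurable_indic; apply: mcyl.
- by move=> l w _; rewrite lee_fin mulr_ge0.
Qed.

Definition EPhi t := \sum_(l <- hist t) pr l * Phi (cfg l).
(** The probability that the process is still unstable at time [t], as a finite sum. *)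
Definition ust t := \sum_(l <- hist t) pr l * (enumw (cfg l) != [::])%:R.

Lemma EPhiS t : EPhi t.+1 <= EPhi t - ust t.
Proof.
rewrite /EPhi /= big_allpairs_dep /= -sumrB big_seq [X in _ <= X]big_seq.
apply: ler_sum => l lt; have [_ wl Gl] := hist_spec lt.
rewrite -mulrBr; under eq_big_seq => s sp.
  rewrite cfg_rcons /pr -cats1 big_cat big_seq1 /= -/(pr l).
  rewrite (perm_size (_ : perm_eq s (enumw (cfg l)))) -?mem_permutations // -mulrA.
  over.
rewrite -mulr_sumr ler_pM2l ?pr_gt0 // -mulr_sumr ler_pdivrMl ?ltr0n ?fact_gt0 //.
exact: PhiS.
Qed.

Lemma EPhi_ge0 t : 0 <= EPhi t.
Proof.
rewrite /EPhi big_seq; apply: sumr_ge0 => l lt; have [_ _ Gl] := hist_spec lt.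
by rewrite mulr_ge0 ?(ltW (pr_gt0 _)) // (le_trans _ (PhiN Gl)).
Qed.

Lemma EPhi_ust t : EPhi t + \sum_(i < t) ust i <= Phi c0.
Proof.
elim: t => [|t IH]; first by rewrite big_ord0 addr0 /EPhi big_seq1 /pr big_nil mul1r.
rewrite big_ord_recr /=; apply: le_trans IH.
by rewrite addrA addrAC lerD2r -lerBrDr; apply: EPhiS.
Qed.

Lemma ust_ge0 t : 0 <= ust t.
Proof. by apply: sumr_ge0 => l _; rewrite mulr_ge0 ?(ltW (pr_gt0 _)). Qed.

Definition stab t w := stable adj T (evolve adj T c0 (sigma ^~ w) t).

Lemma stab_enum t w : stab t w <-> enumw (cfg (hw t w)) = [::].
Proof.
have [_ [_ we] _] := hist_spec (hw_hist t w); rewrite /stab evolve_cfg -/(hw t w); split=> h.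
  by case: (enumw _) we => // v s /(_ v)[/(_ (mem_head _ _))/h].
by move=> v; rewrite -we h in_nil.
Qed.

Lemma stabS t w : stab t w ->
  evolve adj T c0 (sigma ^~ w) t.+1 = evolve adj T c0 (sigma ^~ w) t.
Proof.
move=> h /=; have [_ ws] := PD_ordering PD t w.
by case: (sigma t w) ws => // v s /(_ v)[/(_ (mem_head _ _))/h].
Qed.

Lemma stab_const t k w : stab t w ->
  evolve adj T c0 (sigma ^~ w) (t + k) = evolve adj T c0 (sigma ^~ w) t.
Proof.
move=> h; elim: k => [|k IH]; first by rewrite addn0.
by rewrite addnS stabS // /stab IH.
Qed.

Lemma final_stab t w : stab t w ->
  final_config adj T c0 (sigma ^~ w) = evolve adj T c0 (sigma ^~ w) t.
Proof.
move=> h; have ex : exists t, `[< stab t w >] by exists t; apply/asboolP.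
have [m /asboolP sm mm] := ex_minnP ex.
rewrite /final_config (_ : stop_time _ _ _ _ = m).
  have lm : (m <= t)%N by apply: mm; apply/asboolP.
  by rewrite -[in RHS](subnKC lm) stab_const.
rewrite /stop_time; case: xgetP => [n -> [sn Hn]|/(_ m)[]]; last first.
  by split => // i im si; have := mm i; rewrite leqNgt im; move=> H; have := H (introT (asboolP _) si).
apply/eqP; rewrite eqn_leq mm ?andbT; last exact/asboolP.
by rewrite leqNgt; apply/negP => /Hn; apply.
Qed.

(** The probabilities of being unstable have partial sums at most [Phi c0], so they take arbitrarily
    small values; each of them bounds the probability of never stopping. *)
Lemma process_stops : {ae P, forall w, stops adj T c0 (sigma ^~ w)}.
Proof.
pose B t := [set w | enumw (cfg (hw t w)) != [::]].
have BE t : B t = \bigcup_(l in [set` [seq l <- hist t | enumw (cfg l) != [::]]]) cyl l.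
  apply/seteqP; split => w /=.
    move=> h; exists (hw t w); first by rewrite /= mem_filter h hw_hist.
    by apply/(cyl_hw w (size_hist (hw_hist t w))).
  move=> [l /=]; rewrite mem_filter => /andP[h lt] /(cyl_hw w (size_hist lt)) e.
  by rewrite /B /= -e.
have mB t : measurable (B t).
  rewrite BE; apply: fin_bigcup_measurable => [|l _]; last exact: mcyl.
  exact: finite_seq.
have PB t : P (B t) = (ust t)%:E.
  have := @integral_hist (fun l => (enumw (cfg l) != [::])%:R) t (fun=> ler0n _ _).
  rewrite -/(ust t) => <-; rewrite -[B t]setIT -integral_indic //.
  apply: eq_integral => w _; rewrite indicE; congr (_%:R)%:E.
  by case: (boolP (enumw _ != _)) => h; [rewrite mem_set|rewrite memNset //; apply/negP].
exists (\bigcap_t B t); split.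
- exact: bigcap_measurableType.
- apply/eqP; rewrite eq_le measure_ge0 andbT; apply/lee_addgt0Pr => e e0; rewrite add0e.
  pose n := (Num.truncn (Phi c0 / e)).+1.
  have ln : Phi c0 < n%:R * e.
    by rewrite -ltr_pdivrMr //; apply: truncnS_gt.
  have [t lt] : exists t, ust t <= e.
    apply: contrapT => K; have : n%:R * e <= \sum_(i < n) ust i.
      rewrite mulr_natl -[X in _ *+ X](card_ord n) -sumr_const; apply: ler_sum => i _.
      by rewrite leNgt; apply/negP => h; apply: K; exists i; apply: ltW.
    move=> h; have : \sum_(i < n) ust i <= Phi c0.
      by apply: le_trans (EPhi_ust n); rewrite lerDr EPhi_ge0.
    by move=> /(le_trans h); rewrite leNgt ln.
  apply: le_trans (_ : (ust t)%:E <= _)%E; last by rewrite lee_fin.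
  rewrite -PB; apply: le_measure; rewrite ?inE //; first exact: bigcap_measurableType.
  by move=> w; apply.
- move=> w /= ns t _; apply/negP => /eqP h; apply: ns; exists t.
  by have [_] := stab_enum t w; apply.
Qed.

Lemma process_expectation :
  ('E_P[fun w => (N (final_config adj T c0 (sigma ^~ w)))%:R] <= (Phi c0 + (N c0)%:R)%:E)%E.
Proof.
(* A process that never stops gets [stop_time] 0 and final configuration [c0]. With the value [N c0]
   while unstable, [K] converges at every point to the final number; this is the origin of the extra
   term [N c0]. *)
pose K l : R := if enumw (cfg l) == [::] then (N (cfg l))%:R else (N c0)%:R.
have K0 l : 0 <= K l by rewrite /K; case: ifP.
have mK t : measurable_fun setT (fun w => (K (hw t w))%:E).
  apply/measurable_EFinP; under eq_fun do rewrite sum_hist.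
  apply: measurable_sum => l; apply: measurable_funM => //.
  by apply: measurable_indic; apply: mcyl.
have cvK w : (K (hw t w))%:E @[t --> \oo] --> (N (final_config adj T c0 (sigma ^~ w)))%:R%:E.
  have [[t st]|ns] := pselect (stops adj T c0 (sigma ^~ w)).
    apply: cvg_near_cst; exists t => // k /= tk.
    have st' : stab k w by rewrite /stab -(subnKC tk) stab_const.
    rewrite (final_stab st') /K (stab_enum k w).1 // eqxx.
    by rewrite evolve_cfg.
  apply: cvg_near_cst; exists 0%N => // k /= _; rewrite /K.
  case: eqP => [h|_]; first by case: ns; exists k; apply/(stab_enum k w).
  rewrite /final_config /stop_time; case: xgetP => [n _ [sn _]|_]; last by [].
  by case: ns; exists n.
rewrite unlock; under eq_integral => w _ do rewrite -(cvg_limn_einf_sup (cvK w)).1.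
apply: le_trans (fatou _ _ _ _) _ => //.
  by move=> n w _; rewrite lee_fin.
rewrite limn_einf_lim; apply: lime_le; first exact: is_cvg_einfs.
apply: nearW => t; apply: le_trans (_ : \int[P]_w (K (hw t w))%:E <= _)%E.
  by apply: ereal_inf_lbound; exists t => /=.
rewrite integral_hist // lee_fin; apply: le_trans (_ : EPhi t + (N c0)%:R <= _).
  have s1 : \sum_(l <- hist t) pr l = 1.
    have := @integral_hist (fun=> 1) t (fun=> ler01).
    rewrite integral_cst //= probability_setT mule1 => -[->].
    by apply: eq_bigr => l _; rewrite mulr1.
  have e : (N c0)%:R = \sum_(l <- hist t) pr l * (N c0)%:R :> R.
    by rewrite -mulr_suml s1 mul1r.
  rewrite [X in _ <= _ + X]e -big_split /= big_seq [X in _ <= X]big_seq.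
  apply: ler_sum => l lt; have [_ _ Gl] := hist_spec lt.
  rewrite -mulrDr ler_pM2l ?pr_gt0 // /K; have h := PhiN Gl.
  case: ifP => _; first by apply: (le_trans h); rewrite lerDl; exact: ler0n.
  by rewrite lerDr; apply: le_trans h; exact: ler0n.
rewrite lerD2r; apply: le_trans (EPhi_ust t); rewrite lerDl.
by apply: sumr_ge0 => i _; apply: ust_ge0.
Qed.
End Process.

(** * Transfer between the grid and integer coordinates *)

Definition nearz (z z' : Z * Z) : bool :=
  ((z.1 - z'.1) * (z.1 - z'.1) + (z.2 - z'.2) * (z.2 - z'.2) =? 1)%BZ.

Lemma near_nearz x y u v : near x y u v -> nearz (x, y) (u, v).
Proof. by rewrite /nearz => -[] /=; apply/Z.eqb_eq; lia. Qed.

Lemma nearz_near x y u v : nearz (x, y) (u, v) -> near x y u v.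
Proof.
rewrite /nearz /= => /Z.eqb_eq e.
have B (p q : Z) : (p * p + q * q = 1)%BZ -> (p = -1 \/ p = 0 \/ p = 1)%BZ.
  move=> e1; have q0 := Z.square_nonneg q.
  have [l|[l|l]] : (p <= -2 \/ 2 <= p \/ -1 <= p <= 1)%BZ by lia.
  - have : (4 <= p * p)%BZ by apply: (Z.mul_le_mono_nonpos 2 (-2)%BZ) || nia.
    by lia.
  - have : (2 * 2 <= p * p)%BZ by apply: Z.mul_le_mono_nonneg; lia.
    by lia.
  - by lia.
have [[-> ->]|[[-> ->]|[[-> ->]|[-> ->]]]] :
  (u = x + 1 /\ v = y \/ u = x + -1 /\ v = y \/ u = x /\ v = y + 1 \/ u = x /\ v = y + -1)%BZ.
- have p := B _ _ e; have := e; rewrite Z.add_comm => /B q.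
  by case: p => [h|[h|h]]; case: q => [h'|[h'|h']]; rewrite h h' /= in e; lia.
all: by constructor.
Qed.

(** A graph isomorphism onto the grid. A tetromino is brought into standard position by the choice
    of the chart, which leaves the random process untouched. *)
Record chart (phi : Z * Z -> int * int) (psi : int * int -> Z * Z) : Prop := Chart {
  ch_phi : cancel phi psi; ch_psi : cancel psi phi;
  ch_grid : forall z z', grid (phi z) (phi z') = nearz z z' }.

Section Chart.
Variables (R : realType) (T : R) (phi : Z * Z -> int * int) (psi : int * int -> Z * Z).
Hypotheses (T1 : 1 < T) (T2 : T < 4 / 3) (ch : chart phi psi).

Definition view (c : config (int * int)%type) : Z -> Z -> bool := fun x y => c (phi (x, y)).

Lemma nbhood_phi x y : nbhood grid (phi (x, y)) =
  [set` [:: phi (x + 1, y)%BZ; phi (x + -1, y)%BZ; phi (x, y + 1)%BZ; phi (x, y + -1)%BZ]].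
Proof.
apply/seteqP; split => v; rewrite /nbhood /=.
  rewrite -(ch_psi ch v) (ch_grid ch); case: (psi v) => a b /nearz_near nr.
  by case: nr; rewrite !inE eqxx ?orbT.
by rewrite !inE => /or4P[] /eqP ->; rewrite (ch_grid ch); apply: near_nearz; constructor.
Qed.

Lemma closed_phi x y w : closed_nbhood grid (phi (x, y)) w <->
  exists u v, (near x y u v \/ (u = x /\ v = y)) /\ w = phi (u, v).
Proof.
rewrite /closed_nbhood; split => [[->|]|[u [v [[nr|[-> ->]] ->]]]].
- by exists x, y; split => //; right.
- rewrite /nbhood /= -(ch_psi ch w) (ch_grid ch); case: (psi w) => a b /nearz_near nr.
  by exists a, b; split => //; left.
- by right; rewrite /nbhood /= (ch_grid ch); apply: near_nearz.
- by left.
Qed.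

Definition coop_nbn (f : Z -> Z -> bool) x y : nat :=
  (f (x + 1)%BZ y + f (x + -1)%BZ y + f x (y + 1)%BZ + f x (y + -1)%BZ)%N.

Lemma nbnE f x y : coop_nb f x y = Z.of_nat (coop_nbn f x y).
Proof.
rewrite /coop_nb /coop_nbn !Nat2Z.inj_add.
by case: (f (x + 1)%BZ y); case: (f (x + -1)%BZ y); case: (f x (y + 1)%BZ); case: (f x (y + -1)%BZ).
Qed.

Lemma score_phi c x y : score grid T c (phi (x, y)) =
  (if view c x y then 1 else T) * (coop_nbn (view c) x y)%:R.
Proof.
rewrite /score nbhood_phi -fsbig_seq; last first.
  rewrite /= !inE !(can_eq (ch_phi ch)) !xpair_eqE !negb_or andbT.
  by rewrite !eqE /=; do ?(apply/andP; split); apply/negP; lia.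
rewrite !big_cons big_nil /= addr0 /coop_nbn -/(view c (x + 1)%BZ y) -/(view c (x + -1)%BZ y).
rewrite -/(view c x (y + 1)%BZ) -/(view c x (y + -1)%BZ) -/(view c x y).
case: (view c x y); case: (view c (x + 1)%BZ y); case: (view c (x + -1)%BZ y);
  case: (view c x (y + 1)%BZ); case: (view c x (y + -1)%BZ); rewrite /= ?mul1r ?mulr0 ?addr0 ?add0r //; lra.
Qed.

Lemma nbn_le4 f x y : (coop_nbn f x y <= 4)%N.
Proof. by rewrite /coop_nbn; do 4!case: (f _ _). Qed.

Lemma payoff_D (m n : nat) : (m <= n)%N -> m%:R <= T * n%:R :> R.
Proof.
rewrite -(ler_nat R) => h; apply: le_trans h _.
by rewrite ler_peMl ?ler0n // ltW.
Qed.

(** The critical case is [n = 3], [m = 4], where the inequality is exactly [T < 4 / 3]. *)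
Lemma payoff_C (m n : nat) : (n < m)%N -> (m <= 4)%N -> T * n%:R < m%:R :> R.
Proof.
move=> nm m4; have : (n.+1)%:R <= m%:R :> R by rewrite ler_nat.
apply: lt_le_trans; have := leq_trans nm m4; move: T T1 T2 => t t1 t2.
by case: n {nm} => [|[|[|[|n]]]] nm //; lra.
Qed.

Lemma weak_view c x y : weak grid T c (phi (x, y)) <-> weakb (view c) x y.
Proof.
rewrite /weakb; set D := top_rank false (view c) x y; set C := top_rank true (view c) x y.
have Sc u v : score grid T c (phi (u, v)) = (if view c u v then 1 else T) * (coop_nbn (view c) u v)%:R.
  exact: score_phi.
have rkE a u v : view c u v = a -> (near x y u v \/ u = x /\ v = y) ->
   (coop_nb (view c) u v <= top_rank a (view c) x y)%BZ.
  by move=> e n; rewrite -(rk_eq e); apply: top_ge.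
have nn u v : (0 <= coop_nb (view c) u v)%BZ by have := nb_ge0 (view c) u v; lia.
have ex a : (0 <= top_rank a (view c) x y)%BZ -> exists u v, [/\ (near x y u v \/ u = x /\ v = y),
    view c u v = a & coop_nb (view c) u v = top_rank a (view c) x y].
  move=> l; have [u [v [n e]]] := top_ex a (view c) x y.
  have eu : view c u v = a by move: e l; rewrite /rank_as; case: eqP => // _ <-; lia.
  by exists u, v; split => //; rewrite -e rk_eq.
have self : (near x y x y \/ x = x /\ y = y) by right.
have [lt|ge] := boolP (D <? C)%BZ.
  (* A cooperator of maximal count strictly beats every defector, so all top scorers cooperate; in
     the other case a defector of maximal count is a top scorer and wins ties. *)
  move/Z.ltb_lt: lt => lt; rewrite addbT.
  have [u [v [n eu nu]]] : exists u v, [/\ (near x y u v \/ u = x /\ v = y),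
      view c u v = true & coop_nb (view c) u v = C].
    have l1 : (-1 <= D)%BZ := Z.le_trans _ _ _ (@rk_ge (view c) x y false) (@top_ge false (view c) x y x y self).
    by apply: ex; rewrite -/C; lia.
  have beat p q : (near x y p q \/ p = x /\ q = y) ->
      score grid T c (phi (p, q)) <= score grid T c (phi (u, v)) /\
      (~~ view c p q -> score grid T c (phi (p, q)) < score grid T c (phi (u, v))).
    move=> npq; rewrite !Sc eu mul1r; case E: (view c p q) => /=.
      rewrite mul1r ler_nat; split => //; have := rkE _ _ _ E npq.
      by rewrite -/C -nu !nbnE => h; lia.
    have h : T * (coop_nbn (view c) p q)%:R < (coop_nbn (view c) u v)%:R.
      apply: payoff_C; last exact: nbn_le4.
      by have := rkE _ _ _ E npq; rewrite -/D; move: lt; rewrite -nu !nbnE; lia.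
    by split=> [|_ //]; exact: ltW.
  have top_u : top_scorers grid T c (phi (x, y)) (phi (u, v)).
    split; first by apply/closed_phi; exists u, v.
    by move=> w /closed_phi[p [q [npq ->]]]; have [] := beat p q npq.
  have onlyC w : top_scorers grid T c (phi (x, y)) w -> c w.
    move=> [/closed_phi[p [q [npq ->]]] H]; apply/negPn/negP => nw.
    have [_ /(_ nw)] := beat p q npq; rewrite ltNge H //.
    by apply/closed_phi; exists u, v.
  split=> [[w [tw _]]|nf]; first by rewrite (onlyC _ tw) /view; case: (c _).
  exists (phi (u, v)); last by rewrite -/(view c u v) eu; move: nf; rewrite /view; case: (c _).
  by split => // -[w tw /negP]; rewrite onlyC.
rewrite addbF.
have ge' : (C <= D)%BZ by move: ge => /negP/Z.ltb_lt; lia.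
have [u [v [n eu nu]]] : exists u v, [/\ (near x y u v \/ u = x /\ v = y),
    view c u v = false & coop_nb (view c) u v = D].
  apply: ex; rewrite -/D; case E: (view c x y).
    by have := rkE _ _ _ E self; rewrite -/C; have := nn x y; lia.
  by have := rkE _ _ _ E self; rewrite -/D; have := nn x y; lia.
have beat p q : (near x y p q \/ p = x /\ q = y) ->
    score grid T c (phi (p, q)) <= score grid T c (phi (u, v)).
  move=> npq; rewrite !Sc eu; case E: (view c p q) => /=.
    rewrite mul1r; apply: payoff_D.
    by have := rkE _ _ _ E npq; rewrite -/C; move: ge'; rewrite -nu !nbnE; lia.
  rewrite ler_pM2l ?(lt_trans _ T1) // ler_nat.
  by have := rkE _ _ _ E npq; rewrite -/D -nu !nbnE; lia.
have top_u : top_scorers grid T c (phi (x, y)) (phi (u, v)).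
  split; first by apply/closed_phi; exists u, v.
  by move=> w /closed_phi[p [q [npq ->]]]; apply: beat.
have nu' : ~~ c (phi (u, v)) by rewrite -/(view c u v) eu.
split=> [[w [tw H]]|f].
  have := H (ex_intro2 _ _ _ top_u nu'); rewrite -/(view c x y) /view.
  by case: (c w) => //; case: (c (phi (x, y))).
by exists (phi (u, v)); [split|rewrite (negbTE nu') -/(view c x y) f].
Qed.

Lemma view_update c z : view (update grid T c (phi z)) = flip_weak (view c) z.
Proof.
apply/funext => x; apply/funext => y; rewrite /view /update /flip_weak (can_eq (ch_phi ch)).
case: z => a b /=; rewrite xpair_eqE -/(view c a b) -/(view c x y).
have -> : `[< weak grid T c (phi (a, b)) >] = weakb (view c) a b.
  by apply/asboolP/idP => /weak_view.
have E (u v : Z) : (u == v) = (u =? v)%BZ by apply/eqP/idP => /Z.eqb_eq.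
by rewrite !E.
Qed.

Lemma view_run c s : view (foldl (update grid T) c s) = run (view c) (map psi s).
Proof.
elim: s c => // v s IH c /=; rewrite IH.
by rewrite /run /= -view_update (ch_psi ch).
Qed.

Lemma view_order c s : weak_ordering grid T c s -> enum_weak (view c) (map psi s).
Proof.
move=> [us ws]; have inj : injective psi by apply: can_inj (ch_psi ch).
split; first by rewrite map_inj_uniq.
move=> [x y] /=; rewrite -(ch_phi ch (x, y)) (mem_map inj).
by apply/idP/idP => [/ws/weak_view|/weak_view/ws].
Qed.
End Chart.

(** * Numerical bounds on the potential and on the number of cells *)

Section PotentialBounds.
Variable R : realFieldType.

(** The binomial expansion of [(1 + 1/20)^n] up to second order suffices. *)
Lemma exp_rho_quad n : (n * n)%:R / 1000%:R <= (21%:R / 20%:R) ^+ n :> R.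
Proof.
apply: (@le_trans _ _ (1 + n%:R / 20 + (n%:R * n%:R - n%:R) / 800)).
  rewrite natrM; have : 0 <= n%:R :> R by rewrite ler0n.
  move: (n%:R) => x x0; have : 0 <= x * x by rewrite mulr_ge0.
  by lra.
elim: n => [|n IH]; first by rewrite expr0; lra.
rewrite exprS -natr1; set x : R := n%:R in IH *; set y := _ ^+ n in IH *.
have x0 : 0 <= x * x - x.
  by rewrite -[x in _ - x]mulr1 -mulrBr; rewrite /x; case: n {IH x y} => [|n];
     rewrite ?mul0r // mulr_ge0 ?ler0n // -natr1 addrK ler0n.
by have : 0 <= x; [rewrite ler0n|lra].
Qed.

Lemma exp_rho32 n : (n <= 32)%N -> (21%:R / 20%:R) ^+ n <= 5%:R :> R.
Proof.
move=> l; apply: (@le_trans _ _ ((21%:R / 20%:R) ^+ 32)).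
  by apply: ler_weXn2l => //; lra.
(* The fourth power is rounded up to 122/100 before taking the eighth, to keep the fractions
   small. *)
have -> : 32%N = (4 * 8)%N by [].
rewrite exprM; apply: (@le_trans _ _ ((122%:R / 100%:R) ^+ 8)).
  by apply: lerXn2r; rewrite ?nnegrE; rewrite ?exprS ?expr0; lra.
by rewrite !exprS expr0; lra.
Qed.

Lemma vt_bounds f d h : good f d h ->
  1000%:R <= ratZ R (weight (slack d h 0) (slack d h 1) (slack d h 2) (slack d h 3)) <= 3164%:R.
Proof.
move=> gd; have [If D S] := gd.
have := vt_ge1 (@Uv_ge0 f d h 0 D) (@Uv_ge0 f d h 1 D) (@Uv_ge0 f d h 2 D) (@Uv_ge0 f d h 3 D) (sokP gd).
move=> [/(ler_zr R) a /(ler_zr R) b].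
by rewrite -[1000%BZ]/(Z.of_nat 1000) -[3164%BZ]/(Z.of_nat 3164) !zr_nat in a b; rewrite a b.
Qed.
End PotentialBounds.

Lemma permutations_map (A B : eqType) (f : A -> B) (g : B -> A) (s : seq A) :
  cancel f g -> cancel g f ->
  perm_eq [seq map f t | t <- permutations s] (permutations (map f s)).
Proof.
move=> fK gK; have fi := can_inj fK.
apply: uniq_perm; rewrite ?map_inj_uniq ?permutations_uniq //; first exact: inj_map.
move=> t; rewrite mem_permutations; apply/mapP/idP => [[u]|p].
  by rewrite mem_permutations => p ->; apply: perm_map.
exists (map g t); last by rewrite mapK.
by rewrite mem_permutations -[s](mapK fK); apply: perm_map.
Qed.

Section Counting.
Variables (phi : Z * Z -> int * int) (psi : int * int -> Z * Z) (ch : chart phi psi).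
Notation view := (view phi).
Notation cf := (config (int * int)%type).

Lemma num_coop (c : cf) (l : seq (Z * Z)) : uniq l -> (forall x y, view c x y = ((x, y) \in l)) ->
  num_cooperators c = size l.
Proof.
move=> ul lE; rewrite /num_cooperators.
have -> : cooperators c = [set` map phi l].
  apply/seteqP; split => v; rewrite /cooperators /= -(ch_psi ch v) (mem_map (can_inj (ch_phi ch))).
    by case: (psi v) => x y; rewrite -lE.
  by case: (psi v) => x y; rewrite -lE.
rewrite (_ : fset_set _ = [fset v in map phi l]%fset); last first.
  by apply/fsetP => v; rewrite in_fset_set ?inE; [apply/idP/idP; rewrite inE|exact: finite_seq].
by rewrite card_fseq undup_id ?size_map // map_inj_uniq //; apply: can_inj (ch_phi ch).
Qed.

Lemma num_coop_shp (c : cf) l : uniq l -> view c = of_seq l -> num_cooperators c = size l.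
Proof. by move=> ul e; apply: num_coop => // x y; rewrite e shpE. Qed.

Lemma fin_list f d h : dims f d h -> exists l : seq (Z * Z), [/\ uniq l,
  forall x y, f x y = ((x, y) \in l) &
  (size l <= Z.to_nat (h 0%N + h 2%N) * Z.to_nat (h 1%N + h 3%N))%N].
Proof.
move=> D; have [_ [_ h0]] := D 0%N; have [_ [_ h1]] := D 1%N.
have [_ [_ h2]] := D 2%N; have [_ [_ h3]] := D 3%N.
have {}h1 x y : f x y -> (x <= h 1%N)%BZ.
  by have := h1 (- y + 1)%BZ x; rewrite /rotn /= /rot /fl /tr !fl1K.
have {}h2 x y : f x y -> (- y + 1 <= h 2%N)%BZ.
  by have := h2 (- x + 1)%BZ (- y + 1)%BZ; rewrite /rotn /= /rot /fl /tr !fl1K.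
have {}h3 x y : f x y -> (- x + 1 <= h 3%N)%BZ.
  by have := h3 y (- x + 1)%BZ; rewrite /rotn /= /rot /fl /tr !fl1K.
pose X := zrange (1 - h 3%N)%BZ (h 1%N); pose Y := zrange (1 - h 2%N)%BZ (h 0%N).
pose l := [seq z <- [seq (x, y) | x <- X, y <- Y] | f z.1 z.2].
have inj a : injective (fun i => (a + Z.of_nat i)%BZ : Z) by move=> i j; clear; lia.
have uX a b : uniq (zrange a b) by rewrite map_inj_uniq ?iota_uniq //; exact: inj.
exists l; split.
- apply: filter_uniq; apply: allpairs_uniq; rewrite ?uX //.
  by move=> [? ?] [? ?] _ _ [-> ->].
- move=> x y; rewrite mem_filter /=; case fxy: (f x y) => //=.
  apply/esym/allpairsP; exists (x, y); split => //; [change (x \in X)|change (y \in Y)].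
    by apply: mem_zrange; have := h1 _ _ fxy; have := h3 _ _ fxy; clear; lia.
  by apply: mem_zrange; have := h0 _ _ fxy; have := h2 _ _ fxy; clear; lia.
- apply: leq_trans (_ : size [seq (x, y) | x <- X, y <- Y] <= _)%N.
    by rewrite size_filter; apply: count_size.
  rewrite size_allpairs !size_map !size_iota mulnC; apply: leq_mul; clear; lia.
Qed.

(** Adding the nonnegative slacks of two opposite tips bounds twice the width, and likewise twice
    the height, of the bounding box by the sum of the four diagonal extents. *)
Lemma size_good f d h (l : seq (Z * Z)) : inv f -> dims f d h -> uniq l ->
  (forall x y, f x y = ((x, y) \in l)) ->
  (4 * size l <= Z.to_nat (d 0%N + d 1%N + d 2%N + d 3%N)%BZ * Z.to_nat (d 0%N + d 1%N + d 2%N + d 3%N)%BZ)%N.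
Proof.
move=> If D ul lE; have [l' [ul' lE' sl']] := fin_list D.
have -> : size l = size l' by apply/eqP; rewrite -uniq_size_uniq // => -[x y]; rewrite -lE -lE'.
have d02 := @dims_ge2 f d h 0 If D; have d13 := @dims_ge2 f d h 1 If D.
have := (@Uv_ge0 f d h 0 D, @Uv_ge0 f d h 1 D, @Uv_ge0 f d h 2 D, @Uv_ge0 f d h 3 D).
have [e4 h4] := dims4 0 D; rewrite !add0n in e4 h4.
rewrite /slack e4 h4 => -[[[u0 u1] u2] u3].
have : (2 * Z.to_nat (h 0%N + h 2%N) <= Z.to_nat (d 0%N + d 1%N + d 2%N + d 3%N))%N.
  clear -u0 u1 u2 u3 d02 d13; lia.
have : (2 * Z.to_nat (h 1%N + h 3%N) <= Z.to_nat (d 0%N + d 1%N + d 2%N + d 3%N))%N.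
  clear -u0 u1 u2 u3 d02 d13; lia.
move: (Z.to_nat _) (Z.to_nat _) (Z.to_nat _) sl' => n a b s1 l1 l2.
have := leq_mul l2 l1; rewrite mulnACA => /(leq_trans _); apply.
by rewrite leq_mul2l.
Qed.
End Counting.

(** * The drift condition along the process on the grid *)

Section Drift.
Variables (R : realType) (T : R) (phi : Z * Z -> int * int) (psi : int * int -> Z * Z).
Hypotheses (T1 : 1 < T) (T2 : T < 4 / 3) (ch : chart phi psi).
Notation view := (view phi).
Notation cf := (config (int * int)%type).
Notation pot := (potential R).
Notation rnd := (foldl (update grid T)).
Notation worder := (weak_ordering grid T).

Definition good_at (c : cf) := exists d h, good (view c) d h.
Definition start_at (c : cf) := exists2 p, p \in slow_tetrominoes ++ degenerate_shapes & view c = of_seq p.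

(** The drift criterion needs a function on all configurations; by [dims_uniq] the choice does not
    affect the potential. *)
Definition some_dims (f : Z -> Z -> bool) := xget (fun=> 0%BZ, fun=> 0%BZ) [set p | dims f p.1 p.2].
Definition potential_at (c : cf) : R := pot (some_dims (view c)).1 (some_dims (view c)).2.

(* 8000 exceeds by 1 every potential reached in one round from a slow tetromino. *)
Definition start_pot (n : nat) : R := if n == 4%N then 8000%:R else if n == 0%N then 0 else 50%:R.
Definition Phi (c : cf) : R :=
  if `[< good_at c >] then potential_at c - (num_cooperators c)%:R else start_pot (num_cooperators c).

Lemma dh_dims f d h : dims f d h -> dims f (some_dims f).1 (some_dims f).2.
Proof. by move=> D; rewrite /some_dims; case: xgetP => [[a b] _ //|/(_ (d, h))]. Qed.

Lemma potvE c d h : dims (view c) d h -> potential_at c = pot d h.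
Proof.
move=> D; have U := dims_uniq (dh_dims D) D.
by rewrite /potential_at; congr pot; apply/funext => k; have [] := U k.
Qed.

Lemma potv_ge c : good_at c -> 2%:R * (num_cooperators c)%:R <= potential_at c.
Proof.
move=> [d [h gd]]; have [If D S] := gd; rewrite (potvE D).
have [l [ul lE _]] := fin_list D; rewrite (num_coop ch ul lE).
have := size_good If D ul lE; rewrite -(ler_nat R) natrM.
have /andP[v0 _] := vt_bounds R gd; rewrite /potential.
move: (ratZ R _) v0 => v v0; set n := Z.to_nat _; have := exp_rho_quad R n.
have : 0 <= (n * n)%:R :> R by rewrite ler0n.
move: (_ ^+ n) ((n * n)%:R) ((size l)%:R) => q m t m0 h1 h2.
have : 500%:R * (m / 1000%:R) <= v / 2%:R * q by apply: ler_pM; lra.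
by lra.
Qed.

Lemma potv_box c l : good_at c -> view c = of_seq l -> box l -> potential_at c <= 7999%:R.
Proof.
move=> [d [h gd]] e bl; have [If D S] := gd; rewrite (potvE D).
have D' := D; rewrite e in D'; have n32 := dims_box bl D'.
have /andP[v0 v1] := vt_bounds R gd; rewrite /potential.
have := @exp_rho32 R (Z.to_nat (d 0%N + d 1%N + d 2%N + d 3%N)).
have -> : (Z.to_nat (d 0%N + d 1%N + d 2%N + d 3%N) <= 32)%N by clear -n32; lia.
move=> /(_ isT); move: (ratZ R _) v0 v1 => v v0 v1; set q := _ ^+ _ => q5.
(* Here 1582 is half the largest weight 3164; the product 7910 leaves room below 7999. *)
have : v / 2%:R * q <= 1582%:R * 5%:R by apply: ler_pM; rewrite ?exprn_ge0 //; lra.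
by lra.
Qed.

Lemma Phi_ge c : good_at c \/ start_at c -> (num_cooperators c)%:R <= Phi c.
Proof.
rewrite /Phi; case: asboolP => [g _|ng]; first by have := potv_ge g; lra.
move=> [//|[p pp e]].
have /andP[up s6] : uniq p && (size p <= 50)%N.
  have : all (fun p : seq (Z * Z) => uniq p && (size p <= 50)%N) (slow_tetrominoes ++ degenerate_shapes) by [].
  by move/allP; apply.
rewrite (num_coop_shp ch up e) /start_pot; case: eqP => [->|_]; first by rewrite ler_nat.
by case: eqP => [->//|_]; rewrite ler_nat.
Qed.

Lemma round_view c s : view (rnd c s) = run (view c) (map psi s).
Proof. exact: view_run T1 T2 ch c s. Qed.

Lemma good_round c s0 s : good_at c -> worder c s0 -> s \in permutations s0 ->
  good_at (rnd c s) /\ (num_cooperators c + (s0 != [::]) <= num_cooperators (rnd c s))%N.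
Proof.
move=> [d [h gd]] /(view_order T1 T2 ch) es0 sp; have [If D S] := gd.
have es : enum_weak (view c) (map psi s).
  by apply: perm_enum es0 _; rewrite mem_permutations; apply: perm_map; rewrite -mem_permutations.
have sp' : map psi s \in permutations (map psi s0).
  by rewrite mem_permutations; apply: perm_map; rewrite -mem_permutations.
have rd := round_of If es; have sg := shape_round If rd.
have [d' [h' D']] : exists d' h', dims (run (view c) (map psi s)) d' h'.
  have [l [ul lE _]] := fin_list D; have [_ w] := es; have [[m1 m2 _] _ _ _ _] := rd.
  pose g := run (view c) (map psi s); pose L := [seq z <- l ++ map psi s | g z.1 z.2].
  have gE : g = of_seq L.
    apply/funext => x; apply/funext => y; rewrite shpE mem_filter /=; case gxy: (g x y) => //=.
    by rewrite mem_cat -lE w; case/m2: gxy => [->//|[_ ->]]; rewrite orbT.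
  exists (diag_of_seq L), (top_of_seq L); rewrite -/g gE; apply: dims_shp.
  have [_ _ _ _ [x [y fxy]]] := If; have := m1 _ _ fxy.
  by rewrite -/(g x y) gE shpE; apply: contraTneq => ->.
have gd' := good_step gd es0 sp' D'; split; first by exists d', h'; rewrite round_view.
have [l [ul lE _]] := fin_list D; have [l' [ul' lE' _]] := fin_list D'.
rewrite (num_coop ch ul lE) (num_coop ch (l := l') ul'); last by move=> x y; rewrite round_view.
have sub : {subset l <= l'}.
  by case: rd => -[m _ _] _ _ _ _ [x y]; rewrite -lE -lE'; apply: m.
case: eqP => [_|ne]; first by rewrite addn0; apply: uniq_leq_size.
have [|x [y [gxy fxy]]] := run_grow If es.
  by move: sp => /[swap]; case: s {es sp' rd sg D' gd' lE'} => // _;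
    rewrite mem_permutations => /perm_size; case: s0 ne {es0}.
rewrite addn1 -/(size ((x, y) :: l)); apply: uniq_leq_size; first by rewrite /= ul -lE fxy.
by move=> z; rewrite inE => /predU1P[->|/sub//]; rewrite -lE'.
Qed.

Lemma pre4_round c p s : view c = of_seq p -> p \in slow_tetrominoes -> worder c s ->
  exists l, [/\ uniq l, view (rnd c s) = of_seq l, box l &
    good_b l \/ size l <> 4%N /\ l \in degenerate_shapes].
Proof.
move=> e pp /(view_order T1 T2 ch); rewrite e => /outsP[l [lo le]].
have /allP/(_ _ pp)/allP/(_ _ lo)/and3P[ul bl gl] := pre4_outs.
exists l; split => //; first by rewrite round_view e.
by case/orP: gl => [|/andP[/eqP]]; [left|right].
Qed.

Lemma smalls_round c p s : view c = of_seq p -> p \in degenerate_shapes -> worder c s ->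
  s = [::] \/ [/\ s <> [::], p <> [::] & view (rnd c s) = of_seq [::]].
Proof.
move=> e pp /(view_order T1 T2 ch); rewrite e => es.
have /allP/(_ _ pp)/and3P[_ _ /orP[/eqP w|/andP[/eqP p0 o]]] := smalls_outs.
  left; case: es => us ws; have [_ ww] := enum_wlist p; rewrite w in ww.
  case: s us ws => // v s _ /(_ (psi v)); rewrite -ww /= mem_head.
  by case: (psi v).
have [s0|s0] := eqVneq s [::]; [by left|right]; split => //; first exact/eqP.
have [l [lo le]] := outsP es.
by move/allP: o => /(_ _ lo)/eqP el; rewrite round_view e le el.
Qed.

Lemma Good_round c s : good_at c \/ start_at c -> worder c s ->
  good_at (rnd c s) \/ start_at (rnd c s).
Proof.
move=> [g|[p pp e]] ws; first by left; have [] := good_round g ws (s := s) _; rewrite ?mem_permutations.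
move: pp; rewrite mem_cat => /orP[pp|ps].
  have [l [ul le bl [gl|[_ ls]]]] := pre4_round e pp ws.
    by left; rewrite /good_at le; do 2!eexists; apply: good_bP gl.
  by right; exists l => //; rewrite mem_cat ls orbT.
have [->|[_ _ e0]] := smalls_round e ps ws; first by right; exists p => //; rewrite mem_cat ps orbT.
by right; exists [::].
Qed.

Lemma perm_worder c s0 s : worder c s0 -> s \in permutations s0 -> worder c s.
Proof.
move=> [us ws]; rewrite mem_permutations => p; split; first by rewrite (perm_uniq p).
by move=> v; rewrite (perm_mem p).
Qed.

Lemma not_good_nil c : view c = of_seq [::] -> ~ good_at c.
Proof. by move=> e [d [h [[_ _ _ _ [x [y]]]]]]; rewrite e. Qed.

Lemma Phi_drift c s0 : good_at c \/ start_at c -> worder c s0 ->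
  \sum_(s <- permutations s0) Phi (rnd c s) <= (size s0)`!%:R * (Phi c - (s0 != [::])%:R).
Proof.
move=> gc ws; have szP (K : R) : \sum_(s <- permutations s0) K = (size s0)`!%:R * K.
  by rewrite big_const_seq count_predT size_permutations ?iter_addr_0 ?mulr_natl //; case: ws.
have [g|ng] := pselect (good_at c).
  have es0 := view_order T1 T2 ch ws; have [d [h gd]] := g; have [_ D _] := gd.
  have H s : s \in permutations s0 -> Phi (rnd c s) <= potential_at (rnd c s) -
      ((num_cooperators c)%:R + (s0 != [::])%:R).
    (* The potential itself need not decrease in mean; the unit of drift comes from the cooperator
       gained, which [Phi] subtracts. *)
    move=> sp; have [g' N'] := good_round g ws sp.
    by rewrite /Phi asboolT // lerD2l lerN2 -natrD ler_nat.
  rewrite big_seq; apply: le_trans (ler_sum _ H) _; rewrite -big_seq sumrB szP.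
  rewrite /Phi asboolT // -addrA -opprD mulrBr lerD2r (potvE D) -(size_map psi s0).
  pose dd s := (some_dims (view (rnd c (map phi s)))).1; pose hh s := (some_dims (view (rnd c (map phi s)))).2.
  have -> : \sum_(s <- permutations s0) potential_at (rnd c s) =
      \sum_(s <- permutations (map psi s0)) pot (dd s) (hh s).
    rewrite -(perm_big _ (permutations_map _ (ch_psi ch) (ch_phi ch))) big_map; apply: eq_bigr => s _.
    by rewrite /dd /hh mapK //; apply: ch_psi.
  apply: (@potential_step R (view c) (map psi s0) d h dd hh gd es0) => s; rewrite mem_permutations => sp.
  have sp' : map phi s \in permutations s0.
    rewrite mem_permutations -[s0](mapK (ch_psi ch)); exact: perm_map.
  have [[d' [h' [_ D' _]]] _] := good_round g ws sp'.
  have := dh_dims D'; rewrite -/(dd s) -/(hh s) round_view (mapK (ch_phi ch)); exact.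
case: gc => [//|[p pp e]]; move: pp; rewrite mem_cat => /orP[pp|ps].
  have P8 : Phi c = 8000%:R.
    rewrite /Phi asboolF // (num_coop_shp ch (l := p)) //.
      by move: pp; rewrite !inE => /or3P[] /eqP ->.
    by move: pp; rewrite !inE => /or3P[] /eqP ->.
  apply: le_trans (_ : \sum_(s <- permutations s0) 7999%:R <= _).
    rewrite big_seq [leRHS]big_seq; apply: ler_sum => s sp.
    have [l [ul le bl gl]] := pre4_round e pp (perm_worder ws sp).
    rewrite /Phi; case: asboolP => [g|ng'].
      by apply: le_trans (potv_box g le bl); rewrite gerBl ler0n.
    rewrite (num_coop_shp ch ul le) /start_pot; case: gl => [gl|[/eqP/negbTE -> _]].
      by case: ng'; rewrite /good_at le; do 2!eexists; apply: good_bP gl.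
    by case: ifP => _; rewrite ?ler0n ?ler_nat.
  rewrite szP ler_wpM2l ?ler0n // P8.
  by rewrite lerBrDr -natrD ler_nat; case: (s0 != [::]).
have [s0E|[s00 p0 _]] := smalls_round e ps ws.
  by rewrite s0E subr0 mul1r big_seq1.
(* An unstable degenerate shape dies out within the round in every order, so its value 50 drops to
   that of the empty configuration, 0. *)
apply: le_trans (_ : \sum_(s <- permutations s0) 0 <= _).
  rewrite big_seq [leRHS]big_seq; apply: ler_sum => s sp.
  have [sE|[_ _ es]] := smalls_round e ps (perm_worder ws sp).
    by move: sp; rewrite sE mem_permutations => /perm_size/esym/size0nil.
  by rewrite /Phi asboolF ?(num_coop_shp ch (l := [::])) //; apply: not_good_nil.
rewrite szP ler_wpM2l ?ler0n // /Phi asboolF // /start_pot.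
have /allP/(_ _ ps)/and3P[up /negbTE p4 _] := smalls_outs.
rewrite (num_coop_shp ch up e) p4; case: eqP => [/size0nil//|_].
by case: (s0 != [::]) => /=; lra.
Qed.

End Drift.

(** * Connected sets of four vertices up to symmetry *)

Section Tetrominoes.
Notation cf := (config (int * int)%type).

Definition placed (c : cf) (L : seq (Z * Z)) :=
  exists phi psi, chart phi psi /\ view phi c = of_seq L.

Lemma chart_int : chart (fun z : Z * Z => (int_of_Z z.1, int_of_Z z.2))
  (fun v : int * int => (Z_of_int v.1, Z_of_int v.2)).
Proof.
split.
- by move=> [x y] /=; rewrite !int_of_ZK.
- by move=> [x y] /=; rewrite !Z_of_intK.
- move=> [x y] [u v]; rewrite /grid /nearz /= !expr2.
  by apply/eqP/idP => [e|/Z.eqb_eq e]; [apply/Z.eqb_eq|]; lia.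
Qed.

Definition shiftz (t z : Z * Z) : Z * Z := (z.1 + t.1, z.2 + t.2)%BZ.

Lemma chart_comp phi psi (g g' : Z * Z -> Z * Z) : chart phi psi ->
  cancel g g' -> cancel g' g -> (forall z z', nearz (g z) (g z') = nearz z z') ->
  chart (phi \o g) (g' \o psi).
Proof.
move=> ch gK gK' gn; split => [z|v|z z'] /=.
- by rewrite (ch_phi ch) gK.
- by rewrite gK' (ch_psi ch).
- by rewrite (ch_grid ch) gn.
Qed.

Lemma placed_comp c L (g g' : Z * Z -> Z * Z) : placed c L ->
  cancel g g' -> cancel g' g -> (forall z z', nearz (g z) (g z') = nearz z z') ->
  placed c (map g' L).
Proof.
move=> [phi [psi [ch e]]] gK gK' gn; exists (phi \o g), (g' \o psi); split; first exact: chart_comp.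
apply/funext => x; apply/funext => y; rewrite shpE -[(x, y)]gK (mem_map (can_inj gK')).
by rewrite [g _]surjective_pairing -shpE -e /view /= -surjective_pairing.
Qed.

Lemma placed_shz c L t : placed c L -> placed c (map (shiftz t) L).
Proof.
move=> h; apply: (placed_comp h (g := shiftz (- t.1, - t.2)%BZ)).
- by move=> [x y]; rewrite /shiftz /=; congr pair; lia.
- by move=> [x y]; rewrite /shiftz /=; congr pair; lia.
- by move=> [x y] [u v]; rewrite /nearz /shiftz /=; do 2!f_equal; f_equal; lia.
Qed.

Lemma trzK : involutive trz. Proof. by case. Qed.
Lemma fvzK : involutive fvz. Proof. by move=> [x y]; rewrite /fvz /=; congr pair; lia. Qed.

Lemma placed_trz c L : placed c L -> placed c (map trz L).
Proof.
move=> h; apply: (placed_comp h trzK trzK) => -[x y] [u v].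
by rewrite /nearz /= Z.add_comm.
Qed.
Lemma placed_flz c L : placed c L -> placed c (map flz L).
Proof.
move=> h; apply: (placed_comp h flzK flzK) => -[x y] [u v].
by rewrite /nearz /flz /=; f_equal; f_equal; lia.
Qed.
Lemma placed_fvz c L : placed c L -> placed c (map fvz L).
Proof.
move=> h; apply: (placed_comp h fvzK fvzK) => -[x y] [u v].
by rewrite /nearz /fvz /=; f_equal; f_equal; lia.
Qed.

Lemma placed_eq c L L' : placed c L -> L =i L' -> placed c L'.
Proof. by move=> [phi [psi [ch e]]] h; exists phi, psi; rewrite e (shp_eq h). Qed.

Definition framez (b : bool * bool * bool) (z : Z * Z) : Z * Z :=
  let: (b1, b2, b3) := b in
  let z := if b1 then trz z else z in
  let z := if b2 then flz z else z in if b3 then fvz z else z.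

Lemma placed_frz b c L : placed c L -> placed c (map (framez b) L).
Proof.
case: b => -[[] []] [] h; rewrite /framez; try by rewrite map_id.
- by rewrite (map_comp fvz) (map_comp flz); apply/placed_fvz/placed_flz/placed_trz.
- by rewrite (map_comp flz); apply/placed_flz/placed_trz.
- by rewrite (map_comp fvz); apply/placed_fvz/placed_trz.
- exact/placed_trz.
- by rewrite (map_comp fvz); apply/placed_fvz/placed_flz.
- exact/placed_flz.
- exact/placed_fvz.
Qed.

Definition frames : seq (bool * bool * bool) :=
  [seq (x, b) | x <- [seq (x, y) | x <- [:: false; true], y <- [:: false; true]], b <- [:: false; true]].
Definition shapes4 := [:: tetI; tetL; tetS; tetT; square].

(** Every shape in [shapes4] contains the origin, so only translations taking some cell of [M] there
    have to be tried. *)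
Definition is_shape4 (L : seq (Z * Z)) := has (fun b => let M := map (framez b) L in
  has (fun p => has (fun u => all (fun z => shiftz (- u.1, - u.2)%BZ z \in p) M) M) shapes4) frames.

Definition nbrs (u : Z * Z) : seq (Z * Z) :=
  [:: (u.1 + 1, u.2); (u.1 + -1, u.2); (u.1, u.2 + 1); (u.1, u.2 + -1)]%BZ.
Definition grow (Ls : seq (seq (Z * Z))) := undup (flatten
  [seq [seq rcons l z | z <- flatten (map nbrs l) & z \notin l] | l <- Ls]).

Lemma connected4 : all (fun L => is_shape4 L) (iter 3 grow [:: [:: (0, 0)%BZ]]).
Proof. by vm_compute. Qed.

Lemma grow_mem Ls l u z : l \in Ls -> u \in l -> nearz u z -> z \notin l -> rcons l z \in grow Ls.
Proof.
move=> lL ul nr zl; rewrite mem_undup; apply/flattenP.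
exists [seq rcons l z | z <- flatten (map nbrs l) & z \notin l]; first exact: (map_f _ lL).
apply: map_f; rewrite mem_filter zl; apply/flattenP; exists (nbrs u); first exact: map_f.
case: u z nr {ul zl} => [x y] [x' y'] /nearz_near[]; by rewrite /nbrs !inE eqxx ?orbT.
Qed.

Lemma is_shape4P c L : placed c L -> uniq L -> size L = 4%N -> is_shape4 L ->
  exists2 p, p \in shapes4 & placed c p.
Proof.
move=> h uL sL /hasP[b _ /hasP[p pp /hasP[u _ /allP al]]]; exists p => //.
set t := (_, _) in al; apply: (placed_eq (placed_shz t (placed_frz b h))).
have up : uniq p /\ size p = 4%N.
  have : all (fun p : seq (Z * Z) => uniq p && (size p == 4%N)) shapes4 by [].
  by move=> /allP/(_ _ pp)/andP[? /eqP].
have shK : injective (shiftz t).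
  by move=> [x y] [x' y'] [] e1 e2; congr pair; move: e1 e2; clear; lia.
have fK : injective (framez b).
  apply: (@can_inj _ _ _ (fun z => let z := if b.2 then fvz z else z in
    let z := if b.1.2 then flz z else z in if b.1.1 then trz z else z)) => z.
  by case: b {al} @t shK => -[[] []] []; rewrite /framez /fst /snd ?fvzK ?flzK ?trzK.
have [|||_ e] := @uniq_min_size _ (map (shiftz t) (map (framez b) L)) p.
- by rewrite !map_inj_uniq.
- by move=> z /mapP[w wL ->]; apply: al.
- by rewrite !size_map sL up.2.
by move=> z; rewrite e.
Qed.

(** Used to extend a proper part of a connected set by an adjacent vertex. *)
Lemma edge_out (V : eqType) (e : rel V) (B : seq V) u p :
  path e u p -> u \in B -> last u p \notin B ->
  exists x y, [/\ x \in B, y \notin B, y \in u :: p & e x y].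
Proof.
elim: p u => [|v p IH] u /=; first by move=> _ ->.
move=> /andP[uv pv] uB lB; have [vB|vB] := boolP (v \in B).
  have [x [y [xB yB yp xy]]] := IH v pv vB lB.
  by exists x, y; split => //; rewrite inE yp orbT.
by exists u, v; split => //; rewrite !inE eqxx orbT.
Qed.

(** With one vertex moved to the origin, connectedness adds adjacent vertices three times, so the
    set appears in the list enumerated by [grow]. *)
Lemma connected_shape (A : {fset int * int}) : #|` A|%fset = 4%N -> connected_in grid A ->
  exists2 p, p \in shapes4 & placed (fun v => v \in A) p.
Proof.
move=> A4 cA; pose c : cf := fun v => v \in A.
have ex (B : seq (int * int)%type) : uniq B -> {subset B <= A} -> (0 < size B < 4)%N ->
    exists x y, [/\ x \in B, y \notin B, y \in A & grid x y].
  move=> uB BA /andP[B0 B4].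
  case: B uB BA B0 B4 => // u B uB BA _ B4.
  have [v vA vB] : exists2 v, v \in A & v \notin u :: B.
    apply: contrapT => H; have : (#|` A| <= size (u :: B))%N.
      apply: uniq_leq_size => // v vA; apply/negPn/negP => vB; apply: H; by exists v.
    by rewrite A4 leqNgt B4.
  have [p [pu pA lv]] := cA u v (BA _ (mem_head _ _)) vA.
  have [|x [y [xB yB yp xy]]] := edge_out pu (mem_head u B); first by rewrite lv.
  exists x, y; split => //; move: yp; rewrite inE => /predU1P[->|/pA//].
  exact/BA/mem_head.
have [a0 a0A] : exists a, a \in A.
  by apply/fset0Pn; rewrite -cardfs_gt0 A4.
pose phi z := let w := shiftz (Z_of_int a0.1, Z_of_int a0.2) z in (int_of_Z w.1, int_of_Z w.2).
pose t := shiftz (Z_of_int a0.1, Z_of_int a0.2).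
have [psi ch] : exists psi, chart phi psi.
  exists (shiftz (- Z_of_int a0.1, - Z_of_int a0.2)%BZ \o (fun v => (Z_of_int v.1, Z_of_int v.2))).
  apply: (chart_comp (g := t) chart_int).
  - by move=> [x y]; rewrite /t /shiftz /=; congr pair; lia.
  - by move=> [x y]; rewrite /t /shiftz /=; congr pair; lia.
  - by move=> [x y] [u v]; rewrite /nearz /t /shiftz /=; do 2!f_equal; f_equal; lia.
have p0 : phi (0, 0)%BZ = a0 by rewrite /phi /= !Z_of_intK -surjective_pairing.
pose K l (n : nat) := [/\ l \in iter n grow [:: [:: (0, 0)%BZ]], uniq l, size l = n.+1 &
  forall z, z \in l -> phi z \in A].
have step l n : (n < 3)%N -> K l n -> exists l', K l' n.+1.
  move=> n3 [lg ul sl lA].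
  have [|||x [y [xB yB yA xy]]] := ex (map phi l).
  - by rewrite map_inj_uniq //; apply: can_inj (ch_phi ch).
  - by move=> v /mapP[z zl ->]; apply: lA.
  - by rewrite size_map sl.
  have [z zl xz] := mapP xB.
  have yl : psi y \notin l by apply: contra yB => h; apply/mapP; exists (psi y); rewrite ?(ch_psi ch).
  exists (rcons l (psi y)); split.
  - by apply: grow_mem lg zl _ yl; rewrite -(ch_grid ch) (ch_psi ch) -xz.
  - by rewrite rcons_uniq yl.
  - by rewrite size_rcons sl.
  - by move=> w; rewrite mem_rcons inE => /predU1P[->|/lA//]; rewrite (ch_psi ch).
have K0 : K [:: (0, 0)%BZ] 0%N.
  by split => // z; rewrite inE => /eqP ->; rewrite p0.
have [l1 K1] := step _ 0%N isT K0; have [l2 K2] := step _ 1%N isT K1.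
have [L [Lg uL sL LA]] := step _ 2%N isT K2.
have cL : placed c L.
  exists phi, psi; split => //; apply/funext => x; apply/funext => y; rewrite shpE /view /c.
  have [|||_ e] := @uniq_min_size _ (map phi L) (enum_fset A).
  - by rewrite map_inj_uniq //; apply: can_inj (ch_phi ch).
  - by move=> v /mapP[z zl ->]; apply: LA.
  - by rewrite size_map sL -A4.
  by rewrite -(mem_map (can_inj (ch_phi ch))) e.
by apply: (is_shape4P cL uL sL); have /allP := connected4; apply.
Qed.
End Tetrominoes.

(** * Two-sided estimate of the series *)

Section Series.
Variable R : realType.

Definition quad_term (j : nat) : R :=
  (7 / 8) ^+ j * (1 / 8) * ((6 * j%:R + 8) ^+ 2 + (6 * j%:R + 7) ^+ 2).

(* Solves [quad_tail j - quad_tail j.+1 = quad_term j]. *)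
Definition quad_tail (j : nat) : R := (72 * j%:R ^+ 2 + 12 * 99 * j%:R + (89 * 100 + 33)) * (7 / 8) ^+ j.

Lemma quad_term_ge0 j : 0 <= quad_term j.
Proof.
rewrite /quad_term; apply: mulr_ge0; last by rewrite addr_ge0 ?sqr_ge0.
by rewrite mulr_ge0 ?exprn_ge0 //; lra.
Qed.

Lemma quad_tail_ge0 j : 0 <= quad_tail j.
Proof.
rewrite /quad_tail; apply: mulr_ge0; last by rewrite exprn_ge0 //; lra.
have : 0 <= j%:R :> R by rewrite ler0n.
move: (j%:R) => x x0; have : 0 <= x ^+ 2 by rewrite exprn_ge0.
by lra.
Qed.

Lemma quad_sum n : \sum_(1 <= j < n.+1) quad_term j = quad_tail 1 - quad_tail n.+1.
Proof.
elim: n => [|n IH]; first by rewrite big_geq // subrr.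
rewrite big_nat_recr // IH; suff -> : quad_tail n.+1 = quad_term n.+1 + quad_tail n.+2.
  by rewrite [LHS]/= [X in _ + X = _]/=; lra.
rewrite /quad_term /quad_tail [_ ^+ n.+2]exprS -[n.+2%:R]natr1.
by move: (n.+1%:R) ((7 / 8) ^+ n.+1) => x y; rewrite !expr2; lra.
Qed.

Lemma quad_tail1 : quad_tail 1 < 8919%:R.
Proof.
have -> : 8919%:R = 89 * 100 + 19 :> R by rewrite -natrM -natrD.
by rewrite /quad_tail expr1n expr1; lra.
Qed.

(** The sum telescopes to [quad_tail 1 - quad_tail 40], that is 8918.875 minus a remainder which the
    bounds below keep under 842. *)
Lemma quad_sum_ge : 8004%:R <= \sum_(1 <= j < 40) quad_term j.
Proof.
have -> : 8004%:R = 80 * 100 + 4 :> R by rewrite -natrM -natrD.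
rewrite quad_sum /quad_tail expr1n expr1; have -> : 40%N = (5 * 8)%N by [].
rewrite exprM.
have X (x y : R) n : 0 <= x -> x <= y -> x ^+ n <= y ^+ n.
  by move=> x0 xy; apply: lerXn2r; rewrite ?nnegrE // (le_trans x0 xy).
have a1 : (7 / 8) ^+ 5 <= 513%:R / 1000%:R :> R by rewrite !exprS expr0; lra.
have a0 : 0 <= (7 / 8) ^+ 5 :> R by apply: exprn_ge0; lra.
have a2 := X _ _ 2%N a0 a1; have a02 := exprn_ge0 2 a0.
have a4 : ((7 / 8) ^+ 5) ^+ 2 <= 264%:R / 1000%:R :> R by apply: le_trans a2 _; rewrite expr2; lra.
have : ((7 / 8) ^+ 5) ^+ 8 <= (264%:R / 1000%:R) ^+ 4 :> R.
  by rewrite [leLHS](exprM _ 2 4); exact: X a02 a4.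
move: (_ ^+ 8) => y yl.
have {}yl : y <= 49 / (100 * 100) by apply: le_trans yl _; rewrite !exprS expr0; lra.
by rewrite natrM expr2; lra.
Qed.

Local Open Scope ereal_scope.
Lemma quad_series : 8004%:R%:E <= \sum_(1 <= j <oo) (quad_term j)%:E /\
  \sum_(1 <= j <oo) (quad_term j)%:E < 8919%:R%:E.
Proof.
have t0 n : true -> (1 <= n)%N -> 0 <= (quad_term n)%:E by rewrite lee_fin quad_term_ge0.
split.
  apply: le_trans (nneseries_lim_ge 40%N _) => //.
    by rewrite sumEFin lee_fin quad_sum_ge.
  by move=> *; rewrite lee_fin quad_term_ge0.
apply: le_lt_trans (_ : (quad_tail 1)%:E < _); last by rewrite lte_fin quad_tail1.
apply: lime_le; first by apply: is_cvg_nneseries => n _ _; rewrite lee_fin quad_term_ge0.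
near=> n; rewrite sumEFin lee_fin; have -> : n = n.-1.+1.
  by rewrite prednK //; near: n; exists 1%N.
by rewrite quad_sum gerBl quad_tail_ge0.
Unshelve. all: by end_near. Qed.
End Series.

Lemma shapes4_start (R : realType) phi psi (ch : chart phi psi) (c : config (int * int)%type) p :
  p \in shapes4 -> view phi c = of_seq p ->
  [/\ num_cooperators c = 4%N, good_at phi c \/ start_at phi c & Phi R phi c <= 8000%:R].
Proof.
move=> pp e; have /allP/(_ _ pp)/and3P[up bp /eqP sp] :
    all (fun p => [&& uniq p, box p & size p == 4%N]) shapes4 by vm_compute.
have N4 := num_coop_shp ch up e; rewrite sp in N4; split => //.
  rewrite /good_at e; move: pp; rewrite /shapes4 !inE => /or4P[||| /orP[]] h.
  - by right; exists p => //; rewrite (eqP h).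
  - by right; exists p => //; rewrite (eqP h).
  - by right; exists p => //; rewrite (eqP h).
  - by left; rewrite (eqP h); do 2!eexists; exact: good_bP good_tetT.
  - by left; rewrite (eqP h); do 2!eexists; exact: good_square.
rewrite /Phi; case: asboolP => [g|_]; last by rewrite N4 /start_pot eqxx.
apply: le_trans (_ : potential_at R phi c <= _); first by rewrite gerBl ler0n.
by apply: le_trans (potv_box R g e bp) _; rewrite ler_nat.
Qed.

Theorem theorem3p8 (R : realType) (T : R) (hT1 : 1 < T) (hT2 : T < 4 / 3)
    (A : {fset int * int}) (hA4 : #|` A|%fset = 4%N)
    (hAconn : connected_in grid A)
    (d : measure_display) (Omega : measurableType d) (P : probability Omega R)
    (sigma : nat -> Omega -> seq (int * int))
    (hsigma : PD_process grid T P (fun v => v \in A) sigma) :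
  let c0 : config (int * int)%type := fun v => v \in A in
  let bound : \bar R :=
    (\sum_(1 <= j <oo)
       ((7 / 8) ^+ j * (1 / 8) *
        ((6 * j%:R + 8) ^+ 2 + (6 * j%:R + 7) ^+ 2))%:E)%E in
  [/\ {ae P, forall w, stops grid T c0 (sigma ^~ w)},
      ('E_P [fun w => (num_cooperators
                (final_config grid T c0 (sigma ^~ w)))%:R] <= bound)%E
    & (bound < 8919%:R%:E)%E].
Proof.
move=> c0 bound; have [s1 s2] := quad_series R; split=> //.
  have [p pp [phi [psi [ch e]]]] := connected_shape hA4 hAconn.
  have [_ g _] := shapes4_start R ch pp e.
  exact: (process_stops (Good := fun c => good_at phi c \/ start_at phi c) (Phi := Phi R phi)
    (N := @num_cooperators _) hsigma g (Good_round hT1 hT2 ch) (Phi_drift hT1 hT2 ch) (Phi_ge R ch)).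
have [p pp [phi [psi [ch e]]]] := connected_shape hA4 hAconn.
have [N4 g P8] := shapes4_start R ch pp e.
apply: le_trans s1.
apply: le_trans (process_expectation (Good := fun c => good_at phi c \/ start_at phi c) (Phi := Phi R phi)
    (N := @num_cooperators _) hsigma g (Good_round hT1 hT2 ch) (Phi_drift hT1 hT2 ch) (Phi_ge R ch)) _.
(* The initial value of [Phi] is at most 8000, and 4 is the initial number of cooperators in
   [process_expectation]. *)
have -> : 8004%:R = 8000%:R + 4%:R :> R by rewrite -natrD.
by rewrite lee_fin N4 lerD2r.
Qed.
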